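(* Let $D\subset\mathbb{C}$ be a bounded domain, $p\in\partial D$, $\nu\in\mathcal{A}(D,p)$, and $n$ a positive integer. Assume that $\partial D$ is $C^2$-smooth near $p$. Then $$\tilde K^{(n-1)}_{D,\nu,n}(z,z)\sim\frac{1}{\nu(p)}\,\tilde K^{(n-1)}_{D,n}(z,z)\qquad\text{as } z\to p .$$
   Context: For a domain $D\subset\mathbb{C}$, $\mathcal{O}(D)$ is the space of holomorphic functions on $D$ and $dA$ is the area measure. For a positive measurable function $\mu$ on $D$, $L^2_\mu(D)$ is the space of measurable $f$ with $\int_D|f|^2\mu\,dA<\infty$, and $A^2_\mu(D)=L^2_\mu(D)\cap\mathcal{O}(D)$. The weight $\mu$ is admissible if (i) $A^2_\mu(D)$ is a closed subspace of $L^2_\mu(D)$, and (ii) for every $z\in D$ the evaluation functional $A^2_\mu(D)\ni f\mapsto f(z)\in\mathbb{C}$ is continuous. For an admissible weight $\mu$ on $D$, $\zeta\in D$ and a positive integer $n$, let $$AD^\mu(D,\zeta^n)=\Big\{f\in\mathcal{O}(D): f(\zeta)=f'(\zeta)=\cdots=f^{(n-1)}(\zeta)=0,\ \int_D|f'(z)|^2\mu(z)\,dA(z)<\infty\Big\},$$ a Hilbert space with inner product $\langle f,g\rangle=\int_D f'\,\overline{g'}\,\mu\,dA$. The functional $f\mapsto f^{(n)}(\zeta)$ is continuous on it, and $M_{D,\mu,n}(\cdot,\zeta)\in AD^\mu(D,\zeta^n)$ is the unique function with $f^{(n)}(\zeta)=\langle f,M_{D,\mu,n}(\cdot,\zeta)\rangle$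 for all $f\in AD^\mu(D,\zeta^n)$. The $n$-th order weighted reduced Bergman kernel is $\tilde K_{D,\mu,n}(z,\zeta)=\frac{\partial}{\partial z}M_{D,\mu,n}(z,\zeta)$, and $\tilde K^{(q)}_{D,\mu,n}(z,\zeta)=\frac{\partial^q}{\partial z^q}\tilde K_{D,\mu,n}(z,\zeta)$ for integers $q\ge0$. $\tilde K_{D,n}$ denotes the unweighted kernel, i.e. the case $\mu\equiv1$. For $p\in\partial D$, $\mathcal{A}(D,p)$ is the collection of all admissible weights $\mu$ on $D$ that are in $L^\infty(D)$ and extend continuously to $p$ with $\mu(p)>0$. For functions $f,g$ on $D$, $f\sim\lambda g$ as $z\to p$ means $f(z)/g(z)\to\lambda$ as $z\to p$. *)

(* Defs.v *)
From HB Require Import structures.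
From mathcomp Require Import all_boot all_order all_algebra.
From mathcomp Require Import all_classical all_reals all_analysis.
From mathcomp Require Import complex.

Set Implicit Arguments.
Unset Strict Implicit.
Unset Printing Implicit Defensive.

Import Order.TTheory GRing.Theory Num.Theory.
Import numFieldNormedType.Exports.

Local Open Scope ring_scope.
Local Open Scope classical_set_scope.
Local Open Scope complex_scope.

(* [R[i]] as a normed space over itself, so that [derivable f z 1], [derive1]
   and [derive1n] are complex differentiability and complex derivatives. *)
HB.instance Definition _ (R : realType) :=
  PseudoPointedMetric.copy R[i] R[i]^o.
HB.instance Definition _ (R : realType) := NormedModule.copy R[i] R[i]^o.

(* Lebesgue-measurable (not just Borel) sets of R^2, with the completion of the
   product of the two one-dimensional Lebesgue measures. *)
Definition plane (R : realType) :=
  caratheodory_type (mu_ext (@lebesgue_measure R \x @lebesgue_measure R)%E).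

Definition area (R : realType) : {measure set (plane R) -> \bar R} :=
  @completed_measure_extension _ _ _
    (@lebesgue_measure R \x @lebesgue_measure R)%E.

Section Definitions.
Variable R : realType.
Implicit Types (D : set R[i]) (mu : R[i] -> R) (f g m : R[i] -> R[i])
  (z zeta p : R[i]) (n q : nat).

Definition cplx (w : R * R) : R[i] := w.1 +i* w.2.

Definition modulus z : R := ComplexField.Normc.normc z.

Definition region D : set (plane R) := [set w | D (cplx w)].

Definition domain D : Prop := [/\ open D, connected D & D !=set0].

Definition boundary D : set R[i] := closure D `\` interior D.

Definition holomorphic D f : Prop := forall z, D z -> derivable f z 1.

Definition cmeasurable D f : Prop :=
  measurable_fun (region D) (fun w => complex.Re (f (cplx w))) /\
  measurable_fun (region D) (fun w => complex.Im (f (cplx w))).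

Definition cintegral D f : R[i] :=
  (\int[@area R]_(w in region D) complex.Re (f (cplx w)))%R +i*
  (\int[@area R]_(w in region D) complex.Im (f (cplx w)))%R.

(* The square of the L^2_mu(D) norm. *)
Definition L2sq D mu f : \bar R :=
  (\int[@area R]_(w in region D) (modulus (f (cplx w)) ^+ 2 * mu (cplx w))%:E)%E.

Definition L2 D mu : set (R[i] -> R[i]) :=
  [set f | cmeasurable D f /\ (L2sq D mu f < +oo)%E].

Definition A2 D mu : set (R[i] -> R[i]) := L2 D mu `&` holomorphic D.

Definition weight D mu : Prop :=
  measurable_fun (region D) (fun w => mu (cplx w)) /\
  forall z, D z -> 0 < mu z.

(* Elements of L^2 are functions up to a.e. equality, hence the a.e. equality
   below; A^2 is a linear subspace by construction. *)
Definition A2_closed D mu : Prop :=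
  forall g, L2 D mu g ->
    (forall e : R, 0 < e ->
       exists2 f, A2 D mu f & (L2sq D mu (g \- f)%R < (e ^+ 2)%:E)%E) ->
    exists2 h, A2 D mu h &
      {ae @area R, forall w, region D w -> g (cplx w) = h (cplx w)}.

Definition eval_continuous D mu z : Prop :=
  forall f, A2 D mu f -> forall e : R, 0 < e ->
    exists2 d : R, 0 < d &
      forall g, A2 D mu g -> (L2sq D mu (g \- f)%R < (d ^+ 2)%:E)%E ->
        modulus (g z - f z) < e.

Definition admissible D mu : Prop :=
  [/\ weight D mu, A2_closed D mu & forall z, D z -> eval_continuous D mu z].

Definition AD D mu n zeta : set (R[i] -> R[i]) :=
  [set f | [/\ holomorphic D f,
               forall j, (j < n)%N -> derive1n j f zeta = 0 &
               (L2sq D mu (derive1 f) < +oo)%E]].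

Definition AD_inner D mu f g : R[i] :=
  cintegral D (fun z => derive1 f z * conjc (derive1 g z) * (mu z)%:C).

(* M_{D,mu,n}(., zeta).  Uniqueness is as a function on D: functions are total
   here and the values outside D are irrelevant. *)
Definition kernelM D mu n zeta : R[i] -> R[i] :=
  xget (fun=> 0)
    [set m | AD D mu n zeta m /\
             forall f, AD D mu n zeta f -> derive1n n f zeta = AD_inner D mu f m].

Definition reduced_kernel D mu n z zeta : R[i] := derive1 (kernelM D mu n zeta) z.

Definition reduced_kernel_deriv D mu n q z zeta : R[i] :=
  derive1n q (fun u => reduced_kernel D mu n u zeta) z.

(* Only the values of [mu] on D are those of the weight; since p is not in the
   open set D, [mu p] stands for the value at p of the continuous extension. *)
Definition class_A D p mu : Prop :=
  [/\ admissible D mu,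
      exists B : R, {ae @area R, forall w, region D w -> `|mu (cplx w)| <= B},
      mu z @[z --> within D (nbhs p)] --> mu p &
      0 < mu p].

Definition C1_on (U : set (R * R)) (rho : R * R -> R) : Prop :=
  forall v : R * R, v = (1, 0) \/ v = (0, 1) ->
  forall w, U w -> derivable rho w v /\ {for w, continuous ('D_v rho)}.

Definition C2_on (U : set (R * R)) (rho : R * R -> R) : Prop :=
  [/\ C1_on U rho, C1_on U ('D_((1, 0) : R * R) rho) &
      C1_on U ('D_((0, 1) : R * R) rho)].

(* Existence of a local C^2 defining function near p. *)
Definition C2_boundary_near D p : Prop :=
  exists (U : set (R * R)) (rho : R * R -> R),
    [/\ open U, U (complex.Re p, complex.Im p), C2_on U rho,
        forall w, U w ->
          'D_((1, 0) : R * R) rho w <> 0 \/ 'D_((0, 1) : R * R) rho w <> 0 &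
        forall w, U w -> (D (cplx w) <-> rho w < 0)].

(* f ~ lambda g as z -> p, z in D. *)
Definition sim D p (lambda : R[i]) f g : Prop :=
  f z / g z @[z --> within D (nbhs p)] --> lambda.

End Definitions.

(* Main.v *)
(* The value K(z,z) of the (n-1)-st derivative of the reduced kernel on the
   diagonal is 1 / m(z), where m(z) is the least energy int_D |f'|^2 mu dA among
   the f in AD(D, z^n) with f^(n)(z) = 1. Close to p, the C^2 boundary lies
   between two tangent discs, one inside and one outside, and the Moebius map W
   with W(z) = 0 and pole at the reflection c = z + d of z turns them into
   concentric discs about 0 whose radii have ratio tending to 1 as z -> p. On a
   disc about 0 the extremal function is a multiple of w^n, so restricting a
   competitor to the inner disc bounds m(z) from below, and W^n/n, whose
   derivative stays comparatively small away from p, bounds it from above. Only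
   the values of mu near p matter in both bounds, and hence
   m_nu(z) / m_1(z) -> nu(p). *)
From HB Require Import structures.
Require Import Defs.
From mathcomp Require Import all_boot all_order all_algebra.
From mathcomp Require Import all_classical all_reals all_analysis.
From mathcomp Require Import measurable_realfun complex zify ring lra.

Set Implicit Arguments.
Unset Strict Implicit.
Unset Printing Implicit Defensive.

Import Order.TTheory GRing.Theory Num.Theory.
Import numFieldNormedType.Exports.

Local Open Scope ring_scope.
Local Open Scope classical_set_scope.
Local Open Scope complex_scope.

(** * Complex differentiability *)

(** The value on the diagonal is [1 / m] because the minimiser [F], divided by its energy,
    represents the functional f -> f^(n)(zeta). Admissibility gives continuity of each evaluation
    separately, while limits of derivatives need bounds uniform near each point; a uniform
    boundedness argument bridges the gap. The limit is found for F' and must be integrated back on a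
    domain that may have holes, which works because it is a limit of derivatives. The size of [m]
    near p is never expressed intrinsically: for each [zeta] both weights are compared with one
    number [x], independent of the weight, which cancels in the quotient. The test function lives on
    all of D, so the outer disc has to capture all of D and not just the part near p; enlarging the
    curvature constant achieves this, and the part far from p contributes a relative error of order
    |d|^2. Planar changes of variables are reduced to one-dimensional substitutions along the lines
    y = t x. This gives polar coordinates with a signed radius and an angle in ]-pi/2, pi/2[, hence
    the half circles and symmetrized integrands throughout. *)

Section Modulus.
Context {R : realType}.
Implicit Types (z w : R[i]) (x y : R).
Local Notation N := (@modulus R).

Lemma normcE z : `|z| = (N z)%:C.
Proof. by case: z. Qed.

Lemma modulus_ge0 z : 0 <= N z.
Proof. by case: z => a b; rewrite /modulus sqrtr_ge0. Qed.

Lemma modulus_sqr z : N z ^+ 2 = complex.Re z ^+ 2 + complex.Im z ^+ 2.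
Proof. by case: z => a b; rewrite /modulus /= sqr_sqrtr // addr_ge0 ?sqr_ge0. Qed.

Lemma modulus0 : N 0 = 0.
Proof. exact: ComplexField.Normc.normc0. Qed.

Lemma modulus1 : N 1 = 1.
Proof. exact: ComplexField.Normc.normc1. Qed.

Lemma modulus_eq0 z : (N z == 0) = (z == 0).
Proof.
apply/eqP/eqP => [|->]; last exact: modulus0.
exact: ComplexField.Normc.eq0_normc.
Qed.

Lemma modulus_gt0 z : (0 < N z) = (z != 0).
Proof. by rewrite lt_def modulus_ge0 andbT modulus_eq0. Qed.

Lemma modulusM z w : N (z * w) = N z * N w.
Proof. exact: ComplexField.Normc.normcM. Qed.

Lemma modulusV z : N z^-1 = (N z)^-1.
Proof. exact: ComplexField.Normc.normcV. Qed.

Lemma modulusN z : N (- z) = N z.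
Proof. by case: z => a b; rewrite /modulus /= !sqrrN. Qed.

Lemma modulusBC z w : N (z - w) = N (w - z).
Proof. by rewrite -modulusN opprB. Qed.

Lemma modulusD z w : N (z + w) <= N z + N w.
Proof. exact: le_normcD. Qed.

Lemma modulusB z w : N (z - w) <= N z + N w.
Proof. by rewrite -(modulusN w) modulusD. Qed.

Lemma modulus_dist z w : N z - N w <= N (z - w).
Proof. by rewrite lerBlDr -{1}(subrK w z) modulusD. Qed.

Lemma modulusX z n : N (z ^+ n) = N z ^+ n.
Proof. by elim: n => [|n IH]; rewrite ?expr0 ?modulus1// !exprS modulusM IH. Qed.

Lemma modulus_real x : N x%:C = `|x|.
Proof. by rewrite /modulus /= expr0n /= addr0 sqrtr_sqr. Qed.

Lemma modulus_conj z : N (conjc z) = N z.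
Proof. by case: z => a b; rewrite /modulus /= sqrrN. Qed.

Lemma modulus_Re z : `|complex.Re z| <= N z.
Proof. by case: z => a b; rewrite /modulus /= -[leLHS]sqrtr_sqr ler_wsqrtr // lerDl sqr_ge0. Qed.

Lemma modulus_Im z : `|complex.Im z| <= N z.
Proof. by case: z => a b; rewrite /modulus /= -[leLHS]sqrtr_sqr ler_wsqrtr // lerDr sqr_ge0. Qed.

Lemma modulus_le z : N z <= `|complex.Re z| + `|complex.Im z|.
Proof.
rewrite -(@ler_pXn2r _ 2) ?nnegrE ?modulus_ge0 ?addr_ge0 //.
rewrite modulus_sqr -(real_normK (num_real (complex.Re z))).
rewrite -(real_normK (num_real (complex.Im z))) sqrrD.
by rewrite -addrA [X in _ <= _ + X]addrC addrA lerDl pmulrn_lge0 // mulr_ge0.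
Qed.

Lemma normc_lt z x : (`|z| < x%:C) = (N z < x).
Proof. by rewrite normcE ltcR. Qed.

Lemma gt0_complexP (e : R[i]) : 0 < e -> exists2 x : R, 0 < x & e = x%:C.
Proof.
case: e => a b; rewrite ltcE /= => /andP[/eqP -> a0]; by exists a.
Qed.

End Modulus.

Section Cdiff.
Context {R : realType}.
Implicit Types (z w l : R[i]) (f g : R[i] -> R[i]).
Local Notation N := (@modulus R).

(** A remainder bound in real numbers and without a quotient: [w = z] is allowed, and sums,
    products, compositions and limits become plain inequalities. *)
Definition cdiff f z l := forall e : R, 0 < e -> exists2 d : R, 0 < d &
  forall w, N (w - z) < d -> N (f w - f z - l * (w - z)) <= e * N (w - z).

Lemma cdiff_is_derive f z l : cdiff f z l ->
  (fun h => h^-1 *: (f (h *: 1 + z) - f z)) @ 0^' --> l.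
Proof.
move=> fzl; apply/cvgrPdist_lt => e /gt0_complexP[x x0 ->].
have [d d0 H] := fzl (x / 2) ltac:(by rewrite divr_gt0).
near=> h.
have h0 : h != 0 by near: h; exact: nbhs_dnbhs_neq.
have hd : N h < d.
  by rewrite -normc_lt; near: h; apply: (@dnbhs0_lt _ R[i]); rewrite ltcR.
rewrite normc_lt modulusBC.
have -> : h^-1 *: (f (h *: 1 + z) - f z) - l = h^-1 * (f (h + z) - f z - l * h).
  rewrite mulrBr [l * h]mulrC mulKf //.
  by congr (_ *: (f (_ + _) - _) - _); rewrite -[LHS]/(h * 1) mulr1.
rewrite modulusM modulusV.
have := H (h + z); rewrite addrK => /(_ hd) H1.
rewrite mulrC ltr_pdivrMr ?modulus_gt0 //; apply: le_lt_trans H1 _.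
by rewrite ltr_pM2r ?modulus_gt0 // ltr_pdivrMr // ltr_pMr // ltr1n.
Unshelve. all: by end_near. Qed.

Lemma cdiff_derivable f z l : cdiff f z l -> derivable f z 1.
Proof. by move=> /cdiff_is_derive h; apply/cvg_ex; exists l. Qed.

Lemma cdiff_derive1 f z l : cdiff f z l -> derive1 f z = l.
Proof.
move=> /cdiff_is_derive h; rewrite derive1E; exact: cvg_lim.
Qed.

Lemma derivable_cdiff f z : derivable f z 1 -> cdiff f z (derive1 f z).
Proof.
move=> df e e0; rewrite derive1E.
have := df; rewrite /derivable => /cvgrPdist_lt /(_ e%:C).
rewrite ltcR => /(_ e0) [d /= d0 H].
rewrite -/('D_1 f z) in H.
have [x x0 dE] := gt0_complexP d0.
exists x => // w wzx.
have [->|wz] := eqVneq w z; first by rewrite !subrr mulr0 subr0 modulus0 mulr0.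
have wz0 : w - z != 0 by rewrite subr_eq0.
have := H (w - z); rewrite /ball_ /= sub0r normrN dE normc_lt => /(_ wzx wz0).
rewrite normc_lt (modulusBC ('D_1 f z)).
have -> : (w - z)^-1 *: (f ((w - z) *: 1 + z) - f z) - 'D_1 f z =
    (w - z)^-1 * (f w - f z - 'D_1 f z * (w - z)).
  rewrite mulrBr ['D_1 f z * _]mulrC mulKf //.
  by congr (_ *: (f _ - _) - _); rewrite -[_ *: 1]/((w - z) * 1) mulr1 subrK.
rewrite modulusM modulusV mulrC ltr_pdivrMr ?modulus_gt0 //.
exact: ltW.
Qed.

Lemma open_modulus (A : set R[i]) : open A <->
  (forall z, A z -> exists2 d : R, 0 < d & forall w, N (w - z) < d -> A w).
Proof.
split=> [oA z Az|H].
  have : nbhs z A by exact: open_nbhs_nbhs.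
  move=> /nbhs_ballP[d /= /gt0_complexP[x x0 ->] H].
  by exists x => // w wz; apply: H; rewrite -ball_normE /ball_ /= normc_lt modulusBC.
rewrite openE => z /H[d d0 Hd]; apply/nbhs_ballP; exists d%:C => /=; first by rewrite ltcR.
by move=> w; rewrite -ball_normE /ball_ /= normc_lt modulusBC; exact: Hd.
Qed.

Lemma cdiff_cst (c : R[i]) z : cdiff (fun=> c) z 0.
Proof.
move=> e e0; exists 1 => // w _; rewrite subrr mul0r subr0 modulus0.
by rewrite mulr_ge0 ?modulus_ge0 // ltW.
Qed.

Lemma cdiff_id z : cdiff id z 1.
Proof.
move=> e e0; exists 1 => // w _; rewrite mul1r subrr modulus0.
by rewrite mulr_ge0 ?modulus_ge0 // ltW.
Qed.

Lemma cdiffD f g z l m : cdiff f z l -> cdiff g z m -> cdiff (f \+ g) z (l + m).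
Proof.
move=> df dg e e0; have e20 : 0 < e / 2 by rewrite divr_gt0.
have [d1 d10 H1] := df _ e20; have [d2 d20 H2] := dg _ e20.
exists (Num.min d1 d2); first by rewrite lt_min d10.
move=> w; rewrite lt_min => /andP[/H1 h1 /H2 h2].
rewrite (splitr e) [leRHS]mulrDl; apply: (le_trans _ (lerD h1 h2)).
apply: (le_trans _ (modulusD _ _)); rewrite le_eqVlt; apply/orP; left; apply/eqP.
by congr modulus; rewrite /=; ring.
Qed.

Lemma cdiff_lip f z l : cdiff f z l -> exists2 d : R, 0 < d &
  forall w, N (w - z) < d -> N (f w - f z) <= (N l + 1) * N (w - z).
Proof.
move=> df; have [d d0 H] := df 1 ltr01; exists d => // w /H h.
have -> : f w - f z = l * (w - z) + (f w - f z - l * (w - z)) by ring.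
by rewrite mulrDl -modulusM; apply: le_trans (modulusD _ _) _; rewrite lerD2l.
Qed.

Lemma cdiff_cont f z l : cdiff f z l -> forall e : R, 0 < e -> exists2 d : R, 0 < d &
  forall w, N (w - z) < d -> N (f w - f z) < e.
Proof.
move=> /cdiff_lip[d d0 H] e e0; have l0 : 0 < N l + 1 by rewrite ltr_wpDl ?modulus_ge0.
exists (Num.min d (e / (N l + 1))); first by rewrite lt_min d0 divr_gt0.
move=> w; rewrite lt_min => /andP[/H h]; rewrite ltr_pdivlMr // mulrC.
exact: le_lt_trans.
Qed.

Lemma cdiff_comp f g z l m : cdiff f z l -> cdiff g (f z) m -> cdiff (g \o f) z (m * l).
Proof.
move=> df dg e e0.
have [d1 d10 H1] := cdiff_lip df.
set K := N l + 1; have K0 : 0 < K by rewrite ltr_wpDl ?modulus_ge0.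
set M := N m + 1; have M0 : 0 < M by rewrite ltr_wpDl ?modulus_ge0.
have [d2 d20 H2] := dg (e / (2 * K)) ltac:(by rewrite divr_gt0 // mulr_gt0).
have [d3 d30 H3] := df (e / (2 * M)) ltac:(by rewrite divr_gt0 // mulr_gt0).
exists (Num.min d1 (Num.min (d2 / K) d3)); first by rewrite !lt_min d10 d30 divr_gt0.
move=> w; rewrite !lt_min => /and3P[/H1 h1]; rewrite ltr_pdivlMr // mulrC => w2 /H3 h3.
have {H2} h2 := H2 _ (le_lt_trans h1 w2).
have -> : (g \o f) w - (g \o f) z - m * l * (w - z) =
  (g (f w) - g (f z) - m * (f w - f z)) + m * (f w - f z - l * (w - z)).
  by rewrite /=; ring.
apply: le_trans (modulusD _ _) _; rewrite modulusM (splitr e) mulrDl lerD //.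
  apply: le_trans h2 _; rewrite -/K in h1.
  apply: le_trans (ler_wpM2l _ h1) _; first by rewrite divr_ge0 ?ltW // mulr_gt0.
  rewrite le_eqVlt; apply/orP; left; apply/eqP; field; by rewrite gt_eqF.
apply: le_trans (_ : M * (e / (2 * M) * N (w - z)) <= _).
  by rewrite ler_pM ?modulus_ge0 // /M lerDl.
rewrite le_eqVlt; apply/orP; left; apply/eqP; field; by rewrite gt_eqF.
Qed.

(** The remainder of a product is made of the two first-order remainders and the product of the
    increments, which is small because g is Lipschitz and f continuous at z. Each of the three gets
    a third of [e]. *)
Lemma cdiffM f g z l m : cdiff f z l -> cdiff g z m ->
  cdiff (f \* g) z (l * g z + f z * m).
Proof.
move=> df dg e e0.
set A := N (g z) + 1; have A0 : 0 < A by rewrite ltr_wpDl ?modulus_ge0.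
set B := N (f z) + 1; have B0 : 0 < B by rewrite ltr_wpDl ?modulus_ge0.
set C := N m + 1; have C0 : 0 < C by rewrite ltr_wpDl ?modulus_ge0.
have [d1 d10 H1] := df (e / (3 * A)) ltac:(by rewrite divr_gt0 // mulr_gt0).
have [d2 d20 H2] := dg (e / (3 * B)) ltac:(by rewrite divr_gt0 // mulr_gt0).
have [d3 d30 H3] := cdiff_lip dg.
have [d4 d40 H4] := cdiff_cont df (e := e / (3 * C)) ltac:(by rewrite divr_gt0 // mulr_gt0).
exists (Num.min (Num.min d1 d2) (Num.min d3 d4)); first by rewrite !lt_min d10 d20 d30.
move=> w; rewrite !lt_min => /andP[/andP[/H1 h1 /H2 h2] /andP[/H3 h3 /H4 h4]].
have -> : (f \* g) w - (f \* g) z - (l * g z + f z * m) * (w - z) =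
  (f w - f z - l * (w - z)) * g z + f z * (g w - g z - m * (w - z)) +
  (f w - f z) * (g w - g z).
  by rewrite /=; ring.
have -> : e * N (w - z) = (e / (3 * A) * N (w - z)) * A + B * (e / (3 * B) * N (w - z))
   + (e / (3 * C)) * (C * N (w - z)).
  by field; rewrite !gt_eqF.
apply: le_trans (modulusD _ _) _; apply: lerD; last first.
  by rewrite modulusM ler_pM ?modulus_ge0 // ltW.
apply: le_trans (modulusD _ _) _.
by apply: lerD; rewrite modulusM ler_pM ?modulus_ge0 // /A /B lerDl.
Qed.

(** The remainder is exactly (w - z)^2 / (w z^2). The first bound on |w - z| keeps |w| above |z| /
    2, the second makes the remainder at most e |w - z|. *)
Lemma cdiffV z : z != 0 -> cdiff (fun w => w^-1) z (- z ^- 2).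
Proof.
move=> z0 e e0; have Nz : 0 < N z by rewrite modulus_gt0.
exists (Num.min (N z / 2) (e * N z ^+ 3 / 2)).
  by rewrite lt_min !divr_gt0 // mulr_gt0 // exprn_gt0.
move=> w; rewrite lt_min => /andP[h1 h2].
have Nw : N z / 2 < N w.
  have := modulus_dist z w; rewrite modulusBC => h3.
  move: h1 h3; set a := N (w - z); move: (N z) (N w) => b c; lra.
have w0 : w != 0 by rewrite -modulus_gt0; apply: lt_trans Nw; rewrite divr_gt0.
have -> : w^-1 - z^-1 - - z ^- 2 * (w - z) = (w - z) ^+ 2 * (w * z ^+ 2)^-1.
  by field; rewrite w0 z0.
rewrite modulusM modulusV !modulusX modulusM modulusX.
have Nw0 : 0 < N w by rewrite modulus_gt0.
rewrite ler_pdivrMr ?mulr_gt0 ?exprn_gt0 //.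
have -> : e * N (w - z) * (N w * N z ^+ 2) = N (w - z) * (e * (N w * N z ^+ 2)) by ring.
rewrite expr2 ler_wpM2l ?modulus_ge0 //; apply: le_trans (ltW h2) _.
have -> : e * N z ^+ 3 / 2 = e * (N z / 2 * N z ^+ 2) by field.
by rewrite ler_wpM2l ?(ltW e0) // ler_wpM2r ?exprn_ge0 ?modulus_ge0 ?ltW.
Qed.

Lemma cdiff_ext f g z l d : 0 < d -> (forall w, N (w - z) < d -> f w = g w) ->
  cdiff f z l -> cdiff g z l.
Proof.
move=> d0 fg df e /df[d1 d10 H]; exists (Num.min d d1); first by rewrite lt_min d0.
move=> w; rewrite lt_min => /andP[wd /H]; rewrite !fg //.
by rewrite subrr modulus0.
Qed.

Lemma cdiffZ (c : R[i]) f z l : cdiff f z l -> cdiff (fun w => c * f w) z (c * l).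
Proof.
by move=> df; have := cdiffM (cdiff_cst c z) df; rewrite mul0r add0r.
Qed.

Lemma cdiffN f z l : cdiff f z l -> cdiff (fun w => - f w) z (- l).
Proof.
move=> df; have := cdiffZ (-1) df; rewrite mulN1r.
by apply: (@cdiff_ext _ _ _ _ 1) => // w _; rewrite mulN1r.
Qed.

Lemma cdiffB f g z l m : cdiff f z l -> cdiff g z m -> cdiff (f \- g) z (l - m).
Proof. by move=> df dg; exact: cdiffD df (cdiffN dg). Qed.

Lemma cdiffX n z : cdiff (fun w => w ^+ n) z (n%:R * z ^+ n.-1).
Proof.
elim: n => [|n IH]; first by rewrite mul0r; exact: cdiff_cst.
have := cdiffM (cdiff_id z) IH.
have -> : 1 * z ^+ n + id z * (n%:R * z ^+ n.-1) = n.+1%:R * z ^+ n.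
  rewrite -natr1; case: n {IH} => [|n] /=; first by rewrite expr0; ring.
  by rewrite exprS; ring.
by apply: (@cdiff_ext _ _ _ _ 1) => // w _; rewrite /= exprS.
Qed.

End Cdiff.

(** * Integrals over segments and Goursat's lemma *)
Section RealAnalysis.
Context {R : realType}.
Implicit Types (f g : R -> R) (a b x : R).
Local Notation mu := (@lebesgue_measure R).

Lemma continuous_atP f x : {for x, continuous f} <->
  (forall e : R, 0 < e -> exists2 d : R, 0 < d &
    forall y, `|y - x| < d -> `|f y - f x| < e).
Proof.
split=> [/cvgrPdist_lt cf e e0|H].
  have [d /= d0 Hd] := cf e e0; exists d => // y yx.
  by rewrite distrC; apply: Hd; rewrite /= distrC.
apply/cvgrPdist_lt => e e0; have [d d0 Hd] := H e e0.
by exists d => //= y yx; rewrite distrC; apply: Hd; rewrite distrC.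
Qed.

Definition rdiff f x l := forall e : R, 0 < e -> exists2 d : R, 0 < d &
  forall y, `|y - x| < d -> `|f y - f x - l * (y - x)| <= e * `|y - x|.

Lemma rdiff_is_derive f x l : rdiff f x l -> is_derive x 1 f l.
Proof.
move=> fxl.
suff h : (fun h => h^-1 *: (f (h *: 1 + x) - f x)) @ 0^' --> l.
  apply: DeriveDef; first by apply/cvg_ex; exists l.
  exact: cvg_lim.
apply/cvgrPdist_lt => e e0.
have [d d0 H] := fxl (e / 2) ltac:(by rewrite divr_gt0).
near=> h.
have h0 : h != 0 by near: h; exact: nbhs_dnbhs_neq.
have hd : `|h| < d by near: h; exact: dnbhs0_lt.
rewrite distrC.
have -> : h^-1 *: (f (h *: 1 + x) - f x) - l = h^-1 * (f (h + x) - f x - l * h).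
  rewrite mulrBr [l * h]mulrC mulKf //.
  by congr (_ *: (f (_ + _) - _) - _); rewrite -[LHS]/(h * 1) mulr1.
rewrite normrM normfV.
have := H (h + x); rewrite addrK => /(_ hd) H1.
rewrite mulrC ltr_pdivrMr ?normr_gt0 //; apply: le_lt_trans H1 _.
by rewrite ltr_pM2r ?normr_gt0 // ltr_pdivrMr // ltr_pMr // ltr1n.
Unshelve. all: by end_near. Qed.

Lemma is_derive_rdiff f x l : is_derive x 1 f l -> rdiff f x l.
Proof.
move=> [df fl] e e0.
have := df; rewrite /derivable => /cvgrPdist_lt /(_ e e0) [d /= d0 H].
rewrite -/('D_1 f x) fl in H.
exists d => // w wzx.
have [->|wz] := eqVneq w x; first by rewrite !subrr mulr0 subr0 normr0 mulr0.
have wz0 : w - x != 0 by rewrite subr_eq0.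
have := H (w - x); rewrite /ball_ /= sub0r normrN => /(_ wzx wz0).
rewrite (distrC l).
have -> : (w - x)^-1 *: (f ((w - x) *: 1 + x) - f x) - l =
    (w - x)^-1 * (f w - f x - l * (w - x)).
  rewrite mulrBr [l * _]mulrC mulKf //.
  by congr (_ *: (f _ - _) - _); rewrite -[_ *: 1]/((w - x) * 1) mulr1 subrK.
rewrite normrM normfV mulrC ltr_pdivrMr ?normr_gt0 //.
exact: ltW.
Qed.

Lemma is_derive_continuous f x l : is_derive x 1 f l -> {for x, continuous f}.
Proof.
move=> [df _]; apply: differentiable_continuous; exact/derivable1_diffP.
Qed.

(** Two-sided continuity at every point of the closed segment, endpoints included, so that it
    restricts to subsegments with no one-sided cases. *)
Definition contseg f a b := forall x, a <= x <= b -> {for x, continuous f}.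

Definition intg f a b : R := (\int[mu]_(x in `[a, b]) f x)%R.

Lemma contseg_within f a b : contseg f a b -> {within `[a, b], continuous f}.
Proof.
move=> cf; apply: continuous_in_subspaceT => x; rewrite inE /= in_itv /=.
exact: cf.
Qed.

Lemma contseg_sub f a b c d : a <= c -> d <= b -> contseg f a b -> contseg f c d.
Proof.
move=> ac db cf x /andP[cx xd]; apply: cf; rewrite (le_trans ac cx).
exact: le_trans xd db.
Qed.

Lemma contseg_integrable f a b : contseg f a b -> mu.-integrable `[a, b] (EFin \o f).
Proof.
move=> /contseg_within cf; apply: continuous_compact_integrable => //.
exact: segment_compact.
Qed.

Lemma intg_split f a b c : a <= c -> c <= b -> contseg f a b ->
  intg f a b = intg f a c + intg f c b.
Proof.
move=> ac cb cf; have intf := contseg_integrable cf.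
rewrite /intg -[X in _ = _ + X]Rintegral_itv_obnd_cbnd; last first.
  apply: integrableS intf => //; apply: subset_itvr; rewrite bnd_simp //.
have := @Rintegral_itvB _ f (BLeft a) (BRight b) c intf.
by rewrite !bnd_simp => <- //; rewrite addrC subrK.
Qed.

Lemma intg_cst k a b : a <= b -> intg (fun=> k) a b = k * (b - a).
Proof.
move=> ab; rewrite /intg Rintegral_cst //= lebesgue_measure_itv /= lte_fin.
case: ltP => [_|ba] //=.
by rewrite (@le_anti _ _ a b) ?ab ?ba // subrr.
Qed.

Lemma contseg_cst k a b : contseg (fun=> k) a b.
Proof. by move=> x _; exact: cst_continuous. Qed.

Lemma contsegD f g a b : contseg f a b -> contseg g a b -> contseg (fun x => f x + g x) a b.
Proof. by move=> cf cg x xab; apply: cvgD; [exact: cf|exact: cg]. Qed.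

Lemma contsegB f g a b : contseg f a b -> contseg g a b -> contseg (fun x => f x - g x) a b.
Proof. by move=> cf cg x xab; apply: cvgB; [exact: cf|exact: cg]. Qed.

Lemma contsegM f g a b : contseg f a b -> contseg g a b -> contseg (fun x => f x * g x) a b.
Proof. by move=> cf cg x xab; apply: cvgM; [exact: cf|exact: cg]. Qed.

Lemma contsegN f a b : contseg f a b -> contseg (fun x => - f x) a b.
Proof. by move=> cf x xab; apply: cvgN; exact: cf. Qed.

Lemma intgD f g a b : contseg f a b -> contseg g a b ->
  intg (fun x => f x + g x) a b = intg f a b + intg g a b.
Proof. by move=> cf cg; rewrite /intg RintegralD //; exact: contseg_integrable. Qed.

Lemma intgB f g a b : contseg f a b -> contseg g a b ->
  intg (fun x => f x - g x) a b = intg f a b - intg g a b.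
Proof. by move=> cf cg; rewrite /intg RintegralB //; exact: contseg_integrable. Qed.

Lemma intgZ k f a b : contseg f a b ->
  intg (fun x => k * f x) a b = k * intg f a b.
Proof. by move=> cf; rewrite /intg RintegralZl //; exact: contseg_integrable. Qed.

Lemma le_intg f g a b : contseg f a b -> contseg g a b ->
  (forall x, a <= x <= b -> f x <= g x) -> intg f a b <= intg g a b.
Proof.
move=> cf cg fg; apply: le_Rintegral; [by []|exact: contseg_integrable|exact: contseg_integrable|].
by move=> x /=; rewrite in_itv; exact: fg.
Qed.

Lemma intg_near f a b (k e : R) : a <= b -> contseg f a b ->
  (forall x, a <= x <= b -> `|f x - k| <= e) -> `|intg f a b - k * (b - a)| <= e * (b - a).
Proof.
move=> ab cf H; rewrite ler_distl -mulrBl -mulrDl -!intg_cst //.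
apply/andP; split; (apply: le_intg => //; first exact: contseg_cst);
  by move=> x /H; rewrite ler_distl => /andP[].
Qed.

Lemma intg_FTC (F f : R -> R) a b : a < b -> (forall x, a <= x <= b -> is_derive x 1 F (f x)) ->
  contseg f a b -> intg f a b = F b - F a.
Proof.
move=> ab dF cf; rewrite /intg /Rintegral (@continuous_FTC2 _ f F) //.
- exact: contseg_within.
- have cF x : a <= x <= b -> {for x, continuous F}.
    by move=> /dF; exact: is_derive_continuous.
  split.
  + by move=> x; rewrite in_itv /= => /andP[ax xb]; have [] := dF x ltac:(by rewrite !ltW).
  + by apply: cvg_at_right_filter; apply: cF; rewrite lexx ltW.
  + by apply: cvg_at_left_filter; apply: cF; rewrite lexx ltW.
- move=> x; rewrite in_itv /= => /andP[ax xb].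
  have h := dF x ltac:(by rewrite !ltW).
  by rewrite derive1E; have [_ ->] := h.
Qed.

(** Total differentiability at one point, nothing being asked of the partial derivatives nearby:
    this is exactly what complex differentiability provides. *)
Definition rdiff2 (P : R -> R -> R) x0 y0 a b := forall e : R, 0 < e -> exists2 d : R, 0 < d &
  forall x y, `|x - x0| < d -> `|y - y0| < d ->
    `|P x y - P x0 y0 - a * (x - x0) - b * (y - y0)| <= e * (`|x - x0| + `|y - y0|).

Lemma rdiff2_l P x0 y0 a b : rdiff2 P x0 y0 a b -> rdiff (P^~ y0) x0 a.
Proof.
move=> dP e /dP[d d0 H]; exists d => // x xd; have := H x y0 xd.
by rewrite !subrr !normr0 mulr0 subr0 addr0; exact.
Qed.

Lemma rdiff2_r P x0 y0 a b : rdiff2 P x0 y0 a b -> rdiff (P x0) y0 b.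
Proof.
move=> dP e /dP[d d0 H]; exists d => // y yd; have := H x0 y _ yd.
by rewrite !subrr !normr0 mulr0 subr0 add0r; exact.
Qed.

(** * Goursat's lemma for rectangles, by bisection *)

Section Goursat.
Variables (P Q : R -> R -> R) (x1 y1 H K : R).
Hypotheses (H0 : 0 < H) (K0 : 0 < K).
Hypothesis dPQ : forall x y, x1 <= x <= x1 + H -> y1 <= y <= y1 + K ->
  exists a b c, rdiff2 P x y a b /\ rdiff2 Q x y b c.

(** The circulation of P dx + Q dy around the rectangle with lower left corner (x, y) and sides h,
    k. The coefficient [b] shared by the two expansions in [dPQ] says that the form is closed. *)
Let J x y h k := intg (fun t => P t y - P t (y + k)) x (x + h) +
  intg (fun t => Q (x + h) t - Q x t) y (y + k).

Let inr x y h k := [&& x1 <= x, x + h <= x1 + H, y1 <= y & y + k <= y1 + K].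

Let cP y : y1 <= y <= y1 + K -> contseg (P^~ y) x1 (x1 + H).
Proof.
move=> hy x hx; have [a [b [c [dP _]]]] := dPQ hx hy.
exact/is_derive_continuous/rdiff_is_derive/(rdiff2_l dP).
Qed.

Let cQ x : x1 <= x <= x1 + H -> contseg (Q x) y1 (y1 + K).
Proof.
move=> hx y hy; have [a [b [c [_ dQ]]]] := dPQ hx hy.
exact/is_derive_continuous/rdiff_is_derive/(rdiff2_r dQ).
Qed.

(** The circulations of the four quarters add up, since each inner edge is traversed twice in
    opposite directions. *)
Let J4 x y h k : 0 < h -> 0 < k -> inr x y (h + h) (k + k) ->
  J x y (h + h) (k + k) = J x y h k + J (x + h) y h k + J x (y + k) h k +
    J (x + h) (y + k) h k.
Proof.
move=> h0 k0 /and4P[ax xb ay yb].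
have sx y' : y1 <= y' <= y1 + K -> intg (P^~ y') x (x + (h + h)) =
    intg (P^~ y') x (x + h) + intg (P^~ y') (x + h) (x + h + h).
  move=> hy; rewrite addrA; apply: intg_split; [lra|lra|].
  apply: contseg_sub (cP hy) => //; lra.
have sy x' : x1 <= x' <= x1 + H -> intg (Q x') y (y + (k + k)) =
    intg (Q x') y (y + k) + intg (Q x') (y + k) (y + k + k).
  move=> hx; rewrite addrA; apply: intg_split; [lra|lra|].
  apply: contseg_sub (cQ hx) => //; lra.
have JE x' y' h' k' : 0 < h' -> 0 < k' -> inr x' y' h' k' ->
    J x' y' h' k' = intg (P^~ y') x' (x' + h') - intg (P^~ (y' + k')) x' (x' + h') +
     (intg (Q (x' + h')) y' (y' + k') - intg (Q x') y' (y' + k')).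
  move=> h0' k0' /and4P[? ? ? ?]; rewrite /J !intgB //.
  - by apply: contseg_sub (cQ _) => //; lra.
  - by apply: contseg_sub (cQ _) => //; lra.
  - by apply: contseg_sub (cP _) => //; lra.
  - by apply: contseg_sub (cP _) => //; lra.
have h20 : 0 < h + h by rewrite addr_gt0.
have k20 : 0 < k + k by rewrite addr_gt0.
rewrite !JE //; [|by rewrite /inr; lra..].
rewrite !sx ?sy; [|lra..].
rewrite !addrA; ring.
Qed.

Let h_ n := H / 2 ^+ n.
Let k_ n := K / 2 ^+ n.

Let bad eta n (p : R * R) := (eta / 4 ^+ n <= `|J p.1 p.2 (h_ n) (k_ n)|) &&
  inr p.1 p.2 (h_ n) (k_ n).

(** The fourth quarter is an untested default: when the other three are not bad, additivity of the
    circulation forces it to be bad. *)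
Let step eta n (p : R * R) : R * R :=
  let q2 := (p.1 + h_ n.+1, p.2) in let q3 := (p.1, p.2 + k_ n.+1) in
  if bad eta n.+1 p then p else if bad eta n.+1 q2 then q2 else
  if bad eta n.+1 q3 then q3 else (p.1 + h_ n.+1, p.2 + k_ n.+1).

Let h_S n : h_ n = h_ n.+1 + h_ n.+1.
Proof. by rewrite /h_ exprS invfM mulrCA mulrA -mulrDl; congr (_ * _); field. Qed.

Let k_S n : k_ n = k_ n.+1 + k_ n.+1.
Proof. by rewrite /k_ exprS invfM mulrCA mulrA -mulrDl; congr (_ * _); field. Qed.

Let h_gt0 n : 0 < h_ n.
Proof. by rewrite divr_gt0 // exprn_gt0. Qed.

Let k_gt0 n : 0 < k_ n.
Proof. by rewrite divr_gt0 // exprn_gt0. Qed.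

Let bad_step eta n p : bad eta n p -> bad eta n.+1 (step eta n p).
Proof.
case: p => x y /andP[/= Hb Hin]; rewrite /step.
case: ifP => // n1; case: ifP => // n2; case: ifP => // n3.
move: Hb Hin; rewrite h_S k_S /= => Hb Hin.
have hh := h_gt0 n.+1; have kk := k_gt0 n.+1.
have i1 : inr x y (h_ n.+1) (k_ n.+1) by move: Hin; rewrite /inr => /and4P[? ? ? ?]; lra.
have i2 : inr (x + h_ n.+1) y (h_ n.+1) (k_ n.+1) by move: Hin; rewrite /inr => /and4P[? ? ? ?]; lra.
have i3 : inr x (y + k_ n.+1) (h_ n.+1) (k_ n.+1) by move: Hin; rewrite /inr => /and4P[? ? ? ?]; lra.
have i4 : inr (x + h_ n.+1) (y + k_ n.+1) (h_ n.+1) (k_ n.+1) by move: Hin; rewrite /inr => /and4P[? ? ? ?]; lra.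
move: n1 n2 n3; rewrite /bad /= i1 i2 i3 i4 !andbT.
move=> /negbT; rewrite -ltNge => n1 /negbT; rewrite -ltNge => n2 /negbT; rewrite -ltNge => n3.
rewrite leNgt; apply/negP => n4.
move: Hb; rewrite J4 //.
have -> : eta / 4 ^+ n = (eta / 4 ^+ n.+1) *+ 4.
  by rewrite exprS -mulr_natr; field; rewrite expf_neq0.
rewrite leNgt => /negP; apply.
apply: le_lt_trans (ler_normD _ _) _.
have := le_trans (ler_normD (J x y (h_ n.+1) (k_ n.+1) + J (x + h_ n.+1) y (h_ n.+1) (k_ n.+1)) (J x (y + k_ n.+1) (h_ n.+1) (k_ n.+1))) (lerD (ler_normD _ _) (lexx _)).
lra.
Qed.

Let seq_ eta := fix seq_ n : R * R := if n is n'.+1 then step eta n' (seq_ n') else (x1, y1).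

Lemma goursat_rect : intg (fun t => P t y1 - P t (y1 + K)) x1 (x1 + H) +
  intg (fun t => Q (x1 + H) t - Q x1 t) y1 (y1 + K) = 0.
Proof.
rewrite -[LHS]/(J x1 y1 H K).
apply/eqP; rewrite -normr_le0 leNgt; apply/negP; set eta := `|_| => eta0.
have badn n : bad eta n (seq_ eta n).
  elim: n => [|n IH] /=; last exact: bad_step.
  by rewrite /bad /inr /= /h_ /k_ !expr0 !divr1 /= !lexx.
have stepx n : (seq_ eta n).1 <= (seq_ eta n.+1).1 <= (seq_ eta n).1 + h_ n.+1.
  have := h_gt0 n.+1; rewrite /= /step.
  by case: ifP => _; [|case: ifP => _; [|case: ifP => _]] => /=; lra.
have stepy n : (seq_ eta n).2 <= (seq_ eta n.+1).2 <= (seq_ eta n).2 + k_ n.+1.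
  have := k_gt0 n.+1; rewrite /= /step.
  by case: ifP => _; [|case: ifP => _; [|case: ifP => _]] => /=; lra.
(* Nested intervals: the left ends increase and stay below every right end, so their supremum lies
   in all the intervals. *)
have lim (u v : nat -> R) : (forall n, u n <= u n.+1) -> (forall n, v n.+1 <= v n) ->
    (forall n, u n <= v n) -> exists x, forall n, u n <= x <= v n.
  move=> u1 v1 uv; exists (sup (range u)) => n.
  have u2 : {homo u : m n / (m <= n)%N >-> m <= n} by exact/nondecreasing_seqP.
  have v2 : {homo v : m n / (m <= n)%N >-> n <= m} by exact/nonincreasing_seqP.
  have ub m : ubound (range u) (v m).
    move=> _ [i _ <-]; apply: le_trans (u2 _ _ (leq_maxl i m)) _.
    exact: le_trans (uv _) (v2 _ _ (leq_maxr _ _)).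
  have hs : has_sup (range u) by split; [exists (u 0); exists 0|exists (v 0); exact: ub].
  apply/andP; split; first by apply: (ub_le_sup hs.2); exists n.
  by apply: (ge_sup hs.1); exact: ub.
have [x xP] : exists x, forall n, (seq_ eta n).1 <= x <= (seq_ eta n).1 + h_ n.
  apply: lim => n; first by case/andP: (stepx n).
    by case/andP: (stepx n) => _; rewrite (h_S n); lra.
  by have := h_gt0 n; lra.
have [y yP] : exists x, forall n, (seq_ eta n).2 <= x <= (seq_ eta n).2 + k_ n.
  apply: lim => n; first by case/andP: (stepy n).
    by case/andP: (stepy n) => _; rewrite (k_S n); lra.
  by have := k_gt0 n; lra.
have hx : x1 <= x <= x1 + H by have := xP 0; rewrite /= /h_ expr0 divr1.
have hy : y1 <= y <= y1 + K by have := yP 0; rewrite /= /k_ expr0 divr1.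
have [a [b [c [dP dQ]]]] := dPQ hx hy.
have HK0 : 0 < (H + K) ^+ 2 by rewrite exprn_gt0 // addr_gt0.
(* With this [e] a small rectangle of sides h, k has circulation at most 2 e (h + k)^2, half of the
   lower bound eta / 4^n preserved by the bisection. *)
pose e := eta / (4 * (H + K) ^+ 2).
have e0 : 0 < e by rewrite divr_gt0 // mulr_gt0.
have [d1 d10 HP] := dP _ e0; have [d2 d20 HQ] := dQ _ e0.
have [n /andP[nh nk]] : exists n, (h_ n < Num.min d1 d2) && (k_ n < Num.min d1 d2).
  have [n Hn] : exists n, (H + K) / Num.min d1 d2 < 2 ^+ n.
    exists (Num.truncn ((H + K) / Num.min d1 d2)).+1.
    apply: lt_le_trans (truncnS_gt _) _.
    by rewrite -natrX ler_nat ltnW // ltn_expl.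
  exists n; move: Hn; rewrite ltr_pdivrMr ?lt_min ?d10 // /h_ /k_.
  rewrite -!lt_min !ltr_pdivrMr ?exprn_gt0 // mulrC.
  by move: H0 K0; set z := _ * _; lra.
move: nh nk; rewrite !lt_min => /andP[nh1 nh2] /andP[nk1 nk2].
have /andP[Jbig /and4P[i1 i2 i3 i4]] := badn n.
move: (xP n) (yP n) Jbig i1 i2 i3 i4 nh1 nh2 nk1 nk2 (h_gt0 n) (k_gt0 n).
have hkE : (h_ n + k_ n) ^+ 2 = (H + K) ^+ 2 / 4 ^+ n.
  have -> : (4 : R) ^+ n = (2 ^+ n) ^+ 2 by rewrite -exprM mulnC exprM; congr (_ ^+ n); ring.
  by rewrite /h_ /k_; field; rewrite expf_neq0.
move: hkE; move: (seq_ eta n) => [u v] /=; set h := h_ n; set k := k_ n.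
move=> hkE xu yv Jbig i1 i2 i3 i4 nh1 nh2 nk1 nk2 h0 k0.
(* On opposite sides the linear parts differ by the constants - b k and b h. Integrated over lengths
   h and k these cancel, and only the remainders are left. *)
have bP t : u <= t <= u + h -> `|P t v - P t (v + k) - (- b * k)| <= 2 * e * (h + k).
  move=> tu.
  have A1 := HP t v ltac:(rewrite ltr_norml; lra) ltac:(rewrite ltr_norml; lra).
  have A2 := HP t (v + k) ltac:(rewrite ltr_norml; lra) ltac:(rewrite ltr_norml; lra).
  have A3 : `|t - x| <= h by rewrite ler_norml; lra.
  have A4 : `|v - y| <= k by rewrite ler_norml; lra.
  have A5 : `|v + k - y| <= k by rewrite ler_norml; lra.
  have A6 : e * (`|t - x| + `|v - y|) <= e * (h + k) := ler_wpM2l (ltW e0) (lerD A3 A4).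
  have A7 : e * (`|t - x| + `|v + k - y|) <= e * (h + k) := ler_wpM2l (ltW e0) (lerD A3 A5).
  have -> : P t v - P t (v + k) - - b * k = (P t v - P x y - a * (t - x) - b * (v - y)) -
     (P t (v + k) - P x y - a * (t - x) - b * (v + k - y)) by ring.
  have -> : 2 * e * (h + k) = e * (h + k) + e * (h + k) by ring.
  apply: le_trans (ler_normB _ _) _; exact: lerD (le_trans A1 A6) (le_trans A2 A7).
have bQ t : v <= t <= v + k -> `|Q (u + h) t - Q u t - b * h| <= 2 * e * (h + k).
  move=> tv.
  have A1 := HQ u t ltac:(rewrite ltr_norml; lra) ltac:(rewrite ltr_norml; lra).
  have A2 := HQ (u + h) t ltac:(rewrite ltr_norml; lra) ltac:(rewrite ltr_norml; lra).
  have A3 : `|t - y| <= k by rewrite ler_norml; lra.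
  have A4 : `|u - x| <= h by rewrite ler_norml; lra.
  have A5 : `|u + h - x| <= h by rewrite ler_norml; lra.
  have A6 : e * (`|u - x| + `|t - y|) <= e * (h + k) := ler_wpM2l (ltW e0) (lerD A4 A3).
  have A7 : e * (`|u + h - x| + `|t - y|) <= e * (h + k) := ler_wpM2l (ltW e0) (lerD A5 A3).
  have -> : Q (u + h) t - Q u t - b * h = (Q (u + h) t - Q x y - b * (u + h - x) - c * (t - y)) -
     (Q u t - Q x y - b * (u - x) - c * (t - y)) by ring.
  have -> : 2 * e * (h + k) = e * (h + k) + e * (h + k) by ring.
  apply: le_trans (ler_normB _ _) _; exact: lerD (le_trans A2 A7) (le_trans A1 A6).
have cPu y' : y1 <= y' <= y1 + K -> contseg (P^~ y') u (u + h).
  by move=> /cP; apply: contseg_sub; lra.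
have cQv x' : x1 <= x' <= x1 + H -> contseg (Q x') v (v + k).
  by move=> /cQ; apply: contseg_sub; lra.
have uh : u <= u + h by rewrite lerDl ltW.
have vk : v <= v + k by rewrite lerDl ltW.
have v_in : y1 <= v <= y1 + K by rewrite i3 (le_trans vk).
have vk_in : y1 <= v + k <= y1 + K by rewrite i4 (le_trans i3).
have u_in : x1 <= u <= x1 + H by rewrite i1 (le_trans uh).
have uh_in : x1 <= u + h <= x1 + H by rewrite i2 (le_trans i1).
have B1 := intg_near uh (contsegB (cPu v v_in) (cPu (v + k) vk_in)) bP.
have B2 := intg_near vk (contsegB (cQv (u + h) uh_in) (cQv u u_in)) bQ.
have : `|J u v h k| <= 2 * (e * (h + k) ^+ 2).
  rewrite /J; move: B1 B2; rewrite (addrAC u h) (addrAC v k) !subrr !add0r.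
  set I1 := intg _ u _; set I2 := intg _ v _ => B1 B2.
  have -> : I1 + I2 = (I1 - - b * k * h) + (I2 - b * h * k) by ring.
  apply: le_trans (ler_normD _ _) _; apply: le_trans (lerD B1 B2) _.
  by rewrite le_eqVlt; apply/orP; left; apply/eqP; ring.
rewrite hkE; apply/negP; rewrite -ltNge; apply: lt_le_trans Jbig.
have -> : 2 * (e * ((H + K) ^+ 2 / 4 ^+ n)) = eta / 4 ^+ n / 2.
  by rewrite /e; field; rewrite expf_neq0 //= gt_eqF // addr_gt0.
by rewrite ltr_pdivrMr // ltr_pMr ?ltr1n // divr_gt0 // exprn_gt0.
Qed.

End Goursat.

End RealAnalysis.

(** * Integrals over the unit circle *)
Section CircleIntegral.
Context {R : realType}.
Implicit Types (z w l : R[i]) (f g phi : R[i] -> R[i]).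
Local Notation N := (@modulus R).

(** With u = f w - f z, the real function Re (conj u f) grows by |u|^2 along the segment. The real
    mean value theorem bounds this growth by |u| M |w - z|, and |u| is divided out. *)
Lemma mean_value_ineq f (f' : R[i] -> R[i]) z w (M : R) :
  (forall t : R, 0 <= t <= 1 -> let u := z + t%:C * (w - z) in
     cdiff f u (f' u) /\ N (f' u) <= M) ->
  N (f w - f z) <= M * N (w - z).
Proof.
move=> H; set u := f w - f z.
pose ga (t : R) : R[i] := z + t%:C * (w - z).
pose ph t := complex.Re (conjc u * f (ga t)).
have gaB t t' : ga t - ga t' = (t - t')%:C * (w - z).
  by rewrite /ga rmorphB /=; ring.
have [E|wz] := eqVneq w z; first by rewrite /u E !subrr modulus0 mulr0.
have Nwz : 0 < N (w - z) by rewrite modulus_gt0 subr_eq0.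
have dph (t : R) : 0 <= t <= 1 -> is_derive t 1 ph (complex.Re (conjc u * (f' (ga t) * (w - z)))).
  move=> /H[df _]; apply: rdiff_is_derive => e e0.
  have K0 : 0 < (N u + 1) * N (w - z) by rewrite mulr_gt0 // ltr_wpDl ?modulus_ge0.
  have [d d0 Hd] := df (e / ((N u + 1) * N (w - z))) ltac:(by rewrite divr_gt0).
  exists (d / N (w - z)); first by rewrite divr_gt0.
  move=> y; rewrite ltr_pdivlMr // => yd.
  have := Hd (ga y); rewrite -/(ga t) gaB modulusM modulus_real => /(_ yd) h.
  have -> : ph y - ph t - complex.Re (conjc u * (f' (ga t) * (w - z))) * (y - t) =
    complex.Re (conjc u * (f (ga y) - f (ga t) - f' (ga t) * ((y - t)%:C * (w - z)))).
    rewrite /ph; move: (f (ga y)) (f (ga t)) (f' (ga t)) (conjc u) (w - z).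
    by move=> [? ?] [? ?] [? ?] [? ?] [? ?] /=; ring.
  apply: le_trans (modulus_Re _) _; rewrite modulusM modulus_conj.
  apply: le_trans (ler_wpM2l (modulus_ge0 _) h) _.
  apply: le_trans (_ : (N u + 1) * (e / ((N u + 1) * N (w - z)) * (`|y - t| * N (w - z))) <= _).
    rewrite ler_wpM2r ?lerDl // mulr_ge0 ?mulr_ge0 ?modulus_ge0 //.
    - exact: ltW.
    - by rewrite invr_ge0 ltW.
  rewrite le_eqVlt; apply/orP; left; apply/eqP; field.
  by rewrite !gt_eqF // ltr_wpDl ?modulus_ge0.
have cph (t : R) : 0 <= t <= 1 -> {for t, continuous ph}.
  by move=> /dph; exact: is_derive_continuous.
have [c] := @MVT _ ph (fun t => complex.Re (conjc u * (f' (ga t) * (w - z)))) 0 1 ltr01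
  ltac:(move=> x; rewrite in_itv /= => /andP[? ?]; apply: dph; rewrite !ltW //)
  ltac:(apply: contseg_within; exact: cph).
rewrite in_itv /= => /andP[c0 c1]; rewrite subr0 mulr1.
have -> : ph 1 - ph 0 = N u ^+ 2.
  have -> : ph 1 - ph 0 = complex.Re (conjc u * u).
    have g1 : ga 1 = w by rewrite /ga (_ : 1%:C = 1) // mul1r addrC subrK.
    have g0 : ga 0 = z by rewrite /ga (_ : 0%:C = 0) // mul0r addr0.
    by rewrite /ph g1 g0 /u -raddfB -mulrBr.
  by rewrite modulus_sqr; case: (u) => a b /=; ring.
move=> E; have [_ hM] := H c ltac:(by rewrite !ltW).
have : N u ^+ 2 <= N u * (M * N (w - z)).
  rewrite E; apply: le_trans (ler_norm _) _; apply: le_trans (modulus_Re _) _.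
  rewrite !modulusM modulus_conj ler_wpM2l ?modulus_ge0 //.
  by rewrite ler_wpM2r ?modulus_ge0.
have [->|u0] := eqVneq u 0.
  by rewrite modulus0 mulr_ge0 ?modulus_ge0 // (le_trans (modulus_ge0 _) hM).
by rewrite expr2 ler_pM2l // modulus_gt0.
Qed.

(** * The complex exponential *)

Definition cis (t : R) : R[i] := cos t +i* sin t.

Lemma modulus_cis t : N (cis t) = 1.
Proof. by rewrite /modulus /= cos2Dsin2 sqrtr1. Qed.

Lemma cisD s t : cis (s + t) = cis s * cis t.
Proof. by apply/eqP; rewrite eq_complex /= cosD sinD addrC [X in _ && (_ == X)]addrC; apply/andP; split; apply/eqP; ring. Qed.

Lemma cis_pi t : cis (t + pi) = - cis t.
Proof. by rewrite /cis cosDpi sinDpi. Qed.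

Definition cexp w : R[i] := (expR (complex.Re w))%:C * cis (complex.Im w).

Lemma cexpD w z : cexp (w + z) = cexp w * cexp z.
Proof. by rewrite /cexp !raddfD /= expRD cisD rmorphM /=; ring. Qed.

Lemma cexp0 : cexp 0 = 1.
Proof. by rewrite /cexp /cis /= expR0 cos0 sin0 mul1r. Qed.

Lemma modulus_cexp w : N (cexp w) = expR (complex.Re w).
Proof. by rewrite modulusM modulus_cis mulr1 modulus_real ger0_norm ?expR_ge0. Qed.

Lemma cexp_neq0 w : cexp w != 0.
Proof. by rewrite -modulus_gt0 modulus_cexp expR_gt0. Qed.

(** Only the derivative at 0 is computed by hand, from the first-order expansions of exp, cos and
    sin; the addition formula carries it to other points. The errors make up at most 11 pieces of
    size e |w| / 16. *)
Lemma cdiff_cexp0 : cdiff cexp 0 1.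
Proof.
have dexp := is_derive_rdiff (is_derive_expR (0 : R)).
have dcos := is_derive_rdiff (is_derive_cos (0 : R)).
have dsin := is_derive_rdiff (is_derive_sin (0 : R)).
rewrite expR0 in dexp; rewrite sin0 oppr0 in dcos; rewrite cos0 in dsin.
move=> e e0; have e8 : 0 < e / 16 by rewrite divr_gt0.
have [d1 d10 H1] := dexp _ e8; have [d1' d1'0 H1'] := dexp _ ltr01.
have [d2 d20 H2] := dcos _ e8; have [d3 d30 H3] := dsin _ e8.
exists (Num.min (Num.min d1 d1') (Num.min (Num.min d2 d3) (Num.min (e / 16) 1%R))).
  by rewrite !lt_min d10 d1'0 d20 d30 e8 ltr01.
move=> w; rewrite !subr0 mul1r cexp0 => Hw.
have aw := modulus_Re w; have bw := modulus_Im w.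
move: Hw; rewrite !lt_min => /andP[/andP[w1 w1'] /andP[/andP[w2 w3] /andP[w4 w5]]].
have {H1} H1 := H1 (complex.Re w); have {H1'} H1' := H1' (complex.Re w).
have {H2} H2 := H2 (complex.Im w); have {H3} H3 := H3 (complex.Im w).
move: H1 H1' H2 H3; rewrite !subr0 expR0 cos0 sin0 !mul1r !mul0r !subr0.
move=> /(_ (le_lt_trans aw w1)) H1 /(_ (le_lt_trans aw w1')) H1'.
move=> /(_ (le_lt_trans bw w2)) H2 /(_ (le_lt_trans bw w3)) H3.
have aw4 := le_lt_trans aw w4; have aw5 := le_lt_trans aw w5.
apply: le_trans (modulus_le _) _; rewrite /cexp /cis /=.
case: w aw bw w1 w1' w2 w3 w4 w5 H1 H1' H2 H3 aw4 aw5 => a b /= aw bw _ _ _ _ _ _ H1 H1' H2 H3 aw4 aw5.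
rewrite !mul0r subr0 addr0 oppr0 addr0.
move: aw bw; set n := Num.sqrt (a ^+ 2 + b ^+ 2) => aw bw.
set E := expR a in H1 H1' *.
have E4 : `|E| <= 4.
  have -> : E = (E - 1 - a) + a + 1 by ring.
  apply: le_trans (ler_normD _ _) _; rewrite normr1.
  have := ler_normD (E - 1 - a) a; move: H1' aw5; lra.
have E1 : `|E - 1| <= 2 * `|a|.
  have -> : E - 1 = (E - 1 - a) + a by ring.
  apply: le_trans (ler_normD _ _) _; move: H1'; lra.
have T1 : `|E * cos b - 1 - a| <= e / 16 * `|a| + 4 * (e / 16 * `|b|).
  have -> : E * cos b - 1 - a = (E - 1 - a) + E * (cos b - 1) by ring.
  apply: le_trans (ler_normD _ _) _; rewrite normrM; apply: lerD => //.
  by rewrite ler_pM.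
have T2 : `|E * sin b - b| <= 4 * (e / 16 * `|b|) + 2 * (e / 16 * `|b|).
  have -> : E * sin b - b = E * (sin b - b) + (E - 1) * b by ring.
  apply: le_trans (ler_normD _ _) _; rewrite !normrM; apply: lerD; first by rewrite ler_pM.
  apply: (@le_trans _ _ (2 * (`|a| * `|b|))); first by rewrite mulrA ler_wpM2r.
  rewrite ler_wpM2l //.
  by rewrite ler_wpM2r // ltW.
have ea : e / 16 * `|a| <= e / 16 * n by rewrite ler_wpM2l // ltW.
have eb : e / 16 * `|b| <= e / 16 * n by rewrite ler_wpM2l // ltW.
have n0 : 0 <= e / 16 * n by rewrite mulr_ge0 ?sqrtr_ge0 // ltW.
have -> : e * n = 16 * (e / 16 * n) by field.
lra.
Qed.

Lemma cdiff_cexp w : cdiff cexp w (cexp w).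
Proof.
move=> e e0; have Nw : 0 < N (cexp w) by rewrite modulus_gt0 cexp_neq0.
have [d d0 H] := cdiff_cexp0 (e := e / N (cexp w)) ltac:(by rewrite divr_gt0).
exists d => // z zw; have := H (z - w); rewrite subr0 => /(_ zw).
rewrite mul1r cexp0 => h.
have -> : cexp z - cexp w - cexp w * (z - w) = cexp w * (cexp (z - w) - 1 - (z - w)).
  have -> : cexp z = cexp (z - w) * cexp w by rewrite -cexpD subrK.
  by ring.
rewrite modulusM; apply: le_trans (ler_wpM2l (modulus_ge0 _) h) _.
by rewrite mulrA mulrCA divff ?mulr1 // gt_eqF.
Qed.

Definition ccont phi z := forall e : R, 0 < e -> exists2 d : R, 0 < d &
  forall w, N (w - z) < d -> N (phi w - phi z) < e.

Lemma cdiff_ccont f z l : cdiff f z l -> ccont f z.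
Proof. exact: cdiff_cont. Qed.

Lemma ccont_cst l z : ccont (fun=> l) z.
Proof. exact: cdiff_ccont (cdiff_cst l z). Qed.

Lemma ccontD f g z : ccont f z -> ccont g z -> ccont (fun w => f w + g w) z.
Proof.
move=> cf cg e e0; have e20 : 0 < e / 2 by rewrite divr_gt0.
have [d1 d10 H1] := cf _ e20; have [d2 d20 H2] := cg _ e20.
exists (Num.min d1 d2); first by rewrite lt_min d10.
move=> w; rewrite lt_min => /andP[/H1 h1 /H2 h2].
have -> : f w + g w - (f z + g z) = (f w - f z) + (g w - g z) by ring.
by rewrite (splitr e); apply: le_lt_trans (modulusD _ _) _; exact: ltrD.
Qed.

Lemma ccontM f g z : ccont f z -> ccont g z -> ccont (fun w => f w * g w) z.
Proof.
move=> cf cg e e0.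
set A := N (g z) + 1; have A0 : 0 < A by rewrite ltr_wpDl ?modulus_ge0.
set B := N (f z) + 1; have B0 : 0 < B by rewrite ltr_wpDl ?modulus_ge0.
have [d1 d10 H1] := cf (e / (2 * A)) ltac:(by rewrite divr_gt0 // mulr_gt0).
have [d2 d20 H2] := cg (e / (2 * B)) ltac:(by rewrite divr_gt0 // mulr_gt0).
have [d3 d30 H3] := cg 1 ltr01.
exists (Num.min d1 (Num.min d2 d3)); first by rewrite !lt_min d10 d20.
move=> w; rewrite !lt_min => /and3P[/H1 h1 /H2 h2 /H3 h3].
have -> : f w * g w - f z * g z = (f w - f z) * g w + f z * (g w - g z) by ring.
have gA : N (g w) <= A.
  rewrite -[g w](subrK (g z)) addrC; apply: le_trans (modulusD _ _) _.
  by rewrite lerD2l ltW.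
have -> : e = e / (2 * A) * A + B * (e / (2 * B)) by field; rewrite !gt_eqF.
apply: le_lt_trans (modulusD _ _) _; rewrite !modulusM; apply: ler_ltD.
  by rewrite ler_pM ?modulus_ge0 // ltW.
apply: le_lt_trans (ler_wpM2l (modulus_ge0 _) (ltW h2)) _.
by rewrite ltr_pM2r ?divr_gt0 ?mulr_gt0 // ltrDl.
Qed.

Lemma ccont_comp f g z : ccont f z -> ccont g (f z) -> ccont (fun w => g (f w)) z.
Proof. by move=> cf cg e /cg[d /cf[d' d'0 H'] H]; exists d' => // w /H' /H. Qed.

Lemma ccontN f z : ccont f z -> ccont (fun w => - f w) z.
Proof. by move=> cf e /cf[d d0 H]; exists d => // w /H; rewrite -opprD modulusN. Qed.

Lemma ccontB f g z : ccont f z -> ccont g z -> ccont (fun w => f w - g w) z.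
Proof. by move=> cf cg; exact: ccontD cf (ccontN cg). Qed.

Lemma ccont_id z : ccont id z.
Proof. by move=> e e0; exists e. Qed.

Lemma cis_cont (t : R) : forall e : R, 0 < e -> exists2 d : R, 0 < d &
  forall s, `|s - t| < d -> N (cis s - cis t) < e.
Proof.
move=> e e0; have [d d0 H] := cdiff_cont (cdiff_cexp (0 +i* t)) e0.
exists d => // s st; have := H (0 +i* s).
have -> : (0 +i* s) - (0 +i* t) = (0 +i* (s - t)) :> R[i].
  by apply/eqP; rewrite eq_complex /= subrr !eqxx.
have ci x : cexp (0 +i* x) = cis x by rewrite /cexp /= expR0; exact: mul1r.
rewrite !ci => h; apply: h.
by rewrite /modulus /= expr0n add0r sqrtr_sqr.
Qed.

Lemma contseg_cis phi (a b : R) : (forall z, N z = 1 -> ccont phi z) ->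
  contseg (fun t => complex.Re (phi (cis t))) a b /\
  contseg (fun t => complex.Im (phi (cis t))) a b.
Proof.
move=> cphi; split=> t _; apply/continuous_atP => e e0;
  have [d d0 H] := cphi _ (modulus_cis t) e e0;
  have [d' d'0 H'] := cis_cont t d0; exists d' => // s /H' /H h.
- by apply: le_lt_trans h; rewrite -raddfB modulus_Re.
- by apply: le_lt_trans h; rewrite -raddfB modulus_Im.
Qed.

(* Integral over the right half of the unit circle; all integrands below are
   symmetrized, so that this accounts for the whole circle. *)
Definition cint phi : R[i] :=
  (intg (fun t => complex.Re (phi (cis t))) (- (pi / 2)) (pi / 2)) +i*
  (intg (fun t => complex.Im (phi (cis t))) (- (pi / 2)) (pi / 2)).

Lemma pihalf_lt : - (pi / 2) < pi / 2 :> R.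
Proof. by have := pi_gt0 R; lra. Qed.

Lemma cint_eq phi psi : (forall z, N z = 1 -> phi z = psi z) -> cint phi = cint psi.
Proof.
move=> H; rewrite /cint /intg; congr (_ +i* _);
by apply: eq_Rintegral => t _; rewrite H ?modulus_cis.
Qed.

Lemma cintD f g : (forall z, N z = 1 -> ccont f z) -> (forall z, N z = 1 -> ccont g z) ->
  cint (fun z => f z + g z) = cint f + cint g.
Proof.
move=> cf cg; apply/eqP; rewrite eq_complex /=.
have [f1 f2] := contseg_cis (- (pi / 2)) (pi / 2) cf.
have [g1 g2] := contseg_cis (- (pi / 2)) (pi / 2) cg.
rewrite -!intgD //; apply/andP; split; apply/eqP;
by apply: eq_Rintegral => t _; rewrite raddfD.
Qed.

Lemma cintZ l f : (forall z, N z = 1 -> ccont f z) ->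
  cint (fun z => l * f z) = l * cint f.
Proof.
move=> cf; apply/eqP; rewrite eq_complex /=.
have [f1 f2] := contseg_cis (- (pi / 2)) (pi / 2) cf.
case: l => a b /=; rewrite -!intgZ // -intgB //; last 2 first.
- by move=> x /f1 h; apply: cvgM h; exact: cst_continuous.
- by move=> x /f2 h; apply: cvgM h; exact: cst_continuous.
rewrite -intgD //; last 2 first.
- by move=> x /f2 h; apply: cvgM h; exact: cst_continuous.
- by move=> x /f1 h; apply: cvgM h; exact: cst_continuous.
apply/andP; split; apply/eqP; apply: eq_Rintegral => t _; case: (f (cis t)) => c d //=.
Qed.

Lemma cintB f g : (forall z, N z = 1 -> ccont f z) -> (forall z, N z = 1 -> ccont g z) ->
  cint (fun z => f z - g z) = cint f - cint g.
Proof.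
move=> cf cg; rewrite -mulN1r -cintZ // -cintD //.
  by apply: cint_eq => z _; rewrite mulN1r.
by move=> z /cg; apply: ccontM; exact: ccont_cst.
Qed.

Lemma cint_near phi (c : R[i]) (e : R) : (forall z, N z = 1 -> ccont phi z) ->
  (forall z, N z = 1 -> N (phi z - c) <= e) ->
  N (cint phi - c * pi%:C) <= 2 * e * pi.
Proof.
move=> cf H; have [f1 f2] := contseg_cis (- (pi / 2)) (pi / 2) cf.
have E : pi / 2 - - (pi / 2) = pi :> R by field.
have := intg_near (k := complex.Re c) (e := e) (ltW pihalf_lt) f1
  ltac:(move=> t _; rewrite -raddfB; apply: le_trans (modulus_Re _) _; exact/H/modulus_cis).
have := intg_near (k := complex.Im c) (e := e) (ltW pihalf_lt) f2
  ltac:(move=> t _; rewrite -raddfB; apply: le_trans (modulus_Im _) _; exact/H/modulus_cis).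
rewrite E => h2 h1; apply: le_trans (modulus_le _) _.
rewrite /cint; case: c {H} h1 h2 => c1 c2 /= h1 h2; rewrite !mulr0 subr0 add0r.
by have := lerD h1 h2; rewrite mulrDl; lra.
Qed.

(** In the coordinate z = exp (x + i t) the two half circles are the vertical sides of a rectangle,
    to which Goursat's lemma applies. Its horizontal sides t = pi/2 and t = - pi/2 carry the values
    of G at opposite points, which agree by evenness and cancel. *)
Lemma cdiff_even_cint (G : R[i] -> R[i]) (S : R) :
  (forall z, G (- z) = G z) ->
  (forall z, 0 < N z < S -> exists l, cdiff G z l) ->
  forall s1 s2 : R, 0 < s1 -> s1 < s2 -> s2 < S ->
  cint (fun z => G (s1%:C * z)) = cint (fun z => G (s2%:C * z)).
Proof.
move=> evG dG s1 s2 s10 s12 s2S.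
pose u (x t : R) := complex.Re (G (cexp (x +i* t))).
pose v (x t : R) := complex.Im (G (cexp (x +i* t))).
have s20 : 0 < s2 by exact: lt_trans s12.
have lnlt : ln s1 < ln s2 by rewrite ltr_ln.
have dH x t : ln s1 <= x <= ln s2 ->
    exists l, cdiff (fun w => G (cexp w)) (x +i* t) l.
  move=> /andP[_ x2]; have [|l dl] := dG (cexp (x +i* t)).
    rewrite modulus_cexp /= expR_gt0 /=; apply: le_lt_trans s2S.
    by rewrite -[s2]lnK // ler_expR.
  by exists (l * cexp (x +i* t)); exact: cdiff_comp (cdiff_cexp _) dl.
have duv x t : ln s1 <= x <= ln s2 -> exists a b,
    [/\ rdiff2 u x t a (- b), rdiff2 v x t b a & rdiff2 (fun x t => - v x t) x t (- b) (- a)].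
  move=> /(dH x t)[[a b] dl]; exists a, b.
  have key e : 0 < e -> exists2 d : R, 0 < d & forall x' t', `|x' - x| < d -> `|t' - t| < d ->
      `|u x' t' - u x t - a * (x' - x) - - b * (t' - t)| <= e * (`|x' - x| + `|t' - t|) /\
      `|v x' t' - v x t - b * (x' - x) - a * (t' - t)| <= e * (`|x' - x| + `|t' - t|).
    move=> e0; have [d d0 Hd] := dl e e0; exists (d / 2); first by rewrite divr_gt0.
    move=> x' t' xx tt; have := Hd (x' +i* t').
    have -> : (x' +i* t') - (x +i* t) = ((x' - x) +i* (t' - t)) :> R[i] by [].
    have nle := modulus_le ((x' - x) +i* (t' - t)).
    rewrite /= in nle.
    move=> /(_ _)/Wrap[]; first by apply: le_lt_trans nle _; rewrite (splitr d) ltrD.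
    move=> h; have {}h := le_trans h (ler_wpM2l (ltW e0) nle).
    by split; apply: le_trans h;
      [apply: le_trans (modulus_Re _)|apply: le_trans (modulus_Im _)];
      rewrite /u /v; case: (G _) => ? ?; case: (G _) => ? ? /=;
      rewrite le_eqVlt; apply/orP; left; apply/eqP; congr (`|_|); ring.
  split=> e /key[d d0 Hd]; exists d => // x' t' xx tt; have [h1 h2] := Hd x' t' xx tt => //.
  by rewrite -normrN; move: h2; congr (`|_| <= _); ring.
have pi0 : 0 < pi :> R := pi_gt0 R.
have zero (f : R -> R) a b : (forall x, f x = 0) -> intg f a b = 0.
  move=> f0; rewrite /intg (_ : f = fun=> 0); first by rewrite Rintegral_cst // mul0r.
  exact/funext.
have E : - (pi / 2) + pi = pi / 2 :> R by field.
have per x : G (cexp (x +i* (pi / 2))) = G (cexp (x +i* (- (pi / 2)))).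
  by rewrite -[X in G (cexp (x +i* X)) = _]E -evG /cexp /= cis_pi mulrN opprK.
have E2 : ln s1 + (ln s2 - ln s1) = ln s2 by ring.
have d0 : 0 < ln s2 - ln s1 by rewrite subr_gt0.
have cu x : ln s1 <= x <= ln s2 -> contseg (u x) (- (pi / 2)) (pi / 2).
  move=> hx t _; have [a [b [du _ _]]] := duv x t hx.
  exact/is_derive_continuous/rdiff_is_derive/(rdiff2_r du).
have cv x : ln s1 <= x <= ln s2 -> contseg (v x) (- (pi / 2)) (pi / 2).
  move=> hx t _; have [a [b [_ dv _]]] := duv x t hx.
  exact/is_derive_continuous/rdiff_is_derive/(rdiff2_r dv).
have h1 : ln s1 <= ln s1 <= ln s2 by rewrite lexx ltW.
have h2 : ln s1 <= ln s2 <= ln s2 by rewrite lexx ltW.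
(* By the Cauchy-Riemann equations v dx + u dt and u dx - v dt are closed; they yield the real and
   the imaginary part respectively. *)
have := @goursat_rect _ v u (ln s1) (- (pi / 2)) (ln s2 - ln s1) pi d0 pi0.
rewrite E E2 => /(_ _)/Wrap[].
  move=> x t hx _; have [a [b [du dv _]]] := duv x t hx.
  by exists b, a, (- b).
rewrite zero ?add0r; last by move=> x; rewrite /v per subrr.
rewrite (intgB (cu _ h2) (cu _ h1)) => /subr0_eq Eu.
have := @goursat_rect _ u (fun x t => - v x t) (ln s1) (- (pi / 2)) (ln s2 - ln s1) pi d0 pi0.
rewrite E E2 => /(_ _)/Wrap[].
  move=> x t hx _; have [a [b [du _ dv]]] := duv x t hx.
  by exists a, (- b), (- a); split; [exact: du|exact: dv].
rewrite zero ?add0r; last by move=> x; rewrite /u per subrr.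
rewrite (intgB (contsegN (cv _ h2)) (contsegN (cv _ h1))) => /subr0_eq Ev.
have cE (s t : R) : 0 < s -> cexp (ln s +i* t) = s%:C * cis t.
  by move=> s0; rewrite /cexp /= lnK.
have intgN (s : R) : 0 < s -> ln s1 <= ln s <= ln s2 ->
    intg (fun t => - v (ln s) t) (- (pi / 2)) (pi / 2) =
    - intg (fun t => complex.Im (G (s%:C * cis t))) (- (pi / 2)) (pi / 2).
  move=> s0 hs; transitivity (intg (fun t => -1 * v (ln s) t) (- (pi / 2)) (pi / 2)).
    by apply: eq_Rintegral => t _; rewrite mulN1r.
  rewrite (intgZ _ (cv _ hs)) mulN1r; congr (- _).
  by apply: eq_Rintegral => t _; rewrite /v cE.
move: Ev; rewrite (intgN _ s20 h2) (intgN _ s10 h1) => /oppr_inj Ev.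
have intgP (s : R) : 0 < s -> intg (u (ln s)) (- (pi / 2)) (pi / 2) =
    intg (fun t => complex.Re (G (s%:C * cis t))) (- (pi / 2)) (pi / 2).
  by move=> s0; apply: eq_Rintegral => t _; rewrite /u cE.
move: Eu; rewrite (intgP _ s20) (intgP _ s10) => Eu.
by rewrite /cint Eu Ev.
Qed.

(** The radius may be shrunk to 0, where G is uniformly close to c; the factor pi is the length of
    the parameter interval of the half circle. *)
Lemma cint_even (G : R[i] -> R[i]) (S : R) (c : R[i]) :
  (forall z, G (- z) = G z) ->
  (forall z, 0 < N z < S -> exists l, cdiff G z l) ->
  (forall e : R, 0 < e -> exists2 d : R, 0 < d &
     forall z, 0 < N z < d -> N (G z - c) <= e) ->
  forall s : R, 0 < s < S -> cint (fun z => G (s%:C * z)) = c * pi%:C.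
Proof.
move=> evG dG limG s /andP[s0 sS].
apply/eqP; rewrite -subr_eq0 -modulus_eq0 -normr_le0 ger0_norm ?modulus_ge0 //.
apply/ler_addgt0Pl => e e0; rewrite addr0.
have p0 := pi_gt0 R; have e20 : 0 < e / (2 * pi) by rewrite divr_gt0 // mulr_gt0.
have [d d0 Hd] := limG _ e20.
pose s1 := Num.min (s / 2) (d / 2).
have s10 : 0 < s1 by rewrite lt_min !divr_gt0.
have s1s : s1 < s by rewrite gt_min ltr_pdivrMr // ltr_pMr // ltr1n.
have s1d : s1 < d by rewrite gt_min [X in _ || X]ltr_pdivrMr // ltr_pMr // ltr1n orbT.
rewrite -(cdiff_even_cint evG dG s10 s1s sS).
have Ns1 z : N z = 1 -> N (s1%:C * z) = s1.
  by move=> z1; rewrite modulusM z1 mulr1 modulus_real gtr0_norm.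
have -> : e = 2 * (e / (2 * pi)) * pi by rewrite (mulrC 2) -mulrA divfK // gt_eqF // mulr_gt0.
apply: cint_near => z z1; last by apply: Hd; rewrite Ns1 // s10.
have [|l dl] := dG (s1%:C * z); first by rewrite Ns1 // s10 (lt_trans s1s).
exact: ccont_comp (cdiff_ccont (cdiffZ _ (cdiff_id z))) (cdiff_ccont dl).
Qed.

End CircleIntegral.

(** * Cauchy estimates, Taylor coefficients and Weierstrass's theorem *)
Section Cauchy.
Context {R : realType}.
Implicit Types (a z w l : R[i]) (f g : R[i] -> R[i]) (D : set R[i]).
Local Notation N := (@modulus R).

Lemma modulus_nat n : N n%:R = n%:R.
Proof. by rewrite -(rmorph_nat (real_complex R)) modulus_real normr_nat. Qed.

Lemma complex_lin_ext (z0 s : R[i]) w : cdiff (fun z => z0 + s * z) w s.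
Proof. by have := cdiffD (cdiff_cst z0 w) (cdiffZ s (cdiff_id w)); rewrite add0r mulr1. Qed.

Lemma ccont_lin (z0 s : R[i]) w : ccont (fun z => z0 + s * z) w.
Proof. exact: cdiff_ccont (complex_lin_ext z0 s w). Qed.

Lemma ccont_circle (phi : R[i] -> R[i]) (z0 s w : R[i]) : ccont phi (z0 + s * w) ->
  ccont (fun z => phi (z0 + s * z)) w.
Proof. exact: ccont_comp (ccont_lin z0 s w). Qed.

Lemma ccont_circleN (phi : R[i] -> R[i]) (z0 s w : R[i]) : ccont phi (z0 - s * w) ->
  ccont (fun z => phi (z0 - s * z)) w.
Proof.
rewrite -mulNr => /ccont_circle; by under eq_fun do rewrite mulNr.
Qed.

Lemma ccontV (f : R[i] -> R[i]) z : f z != 0 -> ccont f z -> ccont (fun w => (f w)^-1) z.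
Proof. by move=> fz cf; apply: ccont_comp cf (cdiff_ccont (cdiffV fz)). Qed.

Section Coef.
Variables (f : R[i] -> R[i]) (a : R[i]) (S : R).
Hypothesis df : forall z, N (z - a) < S -> exists l, cdiff f z l.

(** Cauchy's coefficient formula on half a circle: adding (-1)^k f(a - z) makes the quotient by z^k
    even, and the expansion of f at a gives it the limit 2 b at 0. *)
Lemma coef_circle (k : nat) (b : R[i]) :
  (forall e : R, 0 < e -> exists2 d : R, 0 < d &
     forall z, N z < d -> N (f (a + z) - b * z ^+ k) <= e * N z ^+ k) ->
  forall s : R, 0 < s < S ->
  cint (fun z => (f (a + s%:C * z) + (-1) ^+ k * f (a - s%:C * z)) / (s%:C * z) ^+ k)
    = 2 * b * pi%:C.
Proof.
move=> Hk s sS.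
apply: (@cint_even _ (fun z => (f (a + z) + (-1) ^+ k * f (a - z)) / z ^+ k) S) => // {s sS}.
- move=> z; rewrite opprK [(- z) ^+ k]exprNn invfM.
  have -> : ((-1) ^+ k)^-1 = (-1) ^+ k :> R[i] by rewrite -exprVn invrN1.
  have E : (-1) ^+ k * (-1) ^+ k = 1 :> R[i] by rewrite -exprMn mulrNN mulr1 expr1n.
  rewrite mulrA mulrDl mulrAC E mul1r [X in X * _ = _]addrC; congr (_ * _).
  by rewrite [f (a - z) * _]mulrC.
- move=> z /andP[z0 zS].
  have [|l1 d1] := df (z := a + z); first by rewrite addrAC subrr add0r.
  have [|l2 d2] := df (z := a - z); first by rewrite addrAC subrr add0r modulusN.
  have e1 : cdiff (fun z => f (a + z)) z l1.
    have := cdiff_comp (cdiffD (cdiff_cst a z) (cdiff_id z)) d1.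
    by rewrite add0r mulr1.
  have e2 : cdiff (fun z => f (a - z)) z (- l2).
    have := cdiff_comp (cdiffB (cdiff_cst a z) (cdiff_id z)) d2.
    by rewrite sub0r mulrN1.
  rewrite modulus_gt0 in z0.
  have e3 := cdiff_comp (cdiffX k z) (cdiffV (expf_neq0 k z0)).
  by eexists; apply: cdiffM (cdiffD e1 (cdiffZ ((-1) ^+ k) e2)) e3.
- move=> e e0; have [d d0 Hd] := Hk (e / 2) ltac:(by rewrite divr_gt0).
  exists d => // z /andP[z0 zd].
  have h1 := Hd z zd; have := Hd (- z); rewrite modulusN => /(_ zd) h2.
  have zk : 0 < N z ^+ k by rewrite exprn_gt0.
  have zn : z ^+ k != 0 by rewrite expf_neq0 // -modulus_gt0.
  have E : (-1) ^+ k * (-1) ^+ k = 1 :> R[i] by rewrite -exprMn mulrNN mulr1 expr1n.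
  have -> : (f (a + z) + (-1) ^+ k * f (a - z)) / z ^+ k - 2 * b =
    ((f (a + z) - b * z ^+ k) + (-1) ^+ k * (f (a - z) - b * (- z) ^+ k)) / z ^+ k.
    rewrite [(- z) ^+ k]exprNn; move: E; set c := (-1) ^+ k => E.
    have -> : c * (f (a - z) - b * (c * z ^+ k)) = c * f (a - z) - c * c * (b * z ^+ k) by ring.
    by rewrite E mul1r; field.
  rewrite modulusM modulusV modulusX ler_pdivrMr //.
  apply: le_trans (modulusD _ _) _.
  rewrite (splitr e) [leRHS]mulrDl modulusM modulusX modulusN modulus1 expr1n mul1r.
  exact: lerD.
Qed.

(** The difference of values at opposite points removes f(a), so the coefficient of order 1 is
    reached for every f: the quotient is even and tends to 2 l at 0. *)
Lemma cauchy_formula1 l : cdiff f a l -> forall s : R, 0 < s < S ->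
  cint (fun z => (f (a + s%:C * z) - f (a - s%:C * z)) / (s%:C * z)) = 2 * l * pi%:C.
Proof.
move=> fl s sS.
apply: (@cint_even _ (fun z => (f (a + z) - f (a - z)) / z) S) => // {s sS}.
- by move=> z; rewrite opprK invrN mulrN -mulNr opprB.
- move=> z /andP[z0 zS].
  have [|l1 d1] := df (z := a + z); first by rewrite addrAC subrr add0r.
  have [|l2 d2] := df (z := a - z); first by rewrite addrAC subrr add0r modulusN.
  have e1 : cdiff (fun z => f (a + z)) z l1.
    have := cdiff_comp (cdiffD (cdiff_cst a z) (cdiff_id z)) d1.
    by rewrite add0r mulr1.
  have e2 : cdiff (fun z => f (a - z)) z (- l2).
    have := cdiff_comp (cdiffB (cdiff_cst a z) (cdiff_id z)) d2.
    by rewrite sub0r mulrN1.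
  rewrite modulus_gt0 in z0.
  by eexists; apply: cdiffM (cdiffB e1 e2) (cdiffV z0).
- move=> e e0; have [d d0 Hd] := fl (e / 2) ltac:(by rewrite divr_gt0).
  exists d => // z /andP[z0 zd].
  have := Hd (a + z); have := Hd (a - z).
  have -> : a - z - a = - z by rewrite addrAC subrr add0r.
  have -> : a + z - a = z by rewrite addrAC subrr add0r.
  rewrite modulusN => /(_ zd) h2 /(_ zd) h1.
  have zn : z != 0 by rewrite -modulus_gt0.
  have -> : (f (a + z) - f (a - z)) / z - 2 * l =
    ((f (a + z) - f a - l * z) - (f (a - z) - f a - l * - z)) / z by field.
  rewrite modulusM modulusV ler_pdivrMr //.
  apply: le_trans (modulusB _ _) _.
  rewrite (splitr e) [leRHS]mulrDl; exact: lerD.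
Qed.

(** The factor 2 is the price of bounding real and imaginary parts separately in [cint_near]; any
    constant would do below. *)
Lemma cauchy_estimate l (M s : R) : cdiff f a l -> 0 < s < S ->
  (forall z, N (z - a) = s -> N (f z) <= M) -> N l <= 2 * M / s.
Proof.
move=> fl sS HM; have /andP[s0 s1] := sS; have p0 := pi_gt0 R.
have Ns z : N z = 1 -> N (s%:C * z) = s by move=> z1; rewrite modulusM z1 mulr1 modulus_real gtr0_norm.
have := @cint_near _ (fun z => (f (a + s%:C * z) - f (a - s%:C * z)) / (s%:C * z)) 0 (2 * M / s).
rewrite (cauchy_formula1 fl sS) mul0r subr0 !modulusM !modulus_real.
have -> : `|pi : R| = pi by rewrite gtr0_norm.
rewrite modulus_nat.
move=> h; have {}h : 2 * N l * pi <= 2 * (2 * M / s) * pi.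
  apply: h => z z1.
    have [|l1 d1] := df (z := a + s%:C * z); first by rewrite addrAC subrr add0r Ns.
    have [|l2 d2] := df (z := a - s%:C * z); first by rewrite addrAC subrr add0r modulusN Ns.
    apply: ccontM.
      apply: ccontB; first exact/ccont_circle/(cdiff_ccont d1).
      exact/ccont_circleN/(cdiff_ccont d2).
    apply: ccontV; first by rewrite -modulus_gt0 Ns.
    exact: cdiff_ccont (cdiffZ _ (cdiff_id z)).
  rewrite subr0 modulusM modulusV Ns // ler_pdivrMr // divfK ?gt_eqF //.
  apply: le_trans (modulusB _ _) _; have -> : 2 * M = M + M by ring.
  apply: lerD; apply: HM; first by rewrite addrAC subrr add0r Ns.
  by rewrite addrAC subrr add0r modulusN Ns.
by move: h; rewrite ler_pM2r // ler_pM2l.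
Qed.

End Coef.

Lemma seg_ball a z w (r : R) (t : R) : 0 <= t <= 1 -> N (z - a) < r -> N (w - a) < r ->
  N (z + t%:C * (w - z) - a) < r.
Proof.
move=> /andP[t0 t1] hz hw.
have -> : z + t%:C * (w - z) - a = (1 - t)%:C * (z - a) + t%:C * (w - a).
  by rewrite rmorphB rmorph1; ring.
apply: le_lt_trans (modulusD _ _) _; rewrite !modulusM !modulus_real.
have u0 : 0 <= 1 - t by rewrite subr_ge0.
rewrite !ger0_norm //.
have [->|t0'] := eqVneq t 0; first by rewrite mul0r addr0 subr0 mul1r.
have tp : 0 < t by rewrite lt_def t0' t0.
have -> : r = (1 - t) * r + t * r by ring.
by apply: ler_ltD; [rewrite ler_wpM2l // ltW|rewrite ltr_pM2l].
Qed.

Lemma lip_ball f (f' : R[i] -> R[i]) a (r M : R) :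
  (forall z, N (z - a) < r -> cdiff f z (f' z) /\ N (f' z) <= M) ->
  forall z w, N (z - a) < r -> N (w - a) < r -> N (f w - f z) <= M * N (w - z).
Proof.
by move=> H z w hz hw; apply: (@mean_value_ineq _ f f') => t ht /=; apply: H; exact: seg_ball.
Qed.

(** Cauchy's estimate bounds f', so f is Lipschitz. Applied to differences of translates of f it
    shows that f' is Lipschitz, so the first-order remainder of f is quadratic. Cauchy's formula for
    F(z) = f(z + h) - f(z) then compares f'(a + h) - f'(a) with h times the same integral taken for
    f', up to an error O(|h|^2). *)
Lemma deriv_cdiff f (f' : R[i] -> R[i]) a (S : R) : 0 < S ->
  (forall z, N (z - a) < S -> cdiff f z (f' z)) -> exists l, cdiff f' a l.
Proof.
move=> S0 df; have dfa := df a ltac:(by rewrite subrr modulus0).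
have [d0 d00 H0] := cdiff_cont dfa ltr01.
pose r := Num.min S d0; have r0 : 0 < r by rewrite lt_min S0.
(* Nested radii: f is bounded on radius 4 q and f' on 2 q, f' is Lipschitz on q, and the circle of
   radius q / 2, moved by less than q / 4, stays within q. *)
pose q := r / 4; have q0 : 0 < q by rewrite divr_gt0.
have rq : r = 4 * q by rewrite /q; field.
have rS : r <= S by rewrite ge_min lexx.
pose M := N (f a) + 1.
have M0 : 0 <= M by rewrite addr_ge0 ?modulus_ge0.
have fM z : N (z - a) < r -> N (f z) <= M.
  rewrite lt_min => /andP[_ /H0 h]; rewrite -(subrK (f a) (f z)) addrC.
  by apply: le_trans (modulusD _ _) _; rewrite lerD2l ltW.
have tri z w u x y : N (z - w) < x -> N (w - u) < y -> N (z - u) < x + y.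
  move=> h1 h2; have -> : z - u = (z - w) + (w - u) by rewrite addrA subrK.
  by apply: le_lt_trans (modulusD _ _) _; exact: ltrD.
have dfr z : N (z - a) < r -> cdiff f z (f' z) by move=> h; apply: df; exact: lt_le_trans h rS.
pose M1 := 2 * M / q; have M10 : 0 <= M1 by rewrite divr_ge0 ?mulr_ge0 // ltW.
have bf' z : N (z - a) < 2 * q -> N (f' z) <= M1.
  move=> za; apply: (@cauchy_estimate f z (2 * q)).
  - move=> w wz; exists (f' w); apply: dfr; rewrite rq.
    have -> : 4 * q = 2 * q + 2 * q by ring.
    exact: tri wz za.
  - by apply: dfr; rewrite rq; apply: lt_trans za _; rewrite ltr_pM2r // ltr_nat.
  - by rewrite q0 ltr_pMl // ltr1n.
  - move=> w wz; apply: fM; rewrite rq.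
    have -> : 4 * q = 2 * q + 2 * q by ring.
    by apply: tri za; rewrite wz ltr_pMl // ltr1n.
have lipf : forall z w, N (z - a) < 2 * q -> N (w - a) < 2 * q -> N (f w - f z) <= M1 * N (w - z).
  apply: (@lip_ball f f') => z za; split; last exact: bf'.
  by apply: dfr; rewrite rq; apply: lt_trans za _; rewrite ltr_pM2r // ltr_nat.
have shiftd h z : cdiff f (z + h) (f' (z + h)) -> cdiff (fun u => f (u + h)) z (f' (z + h)).
  move=> d; have := cdiff_comp (cdiffD (cdiff_id z) (cdiff_cst h z)) d.
  by rewrite addr0 mulr1.
have q2 : 0 < q / 2 < q by rewrite divr_gt0 //= ltr_pdivrMr // ltr_pMr // ltr1n.
have qq : 2 * q = q + q by ring.
have qr : q < r by rewrite rq ltr_pMl // ltr1n.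
have q2r : 2 * q < r by rewrite rq ltr_pM2r // ltr_nat.
pose M2 := 2 * M1 / (q / 2); have M20 : 0 <= M2.
  by apply: divr_ge0; [rewrite mulr_ge0|case/andP: q2 => /ltW].
have lipf' z w : N (z - a) < q -> N (w - a) < q -> N (f' w - f' z) <= M2 * N (w - z).
  move=> za wa.
  have inb u x : N (x - a) < q -> N (u - 0) < q -> N (u + x - a) < 2 * q.
    move=> xa u0; rewrite qq; apply: tri (xa); by rewrite addrK -[u]subr0.
  have -> : M2 * N (w - z) = 2 * (M1 * N (w - z)) / (q / 2) by rewrite /M2; ring.
  apply: (@cauchy_estimate (fun u => f (u + w) - f (u + z)) 0 q) => //.
  - move=> u u0; eexists; apply: cdiffB; apply: shiftd; apply: dfr; apply: lt_trans q2r; exact: inb.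
  - have := shiftd w 0; have := shiftd z 0; rewrite !add0r => dz dw.
    by apply: cdiffB; [apply: dw|apply: dz]; apply: dfr; apply: lt_trans qr.
  - move=> u uq; have u0 : N (u - 0) < q by rewrite uq; case/andP: q2.
    have -> : w - z = u + w - (u + z) by rewrite opprD addrACA subrr add0r.
    apply: lipf; exact: inb.
have tayl z w : N (z - a) < q -> N (w - a) < q ->
    N (f w - f z - f' z * (w - z)) <= M2 * N (w - z) * N (w - z).
  move=> za wa; have -> : f w - f z - f' z * (w - z) =
    (fun u => f u - f' z * u) w - (fun u => f u - f' z * u) z by ring.
  apply: (@mean_value_ineq _ (fun u => f u - f' z * u) (fun u => f' u - f' z)) => t t01 u.
  have ua : N (u - a) < q by exact: seg_ball.
  split; last first.
    apply: le_trans (lipf' _ _ za ua) _; rewrite ler_wpM2l //.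
    have -> : u - z = t%:C * (w - z) by rewrite /u addrAC subrr add0r.
    case/andP: t01 => t0 t1.
    by rewrite modulusM modulus_real ger0_norm // ler_piMl ?modulus_ge0.
  have := cdiffB (dfr _ (lt_trans ua qr)) (cdiffZ (f' z) (cdiff_id u)); by rewrite mulr1.
pose s := q / 2; have s0 : 0 < s by case/andP: q2.
have Ns z : N z = 1 -> N (s%:C * z) = s by move=> z1; rewrite modulusM z1 mulr1 modulus_real gtr0_norm.
have pC : pi%:C != 0 :> R[i] by rewrite -modulus_gt0 modulus_real gtr0_norm ?pi_gt0.
(* Divided by 2 pi, this Cauchy integral of f' is the candidate for the derivative of f' at a. *)
pose X := cint (fun z => (f' (a + s%:C * z) - f' (a - s%:C * z)) / (s%:C * z)).
exists (X / (2 * pi%:C)) => e e0.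
pose K := 4 * M2 / q + 1; have K0 : 0 < K.
  by apply: ltr_wpDl => //; apply: divr_ge0; [exact: mulr_ge0|exact: ltW].
exists (Num.min (q / 4) (e / K)); first by rewrite lt_min !divr_gt0.
move=> w; rewrite lt_min => /andP[wq we].
pose h := w - a; have wE : w = a + h by rewrite /h addrC subrK.
pose F z := f (z + h) - f z.
have q4 : 3 * q / 4 = q / 2 + q / 4 by field.
have hq : N h < q / 4 by [].
have inq z : N (z - a) < 3 * q / 4 -> N (z + h - a) < q.
  move=> za; have -> : q = q / 4 + 3 * q / 4 by field.
  by apply: tri (za); rewrite addrAC subrr add0r.
have inq' z : N (z - a) < 3 * q / 4 -> N (z - a) < q.
  by move=> za; apply: lt_trans za _; move: q0; lra.
have dF z : N (z - a) < 3 * q / 4 -> cdiff F z (f' (z + h) - f' z).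
  move=> za; apply: cdiffB; last by apply: dfr; apply: lt_trans qr; exact: inq'.
  by apply: shiftd; apply: dfr; apply: lt_trans qr; exact: inq.
have a0 : N (a - a) < 3 * q / 4 by rewrite subrr modulus0; move: q0; lra.
have s34 : 0 < s < 3 * q / 4 by rewrite /s; move: q0; lra.
have := @cauchy_formula1 F a (3 * q / 4) (fun z za => ex_intro _ _ (dF z za)) _ (dF a a0) s s34.
rewrite -wE => FE.
have circ z : N z = 1 -> N (a + s%:C * z - a) < 3 * q / 4 /\ N (a - s%:C * z - a) < 3 * q / 4.
  by move=> z1; rewrite ![_ - _ - a]addrAC ![_ + _ - a]addrAC !subrr !add0r modulusN Ns //; case/andP: s34.
have cf' z : N (z - a) < 3 * q / 4 -> ccont f' z.
  move=> za e' e'0; have M21 : 0 < M2 + 1 by rewrite ltr_wpDl.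
  exists (Num.min (q / 4) (e' / (M2 + 1))); first by rewrite lt_min !divr_gt0.
  move=> u; rewrite lt_min => /andP[u1 u2]; apply: le_lt_trans (lipf' _ _ (inq' _ za) _) _.
    by have := tri _ _ _ _ _ u1 za; have -> : q / 4 + 3 * q / 4 = q by field.
  rewrite ltr_pdivlMr // mulrC in u2; apply: le_lt_trans u2.
  by rewrite ler_wpM2r ?modulus_ge0 // lerDl.
pose A z := (F (a + s%:C * z) - F (a - s%:C * z)) / (s%:C * z).
pose B z := (f' (a + s%:C * z) - f' (a - s%:C * z)) / (s%:C * z).
have cV z : N z = 1 -> ccont (fun z => (s%:C * z)^-1) z.
  move=> z1; apply: ccontV; first by rewrite -modulus_gt0 Ns.
  exact: cdiff_ccont (cdiffZ _ (cdiff_id z)).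
have cA z : N z = 1 -> ccont A z.
  move=> z1; have [z2 z3] := circ z z1; apply: ccontM (cV z z1); apply: ccontB.
    exact/ccont_circle/(cdiff_ccont (dF _ z2)).
  exact/ccont_circleN/(cdiff_ccont (dF _ z3)).
have cB z : N z = 1 -> ccont B z.
  move=> z1; have [z2 z3] := circ z z1; apply: ccontM (cV z z1); apply: ccontB.
    exact/ccont_circle/cf'.
  exact/ccont_circleN/cf'.
have chB z : N z = 1 -> ccont (fun z => h * B z) z.
  by move=> z1; apply: ccontM (cB z z1); exact: ccont_cst.
have cAB z : N z = 1 -> ccont (fun z => A z - h * B z) z.
  by move=> z1; apply: ccontB; [exact: cA|exact: chB].
have := @cint_near _ (fun z => A z - h * B z) 0 (2 * (M2 * N h * N h) / s) cAB.
rewrite mul0r subr0 (cintB cA chB) (cintZ _ cB) [cint A]FE -/X.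
have -> : 2 * (f' w - f' a) * pi%:C - h * X = (2 * pi%:C) * (f' w - f' a - X / (2 * pi%:C) * h).
  have lin (p x Y k : R[i]) : p != 0 -> 2 * x * p - k * Y = 2 * p * (x - Y / (2 * p) * k).
    by move=> p0; field; rewrite p0.
  exact: lin.
rewrite !modulusM modulus_nat modulus_real (gtr0_norm (pi_gt0 R)) => H.
have {}H : 2 * pi * N (f' w - f' a - X / (2 * pi%:C) * h) <=
    2 * pi * (2 * (M2 * N h * N h) / s).
  rewrite [leRHS]mulrAC; apply: H => z z1.
  have [z2 z3] := circ z z1.
  rewrite subr0 /A /B.
  have -> : (F (a + s%:C * z) - F (a - s%:C * z)) / (s%:C * z) -
     h * ((f' (a + s%:C * z) - f' (a - s%:C * z)) / (s%:C * z)) =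
    ((F (a + s%:C * z) - f' (a + s%:C * z) * h) - (F (a - s%:C * z) - f' (a - s%:C * z) * h))
     / (s%:C * z) by ring.
  rewrite modulusM modulusV Ns // ler_pdivrMr // divfK ?gt_eqF //.
  apply: le_trans (modulusB _ _) _; rewrite mulrDl !mul1r.
  have tl u : N (u - a) < 3 * q / 4 -> N (F u - f' u * h) <= M2 * N h * N h.
    move=> ua; have := tayl u (u + h) (inq' _ ua) (inq _ ua).
    by rewrite [u + h - u]addrAC subrr add0r.
  by apply: lerD; exact: tl.
have p2 : 0 < 2 * pi :> R by rewrite mulr_gt0 ?pi_gt0.
move: H; rewrite ler_pM2l // => H; apply: le_trans H _.
have -> : 2 * (M2 * N h * N h) / s = 4 * M2 / q * N h * N h by rewrite /s; field; rewrite gt_eqF.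
rewrite ler_wpM2r ?modulus_ge0 //; apply: (@le_trans _ _ (K * N h)).
  by rewrite ler_wpM2r ?modulus_ge0 // /K lerDl.
by rewrite mulrC -ler_pdivlMr // ltW.
Qed.

Lemma holomorphicP D f : open D -> (holomorphic D f <-> forall z, D z -> cdiff f z (derive1 f z)).
Proof.
move=> oD; split=> H z Dz; first by apply: derivable_cdiff; exact: H.
by apply: cdiff_derivable; exact: H.
Qed.

Lemma holomorphic_derive1 D f : open D -> holomorphic D f -> holomorphic D (derive1 f).
Proof.
move=> oD /(holomorphicP _ oD) H z Dz.
have [d d0 Hd] := (open_modulus D).1 oD z Dz.
have [|l] := @deriv_cdiff f (derive1 f) z d d0; first by move=> w /Hd; exact: H.
exact: cdiff_derivable.
Qed.

Lemma holomorphic_derive1n D f n : open D -> holomorphic D f -> holomorphic D (derive1n n f).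
Proof.
move=> oD hf; elim: n => [|n IH]; first exact: hf.
by rewrite derive1nS; exact: (holomorphic_derive1 oD IH).
Qed.

Lemma derive1_eq D f g z : open D -> D z -> (forall z, D z -> f z = g z) ->
  holomorphic D f -> derive1 f z = derive1 g z.
Proof.
move=> oD Dz fg hf; have [d d0 Hd] := (open_modulus D).1 oD z Dz.
apply/esym/cdiff_derive1/(cdiff_ext d0 _ (derivable_cdiff (hf z Dz))).
by move=> w /Hd; exact: fg.
Qed.

Lemma derive1n_eq D f g n z : open D -> D z -> (forall z, D z -> f z = g z) ->
  holomorphic D f -> derive1n n f z = derive1n n g z.
Proof.
move=> oD + fg hf; elim: n z => [|n IH] z Dz; first exact: fg.
by rewrite !derive1nS; apply: (derive1_eq oD Dz IH); exact: holomorphic_derive1n.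
Qed.

Lemma holomorphicD D f g : holomorphic D f -> holomorphic D g -> holomorphic D (f \+ g).
Proof.
move=> hf hg z Dz; apply: cdiff_derivable.
exact: cdiffD (derivable_cdiff (hf z Dz)) (derivable_cdiff (hg z Dz)).
Qed.

Lemma holomorphicZ D c f : holomorphic D f -> holomorphic D (fun z => c * f z).
Proof.
move=> hf z Dz; apply: cdiff_derivable; exact: cdiffZ (derivable_cdiff (hf z Dz)).
Qed.

Lemma holomorphic_cst D (c : R[i]) : holomorphic D (fun=> c).
Proof. by move=> z _; exact: cdiff_derivable (cdiff_cst c z). Qed.

Lemma derive1nDZ D f g c n z : open D -> D z -> holomorphic D f -> holomorphic D g ->
  derive1n n (fun z => f z + c * g z) z = derive1n n f z + c * derive1n n g z.
Proof.
move=> oD + hf hg; elim: n z => // n IH z Dz.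
have hh := holomorphicD hf (@holomorphicZ D c g hg).
rewrite !derive1nS (derive1_eq oD Dz IH); last exact: holomorphic_derive1n.
apply: cdiff_derive1; apply: cdiffD; last apply: cdiffZ.
  exact: derivable_cdiff (@holomorphic_derive1n D f n oD hf z Dz).
exact: derivable_cdiff (@holomorphic_derive1n D g n oD hg z Dz).
Qed.

(** Induction through f': the mean value inequality, applied to f minus its leading term, integrates
    the expansion of f' and gains one power of |z - a|. *)
Lemma taylor_vanish D f n a : open D -> D a -> holomorphic D f ->
  (forall j, (j < n)%N -> derive1n j f a = 0) ->
  forall e : R, 0 < e -> exists2 d : R, 0 < d & forall z, N (z - a) < d ->
    N (f z - derive1n n f a / n`!%:R * (z - a) ^+ n) <= e * N (z - a) ^+ n.
Proof.
move=> oD Da; elim: n f => [|n IH] f hf f0 e e0.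
  have [d d0 H] := cdiff_cont (derivable_cdiff (hf _ Da)) e0.
  by exists d => // z /H /ltW; rewrite !expr0 !mulr1 fact0 divr1.
have [d1 d10 H1] := IH (derive1 f) (holomorphic_derive1 oD hf)
  (fun j jn => etrans (esym (congr1 (@^~ a) (derive1Sn f j))) (f0 j.+1 jn)) e e0.
have [d2 d20 H2] := (open_modulus D).1 oD a Da.
exists (Num.min d1 d2); first by rewrite lt_min d10.
move=> z; rewrite lt_min => /andP[z1 z2].
set c := derive1n n.+1 f a.
pose g u := f u - c / n.+1`!%:R * (u - a) ^+ n.+1.
have g0 : g a = 0 by rewrite /g subrr expr0n mulr0 subr0 (f0 0 isT : f a = 0).
have n1 : (n.+1%:R : R[i]) != 0 by rewrite pnatr_eq0.
have nf : (n`!%:R : R[i]) != 0 by rewrite pnatr_eq0 -lt0n fact_gt0.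
have -> : f z - c / n.+1`!%:R * (z - a) ^+ n.+1 = g z - g a by rewrite g0 subr0.
rewrite exprSr mulrA.
apply: (@mean_value_ineq _ g (fun u => derive1 f u - c / n`!%:R * (u - a) ^+ n)) => t t01 u.
have ua (r : R) : N (z - a) < r -> N (u - a) < r.
  move=> zr; apply: seg_ball => //; rewrite subrr modulus0.
  exact: le_lt_trans (modulus_ge0 _) zr.
have uz : N (u - a) <= N (z - a).
  have -> : u - a = t%:C * (z - a) by rewrite /u addrAC subrr add0r.
  case/andP: t01 => t0 t1.
  by rewrite modulusM modulus_real ger0_norm // ler_piMl ?modulus_ge0.
split.
  apply: cdiffB; first by apply/derivable_cdiff/hf/H2/ua.
  have := cdiffZ (c / n.+1`!%:R) (cdiff_comp (cdiffB (cdiff_id u) (cdiff_cst a u)) (cdiffX n.+1 (u - a))).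
  rewrite subr0 mulr1; congr (cdiff _ _ _); rewrite /= factS natrM.
  have lin (m m' k x : R[i]) : m != 0 -> m' != 0 -> k / (m * m') * (m * x) = k / m' * x.
    by move=> m0 m'0; field; rewrite m0 m'0.
  exact: lin.
have := H1 u (ua _ z1); rewrite -derive1Sn -/c => h; apply: le_trans h _.
by rewrite ler_wpM2l ?(ltW e0) // lerXn2r ?nnegrE ?modulus_ge0.
Qed.

(** * Limits of sequences of holomorphic functions *)

Definition clim (u : nat -> R[i]) l := forall e : R, 0 < e ->
  exists K : nat, forall k, (K <= k)%N -> N (u k - l) <= e.

Lemma clim_cauchy (u : nat -> R[i]) : (forall e : R, 0 < e -> exists K : nat,
    forall j k, (K <= j)%N -> (K <= k)%N -> N (u j - u k) <= e) -> exists l, clim u l.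
Proof.
move=> H.
have real_lim (v : nat -> R) : (forall e : R, 0 < e -> exists K : nat,
    forall j k, (K <= j)%N -> (K <= k)%N -> `|v j - v k| <= e) ->
  exists l : R, forall e : R, 0 < e -> exists K : nat, forall k, (K <= k)%N -> `|v k - l| <= e.
  move=> Hv; have : cvg (v @ \oo).
    apply/cauchy_cvgP/cauchy_exP => e e0.
    have [K HK] := Hv (e / 2) ltac:(by rewrite divr_gt0).
    exists (v K); exists K => // k /= Kk.
    rewrite /ball /=; apply: le_lt_trans (HK _ _ (leqnn K) Kk) _.
    by rewrite ltr_pdivrMr // ltr_pMr // ltr1n.
  move=> /cvg_ex[l /cvgrPdist_le vl]; exists l => e e0.
  have [K _ HK] := vl e e0; exists K => k Kk.
  by rewrite distrC; exact: HK.
have [a Ha] := real_lim (fun k => complex.Re (u k)) ltac:(move=> e /H[K HK]; exists K => j k Kj Kk;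
  rewrite -raddfB; exact: le_trans (modulus_Re _) (HK _ _ Kj Kk)).
have [b Hb] := real_lim (fun k => complex.Im (u k)) ltac:(move=> e /H[K HK]; exists K => j k Kj Kk;
  rewrite -raddfB; exact: le_trans (modulus_Im _) (HK _ _ Kj Kk)).
exists (a +i* b) => e e0; have e20 : 0 < e / 2 by rewrite divr_gt0.
have [K1 H1] := Ha _ e20; have [K2 H2] := Hb _ e20.
exists (maxn K1 K2) => k; rewrite geq_max => /andP[/H1 h1 /H2 h2].
apply: le_trans (modulus_le _) _; rewrite (splitr e) !raddfB; exact: lerD.
Qed.

Lemma clim_cst l : clim (fun=> l) l.
Proof. by move=> e e0; exists 0 => k _; rewrite subrr modulus0 ltW. Qed.

Lemma clim_unique (u : nat -> R[i]) l m : clim u l -> clim u m -> l = m.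
Proof.
move=> ul um; apply/eqP; rewrite -subr_eq0 -modulus_eq0 -normr_le0 ger0_norm ?modulus_ge0 //.
apply/ler_addgt0Pl => e e0; rewrite addr0.
have e20 : 0 < e / 2 by rewrite divr_gt0.
have [K1 H1] := ul _ e20; have [K2 H2] := um _ e20.
have -> : l - m = (u (maxn K1 K2) - m) - (u (maxn K1 K2) - l) by ring.
apply: le_trans (modulusB _ _) _; rewrite (splitr e); apply: lerD.
  by apply: H2; rewrite leq_maxr.
by apply: H1; rewrite leq_maxl.
Qed.

Lemma modulus_clim_le (u : nat -> R[i]) l (w : R[i]) (M : R) (K : nat) : clim u l ->
  (forall k, (K <= k)%N -> N (u k - w) <= M) -> N (l - w) <= M.
Proof.
move=> ul H; apply/ler_addgt0Pl => e e0; have [K1 H1] := ul _ e0.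
have -> : l - w = (u (maxn K K1) - w) - (u (maxn K K1) - l) by ring.
apply: le_trans (modulusB _ _) _; rewrite addrC; apply: lerD.
  by apply: H1; rewrite leq_maxr.
by apply: H; rewrite leq_maxl.
Qed.

(** Since the derivatives are uniformly Cauchy, the mean value inequality makes the increments of
    G_j - G_k small relative to |w - z|, uniformly in j. One fixed index k then serves for all w
    near z. *)
Lemma cdiff_lim (G G' : nat -> R[i] -> R[i]) (g h : R[i] -> R[i]) a (r : R) :
  (forall k z, N (z - a) < r -> cdiff (G k) z (G' k z)) ->
  (forall e : R, 0 < e -> exists K : nat, forall j k, (K <= j)%N -> (K <= k)%N ->
     forall z, N (z - a) < r -> N (G' j z - G' k z) <= e) ->
  (forall z, N (z - a) < r -> clim (G^~ z) (g z)) ->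
  (forall z, N (z - a) < r -> clim (G'^~ z) (h z)) ->
  forall z, N (z - a) < r -> cdiff g z (h z).
Proof.
move=> dG cG' Gg G'h z za e e0; have e40 : 0 < e / 4 by rewrite divr_gt0.
have [K HK] := cG' _ e40; have [K' HK'] := G'h z za _ e40.
pose k := maxn K K'.
have [d d0 Hd] := dG k z za _ e40.
have r0 : 0 < r - N (z - a) by rewrite subr_gt0.
exists (Num.min d (r - N (z - a))); first by rewrite lt_min d0.
move=> w; rewrite lt_min ltrBrDl => /andP[wd wr].
have wa : N (w - a) < r.
  have -> : w - a = (z - a) + (w - z) by ring.
  exact: le_lt_trans (modulusD _ _) wr.
have h1 : N ((g w - g z) - (G k w - G k z)) <= e / 4 * N (w - z).
  have gwz : clim (fun j => G j w - G j z) (g w - g z).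
    move=> e' e'0; have e'2 : 0 < e' / 2 by rewrite divr_gt0.
    have [K1 H1] := Gg w wa _ e'2; have [K2 H2] := Gg z za _ e'2.
    exists (maxn K1 K2) => j; rewrite geq_max => /andP[/H1 h1 /H2 h2].
    have -> : G j w - G j z - (g w - g z) = (G j w - g w) - (G j z - g z) by ring.
    by apply: le_trans (modulusB _ _) _; rewrite (splitr e'); exact: lerD.
  apply: (modulus_clim_le (K := K) gwz) => j Kj.
  have -> : G j w - G j z - (G k w - G k z) =
    (fun u => G j u - G k u) w - (fun u => G j u - G k u) z by ring.
  apply: (@lip_ball (fun u => G j u - G k u) (fun u => G' j u - G' k u) a r) => // u ua.
  split; first exact: cdiffB (dG j u ua) (dG k u ua).
  by apply: HK => //; rewrite leq_maxl.
have h2 := Hd w wd.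
have h3 : N (G' k z - h z) <= e / 4 by apply: HK'; rewrite leq_maxr.
have -> : g w - g z - h z * (w - z) = ((g w - g z) - (G k w - G k z)) +
   (G k w - G k z - G' k z * (w - z)) + (G' k z - h z) * (w - z) by ring.
apply: le_trans (modulusD _ _) _; rewrite modulusM.
have h4 := modulusD (g w - g z - (G k w - G k z)) (G k w - G k z - G' k z * (w - z)).
have h5 := ler_wpM2r (modulus_ge0 (w - z)) h3.
have h6 : 0 <= e / 4 * N (w - z) by rewrite mulr_ge0 ?modulus_ge0 // ltW.
have -> : e * N (w - z) = 4 * (e / 4 * N (w - z)) by field.
move: h1 h2 h4 h5 h6; lra.
Qed.

Definition lunif D (G : nat -> R[i] -> R[i]) (h : R[i] -> R[i]) := forall z, D z ->
  exists2 r : R, 0 < r & forall e : R, 0 < e -> exists K : nat, forall k, (K <= k)%N ->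
    forall w, N (w - z) < r -> N (G k w - h w) <= e.

Lemma unif_cauchy (G : nat -> R[i] -> R[i]) (h : R[i] -> R[i]) z (r : R) :
  (forall e : R, 0 < e -> exists K : nat, forall k, (K <= k)%N ->
    forall w, N (w - z) < r -> N (G k w - h w) <= e) ->
  (forall e : R, 0 < e -> exists K : nat, forall j k, (K <= j)%N -> (K <= k)%N ->
     forall w, N (w - z) < r -> N (G j w - G k w) <= e).
Proof.
move=> H e e0; have e20 : 0 < e / 2 by rewrite divr_gt0.
have [K HK] := H _ e20; exists K => j k Kj Kk w wz.
have -> : G j w - G k w = (G j w - h w) - (G k w - h w) by ring.
by apply: le_trans (modulusB _ _) _; rewrite (splitr e); apply: lerD; exact: HK.
Qed.

(** Cauchy's estimate with radius r / 4 around the points of the half disc. *)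
Lemma deriv_bound f (f' : R[i] -> R[i]) a (r e : R) : 0 < r ->
  (forall z, N (z - a) < r -> cdiff f z (f' z)) ->
  (forall z, N (z - a) < r -> N (f z) <= e) ->
  forall z, N (z - a) < r / 2 -> N (f' z) <= 8 / r * e.
Proof.
move=> r0 df fe z za.
have tri u : N (u - z) < r / 2 -> N (u - a) < r.
  move=> uz; have -> : u - a = (u - z) + (z - a) by ring.
  by apply: le_lt_trans (modulusD _ _) _; rewrite (splitr r); exact: ltrD.
have -> : 8 / r * e = 2 * e / (r / 4) by field; rewrite gt_eqF.
apply: (@cauchy_estimate f z (r / 2)).
- by move=> w /tri/df; exists (f' w).
- by apply/df/tri; rewrite subrr modulus0 divr_gt0.
- by move: r0; lra.
- by move=> w wz; apply/fe/tri; rewrite wz; move: r0; lra.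
Qed.

(** Each derivative costs half the radius: [deriv_bound] turns uniform closeness of functions into
    uniform closeness of derivatives on the half disc. *)
Lemma clim_derive1n D (G : nat -> R[i] -> R[i]) h a (r : R) j : open D -> 0 < r ->
  (forall z, N (z - a) < r -> D z) ->
  (forall k, holomorphic D (G k)) -> holomorphic D h ->
  (forall e : R, 0 < e -> exists K : nat, forall k, (K <= k)%N ->
    forall w, N (w - a) < r -> N (G k w - h w) <= e) ->
  clim (fun k => derive1n j (G k) a) (derive1n j h a).
Proof.
move=> oD; elim: j G h r => [|j IH] G h r r0 rD hG hh H.
  move=> e /H[K HK]; exists K => k /HK; apply; by rewrite subrr modulus0.
rewrite derive1Sn; under eq_fun do rewrite derive1Sn.
apply: (IH (fun k => derive1 (G k)) (derive1 h) (r / 2)).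
- by rewrite divr_gt0.
- by move=> z zr; apply: rD; apply: lt_trans zr _; move: r0; lra.
- by move=> k; exact: (holomorphic_derive1 oD (hG k)).
- exact: (holomorphic_derive1 oD hh).
move=> e e0; have [K HK] := H (e / (8 / r)) ltac:(by rewrite !divr_gt0).
exists K => k Kk w wr.
have -> : e = 8 / r * (e / (8 / r)) by field; rewrite gt_eqF.
apply: (@deriv_bound (fun z => G k z - h z) (fun z => derive1 (G k) z - derive1 h z) a r) => //.
- move=> z /rD Dz; apply: cdiffB; apply: derivable_cdiff; [exact: hG|exact: hh].
- by move=> z zr; exact: HK.
Qed.

(** On a half disc the derivatives are uniformly Cauchy by [deriv_bound], and [cdiff_lim] identifies
    their limit as the derivative of the limit. *)
Lemma weierstrass D (G : nat -> R[i] -> R[i]) h : open D ->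
  (forall k, holomorphic D (G k)) -> lunif D G h -> holomorphic D h.
Proof.
move=> oD hG Gh a Da; have [r1 r10 H1] := Gh a Da.
have [r2 r20 H2] := (open_modulus D).1 oD a Da.
pose r := Num.min r1 r2; have r0 : 0 < r by rewrite lt_min r10.
have rD z : N (z - a) < r -> D z by rewrite lt_min => /andP[_ /H2].
have Hr e : 0 < e -> exists K : nat, forall k, (K <= k)%N ->
    forall w, N (w - a) < r -> N (G k w - h w) <= e.
  by move=> /H1[K HK]; exists K => k Kk w; rewrite lt_min => /andP[w1 _]; exact: HK.
have Hc := unif_cauchy Hr.
have Hc' e : 0 < e -> exists K : nat, forall j k, (K <= j)%N -> (K <= k)%N ->
     forall w, N (w - a) < r / 2 -> N (derive1 (G j) w - derive1 (G k) w) <= e.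
  move=> e0; have [K HK] := Hc (e / (8 / r)) ltac:(by rewrite !divr_gt0).
  exists K => j k Kj Kk w wr.
  have -> : e = 8 / r * (e / (8 / r)) by field; rewrite gt_eqF.
  apply: (@deriv_bound (fun z => G j z - G k z) (fun z => derive1 (G j) z - derive1 (G k) z) a r) => //.
  - by move=> z /rD Dz; apply: cdiffB; apply: derivable_cdiff; exact: hG.
  - by move=> z zr; exact: HK.
have r2r z : N (z - a) < r / 2 -> N (z - a) < r.
  by move=> zr; apply: lt_trans zr _; move: r0; lra.
have lim z : exists l, N (z - a) < r / 2 -> clim (fun k => derive1 (G k) z) l.
  have [za|] := boolP (N (z - a) < r / 2); last by exists 0.
  have [|l Hl] := @clim_cauchy (fun k => derive1 (G k) z); last by exists l.
  by move=> e /Hc'[K HK]; exists K => j k Kj Kk; exact: HK.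
have [l Hl] := choice lim.
have a2 : N (a - a) < r / 2 by rewrite subrr modulus0 divr_gt0.
apply: cdiff_derivable.
apply: (@cdiff_lim G (fun k => derive1 (G k)) h l a (r / 2)) => //.
- by move=> k z /r2r/rD Dz; apply: derivable_cdiff; exact: hG.
- by move=> z /r2r zr e /Hr[K HK]; exists K => k Kk; exact: HK.
Qed.

(** D may have holes, so holomorphy of h alone would give no primitive; here the primitive is the
    limit of the [F k]. Their common value at a starts the convergence, and the set of points of D
    where they are Cauchy is both open and closed in D. *)
Lemma termwise_primitive D (F : nat -> R[i] -> R[i]) h a : open D -> connected D -> D a ->
  (forall k, holomorphic D (F k)) -> (forall k, F k a = 0) ->
  lunif D (fun k => derive1 (F k)) h ->
  exists2 G, (forall z, D z -> cdiff G z (h z)) & G a = 0.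
Proof.
move=> oD cD Da hF Fa Fh.
pose cau z := forall e : R, 0 < e -> exists K : nat,
    forall j k, (K <= j)%N -> (K <= k)%N -> N (F j z - F k z) <= e.
have loc z : D z -> exists2 r : R, 0 < r & (forall w, N (w - z) < r -> D w) /\
    (forall e : R, 0 < e -> exists K : nat, forall j k, (K <= j)%N -> (K <= k)%N ->
     forall w, N (w - z) < r -> N (derive1 (F j) w - derive1 (F k) w) <= e).
  move=> Dz; have [r1 r10 H1] := Fh z Dz; have [r2 r20 H2] := (open_modulus D).1 oD z Dz.
  exists (Num.min r1 r2); first by rewrite lt_min r10.
  split=> [w|e /(unif_cauchy H1)[K HK]]; first by rewrite lt_min => /andP[_ /H2].
  by exists K => j k Kj Kk w; rewrite lt_min => /andP[w1 _]; exact: HK.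
have prop z (r : R) : 0 < r -> (forall w, N (w - z) < r -> D w) ->
    (forall e : R, 0 < e -> exists K : nat, forall j k, (K <= j)%N -> (K <= k)%N ->
     forall w, N (w - z) < r -> N (derive1 (F j) w - derive1 (F k) w) <= e) ->
    forall u w, N (u - z) < r -> N (w - z) < r -> cau u -> cau w.
  move=> r0 rD Hr u w uz wz cu e e0; have e20 : 0 < e / 2 by rewrite divr_gt0.
  have [K1 H1] := cu _ e20; have [K2 H2] := Hr (e / 2 / (2 * r)) ltac:(by rewrite divr_gt0 ?mulr_gt0).
  exists (maxn K1 K2) => j k; rewrite !geq_max => /andP[j1 j2] /andP[k1 k2].
  have h1 := H1 _ _ j1 k1.
  have h2 : N (F j w - F k w - (F j u - F k u)) <= e / 2 / (2 * r) * N (w - u).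
    apply: (@lip_ball (fun x => F j x - F k x) (fun x => derive1 (F j) x - derive1 (F k) x) z r) => // x xz.
    split; last exact: H2.
    by apply: cdiffB; apply/derivable_cdiff/hF/rD.
  have h3 : e / 2 / (2 * r) * N (w - u) <= e / 2.
    rewrite mulrAC ler_pdivrMr ?mulr_gt0 // ler_wpM2l ?ltW //.
    have -> : w - u = (w - z) - (u - z) by ring.
    by apply: le_lt_trans (modulusB _ _) _; rewrite (_ : 2 * r = r + r); [exact: ltrD|ring].
  rewrite -[F j w - F k w](subrK (F j u - F k u)) (splitr e).
  by apply: le_trans (modulusD _ _) _; apply: lerD => //; exact: le_trans h3.
have cauD : D `&` cau = D.
  apply: cD.
  - exists a; split => // e e0; exists 0 => j k _ _.
    by rewrite !Fa subrr modulus0 ltW.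
  - exists (D `&` cau); last by rewrite setIA setIid.
    apply/open_modulus => z [Dz cz]; have [r r0 [rD Hr]] := loc z Dz.
    exists r => // w wz; split; first exact: rD.
    by apply: (prop z r r0 rD Hr z w) => //; rewrite subrr modulus0.
  - exists (~` (D `&` ~` cau)).
      apply: open_closedC; apply/open_modulus => z [Dz cz]; have [r r0 [rD Hr]] := loc z Dz.
      exists r => // w wz; split; first exact: rD.
      move=> cw; apply: cz; apply: (prop z r r0 rD Hr w z) => //; by rewrite subrr modulus0.
    by rewrite setCI setCK setIUr setICr set0U.
have lim z : exists l, D z -> clim (fun k => F k z) l.
  have [Dz|nDz] := pselect (D z); last by exists 0.
  have [|l Hl] := @clim_cauchy (fun k => F k z); last by exists l.
  by have [] : (D `&` cau) z by rewrite cauD.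
have [G HG] := choice lim.
exists G; last by apply: clim_unique (HG a Da) _; under eq_fun do rewrite Fa; exact: clim_cst.
move=> z Dz; have [r1 r10 H1] := Fh z Dz; have [r r0 [rD Hr]] := loc z Dz.
pose q := Num.min r1 r; have q0 : 0 < q by rewrite lt_min r10.
apply: (@cdiff_lim F (fun k => derive1 (F k)) G h z q) => //; last by rewrite subrr modulus0.
- by move=> k w; rewrite lt_min => /andP[_ wr]; apply/derivable_cdiff/hF/rD.
- by move=> e /Hr[K HK]; exists K => j k Kj Kk w; rewrite lt_min => /andP[_ wr]; exact: HK.
- by move=> w; rewrite lt_min => /andP[_ wr]; apply/HG/rD.
- by move=> w; rewrite lt_min => /andP[w1 _] e /H1[K HK]; exists K => k Kk; exact: HK.
Qed.

End Cauchy.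

(** * Change of variables on the line *)
Section Density.
Local Open Scope ereal_scope.
Context d (T : measurableType d) {R : realType} (mu : {measure set T -> \bar R}).
Variable w : T -> R.
Hypotheses (mw : measurable_fun setT w) (w0 : forall x, (0 <= w x)%R).

Let mw' : measurable_fun setT (EFin \o w). Proof. exact/measurable_EFinP. Qed.

(** The two proofs are arguments of the definition so that the measure structure below can be
    attached to a term that contains them. *)
Definition density of measurable_fun setT w & (forall x, (0 <= w x)%R) : set T -> \bar R :=
  fun A => \int[mu]_(x in A) (w x)%:E.

Local Notation dens := (density mw w0).

Let dens0 : dens set0 = 0. Proof. by rewrite /density integral_set0. Qed.

Let dens_ge0 A : 0 <= dens A. Proof. by apply: integral_ge0 => x _; rewrite lee_fin. Qed.

Let dens_sigma : semi_sigma_additive dens.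
Proof. exact: semi_sigma_additive_nng_induced. Qed.

HB.instance Definition _ := isMeasure.Build _ _ _ dens dens0 dens_ge0 dens_sigma.

Import HBNNSimple.

Lemma ge0_integral_density (g : T -> \bar R) : measurable_fun setT g -> (forall x, 0 <= g x) ->
  \int[dens]_x g x = \int[mu]_x (g x * (w x)%:E).
Proof.
move=> mg g0; pose g_ := nnsfun_approx measurableT mg.
have mono x : {homo (fun n => (g_ n x)%:E) : m n / (m <= n)%N >-> m <= n}.
  by move=> m n mn; rewrite lee_fin; exact/lefP/nd_nnsfun_approx.
have limg x : (fun n => (g_ n x)%:E) @ \oo --> g x by exact: cvg_nnsfun_approx.
transitivity (limn (fun n => \int[dens]_x (g_ n x)%:E)).
  rewrite -monotone_convergence //.
  - by apply: eq_integral => y _; apply/esym/cvg_lim.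
  - by move=> n; exact/measurable_EFinP/measurable_funP.
  - by move=> n y _; rewrite lee_fin.
rewrite [X in limn X](_ : _ = (fun n => \int[mu]_x ((g_ n x)%:E * (w x)%:E))).
  rewrite -monotone_convergence //; last 3 first.
  - by move=> n; apply: emeasurable_funM => //; exact/measurable_EFinP/measurable_funP.
  - by move=> n x _; rewrite mule_ge0 ?lee_fin.
  - by move=> x _ m n mn; rewrite lee_wpmul2r ?lee_fin //; exact: mono.
  apply: eq_integral => x _; apply/cvg_lim => //.
  by apply: cvgeZr => //; exact: limg.
apply/funext => n.
transitivity (\sum_(k \in range (g_ n)) \int[mu]_x ((k * \1_(g_ n @^-1` [set k])  x)%:E * (w x)%:E)).
  under eq_integral do rewrite fimfunE -fsumEFin //.
  rewrite ge0_integral_fsum //; last 2 first.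
  - by move=> y; exact/measurable_EFinP/measurable_funM.
  - by move=> y x _; rewrite nnfun_muleindic_ge0.
  apply: eq_fsbigr => r' /[!inE] -[x _ <-] {r'}; set r := g_ n x.
  have r0 : (0 <= r)%R by exact: fun_ge0.
  rewrite integralZl_indic_nnsfun // integral_indic // setIT /density.
  rewrite -ge0_integralZl //; last 2 first.
  - exact: measurable_funTS.
  - by move=> y _; rewrite lee_fin.
  rewrite [LHS]integral_mkcond; apply: eq_integral => y _; rewrite patchE EFinM -muleA indicE.
  by case: ifPn => _; rewrite ?mul1e ?mul0e ?mule0.
rewrite -ge0_integral_fsum //.
- by apply: eq_integral => x _; rewrite fimfunE -fsumEFin // ge0_mule_fsuml // => i; rewrite nnfun_muleindic_ge0.
- by move=> r; apply: emeasurable_funM => //; exact/measurable_EFinP/measurable_funM.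
- by move=> r x _; rewrite mule_ge0 ?nnfun_muleindic_ge0 ?lee_fin.
Qed.

End Density.

Section Transfer.
Context {R : realType}.
Local Notation mu := (@lebesgue_measure R).
Local Notation RR := (measurableTypeR R).
Local Open Scope ereal_scope.

(** The push-forward by [phi] of the measure with density [w] agrees with Lebesgue measure on
    half-open intervals, hence everywhere. A substitution thus needs checking on intervals only. *)
Lemma ge0_transfer (phi : RR -> RR) (w : RR -> R) : measurable_fun [set: RR] phi ->
  measurable_fun [set: RR] w -> (forall x, (0 <= w x)%R) ->
  (forall a b : R, (a < b)%R -> \int[mu]_(x in phi @^-1` `]a, b]) (w x)%:E = (b - a)%:E) ->
  forall f : RR -> \bar R, measurable_fun [set: RR] f -> (forall x, 0 <= f x) ->
  \int[mu]_x (f (phi x) * (w x)%:E) = \int[mu]_x f x.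
Proof.
move=> mphi mw w0 H f mf f0.
have mfphi : measurable_fun [set: RR] (f \o phi) by exact: measurableT_comp.
have /= <- := ge0_integral_density mu mw w0 mfphi (fun x => f0 (phi x)).
have mphi' : measurable_fun [set: RR] phi by [].
rewrite -[LHS](ge0_integral_pushforward mphi' _ measurableT mf) //.
apply: eq_measure_integral => A mA _.
apply/esym; apply: lebesgue_measure_unique => // _ [[a b] _ <-] /=.
rewrite /pushforward /density lebesgue_measure_itv /= lte_fin.
case: ltP => ab; first by rewrite H.
by rewrite set_itv_ge -?leNgt ?bnd_simp // preimage_set0 integral_set0.
Qed.

Lemma measurable_invr : measurable_fun [set: RR] (fun x : R => x^-1)%R.
Proof.
have -> : [set: RR] = [set x : R | x != 0%R] `|` [set 0%R].
  apply/seteqP; split => // x _ /=; have [->|] := eqVneq x 0%R; by [right|left].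
have o0 : open [set x : R | x != 0%R] by exact: open_neq.
apply/measurable_funU => //; first exact: open_measurable.
split; last exact: measurable_fun_set1.
apply: open_continuous_measurable_fun => // x; rewrite inE => x0.
exact: inv_continuous.
Qed.

Local Notation I := `](- (pi / 2)), (pi / 2)[%R.

Lemma cos_gt0_I (x : R) : x \in I -> (0 < cos x)%R.
Proof. by rewrite in_itv; exact: cos_gt0_pihalf. Qed.

Lemma measurable_tan : measurable_fun [set: RR] (tan : R -> R).
Proof.
have ms : measurable_fun [set: RR] (sin : R -> R).
  by apply: continuous_measurable_fun; exact: continuous_sin.
have mc : measurable_fun [set: RR] (cos : R -> R).
  by apply: continuous_measurable_fun; exact: continuous_cos.
by apply: measurable_funM => //; exact: (measurableT_comp measurable_invr mc).
Qed.

(** As tan is total and periodic, the density is cut off to I. Inside I the preimage of ]a, b] is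
    ]atan a, atan b], where the fundamental theorem of calculus gives the length b - a. *)
Lemma ge0_integral_tan (f : RR -> \bar R) : measurable_fun [set: RR] f -> (forall x, 0 <= f x) ->
  \int[mu]_(x in [set` I]) (f (tan x) * (1 + tan x ^+ 2)%:E) = \int[mu]_x f x.
Proof.
move=> mf f0.
pose w : RR -> R := (fun x : RR => 1 + tan x ^+ 2)%R \_ [set` I].
have mw0 : measurable_fun [set: RR] (fun x : R => 1 + tan x ^+ 2)%R.
  by apply: measurable_funD => //; apply: measurable_funX; exact: measurable_tan.
have mI : measurable ([set` I] : set RR) by [].
rewrite -(ge0_transfer (phi := tan) (w := w)) //.
- rewrite [LHS]integral_mkcond; apply: eq_integral => x _; rewrite /w !patchE.
  by case: ifPn => // _; rewrite mule0.
- exact: measurable_tan.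
- exact: ((measurable_restrictT _ mI).1 (measurable_funTS mw0)).
- by move=> x; rewrite /w patchE; case: ifPn => // _; rewrite addr_ge0 // sqr_ge0.
move=> a b ab.
have aI (x : R) : atan x \in I by rewrite in_itv /= atan_gtNpi2 atan_ltpi2.
transitivity (\int[mu]_(x in `]atan a, atan b]) (1 + tan x ^+ 2)%:E).
  rewrite [LHS]integral_mkcond [RHS]integral_mkcond; apply: eq_integral => x _.
  rewrite /w !patchE.
  have [xI|xI] := boolP (x \in I); last first.
    have -> : (x \in [set` I]) = false by apply: negbTE; apply: contra xI; rewrite inE.
    case: ifP => _; case: ifP => //; rewrite inE /= in_itv /= => /andP[x1 x2];
    by exfalso; move/negP: xI; apply; rewrite in_itv /= (lt_trans (atan_gtNpi2 a) x1) (le_lt_trans x2 (atan_ltpi2 b)).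
  have -> : (x \in [set` I]) by rewrite inE.
  have -> : (x \in tan @^-1` `]a, b]) = (x \in `]atan a, atan b]%classic).
    have E1 : (a < tan x)%R = (atan a < x)%R by rewrite -{1}(atanK a) ltr_tan.
    have E2 : (tan x <= b)%R = (x <= atan b)%R by rewrite -{1}(atanK b) !leNgt ltr_tan.
    by apply/idP/idP; rewrite !inE /= !in_itv /= E1 E2.
  by [].
have ltab := lt_atan ab.
have dtan (x : R) : x \in I -> is_derive x 1%R tan (1 + tan x ^+ 2)%R.
  move=> xI; rewrite -cos2_tan2 ?gt_eqF ?cos_gt0_I //; apply: is_derive_tan.
  by rewrite gt_eqF ?cos_gt0_I.
have inI (x : R) : (atan a <= x <= atan b)%R -> x \in I.
  move=> /andP[x1 x2]; rewrite in_itv /=.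
  by rewrite (lt_le_trans (atan_gtNpi2 a) x1) (le_lt_trans x2 (atan_ltpi2 b)).
have ctan (x : R) : x \in I -> {for x, continuous (tan : R -> R)}.
  by move=> xI; apply: continuous_tan; rewrite gt_eqF // cos_gt0_I.
rewrite integral_itv_obnd_cbnd; last exact/measurable_EFinP/measurable_funTS.
rewrite (@continuous_FTC2 _ (fun x => 1 + tan x ^+ 2)%R tan) ?atanK //.
- apply: contseg_within => x /inI xI; apply: cvgD; first exact: cvg_cst.
  by rewrite expr2; under eq_fun do rewrite expr2; apply: cvgM; exact: ctan.
- split.
  + move=> x; rewrite in_itv /= => /andP[x1 x2].
    by have [] := dtan x (inI x ltac:(by rewrite !ltW)).
  + by apply: cvg_at_right_filter; exact: ctan.
  + by apply: cvg_at_left_filter; exact: ctan.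
- move=> x; rewrite in_itv /= => /andP[x1 x2]; rewrite derive1E.
  by have [_ ->] := dtan x (inI x ltac:(by rewrite !ltW)).
Qed.

End Transfer.

(** * Change of variables in the plane *)
Section Plane.
Context {R : realType}.
Local Notation mu := (@lebesgue_measure R).
Local Notation RR := (measurableTypeR R).
Local Notation mu2 := (@lebesgue_measure R \x @lebesgue_measure R)%E.
Local Notation I := `](- (pi / 2)), (pi / 2)[%R.
Local Open Scope ereal_scope.

Lemma measurable_patch (A : set RR) (g : RR -> \bar R) : measurable A ->
  measurable_fun [set: RR] g -> measurable_fun [set: RR] (g \_ A).
Proof. by move=> mA mg; apply/(measurable_restrictT _ mA); exact: measurable_funTS. Qed.

Lemma ge0_integral_affine (a c : R) (f : RR -> \bar R) : (a != 0)%R ->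
  measurable_fun [set: RR] f -> (forall x, 0 <= f x) ->
  \int[mu]_x (f (a * x + c)%R * `|a|%:E) = \int[mu]_x f x.
Proof.
move=> a0 mf f0.
have ma : measurable_fun [set: RR] (fun x : RR => a * x + c)%R.
  by apply: measurable_funD => //; exact: measurable_funM.
apply: (ge0_transfer ma (w := fun=> `|a|%R)) => // u v uv.
have [ap|an|/esym/eqP] := ltgtP 0%R a; last by rewrite (negbTE a0).
  have -> : (fun x : R => a * x + c)%R @^-1` `]u, v] = `]((u - c) / a)%R, ((v - c) / a)%R]%classic.
    apply/seteqP; split => x /=; rewrite !in_itv /= ltr_pdivrMr // ler_pdivlMr //;
    by rewrite (mulrC x) ltrBlDr lerBrDr.
  rewrite integral_cst //= lebesgue_measure_itv /= lte_fin ltr_pM2r ?invr_gt0 // ltrD2r uv.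
  by rewrite -EFinB -EFinM gtr0_norm //; congr (_%:E); field; rewrite gt_eqF.
have -> : (fun x : R => a * x + c)%R @^-1` `]u, v] = `[((v - c) / a)%R, ((u - c) / a)%R[%classic.
  apply/seteqP; split => x /=; rewrite !in_itv /= ltr_ndivlMr // ler_ndivrMr //;
  by rewrite (mulrC x) ltrBlDr lerBrDr andbC.
rewrite integral_cst //= lebesgue_measure_itv /= lte_fin ltr_nM2r ?invr_lt0 // ltrD2r uv.
by rewrite -EFinB -EFinM ltr0_norm //; congr (_%:E); field; rewrite lt_eqF.
Qed.

Lemma measurable_affine (a c : R) : measurable_fun [set: RR] (fun x : RR => a * x + c : RR)%R.
Proof. by apply: measurable_funD => //; exact: measurable_funM. Qed.

Lemma measurable_opp : measurable_fun [set: RR] (fun x : RR => - x : RR)%R.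
Proof.
have := measurable_affine (-1) 0; congr (measurable_fun _ _).
by apply/funext => x; rewrite mulN1r addr0.
Qed.

Lemma ge0_integral_opp (f : RR -> \bar R) :
  measurable_fun [set: RR] f -> (forall x, 0 <= f x) ->
  \int[mu]_x f (- x)%R = \int[mu]_x f x.
Proof.
move=> mf f0; rewrite -(@ge0_integral_affine (-1) 0 f) ?oppr_eq0 ?oner_eq0 //.
by apply: eq_integral => x _; rewrite normrN1 mule1 mulN1r addr0.
Qed.

Lemma integral_split0 (k : RR -> \bar R) : measurable_fun [set: RR] k -> (forall x, 0 <= k x) ->
  \int[mu]_x k x = \int[mu]_(x in `]0%R, +oo[) (k x + k (- x)%R).
Proof.
move=> mk k0.
have mkN : measurable_fun [set: RR] (fun x : RR => k (- x)%R).
  by apply: (measurableT_comp mk); exact: measurable_opp.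
have s0 : ([set: RR] = `]-oo, 0%R] `|` `]0%R, +oo[)%classic.
  by apply/seteqP; split => // x _ /=; rewrite !in_itv /= andbT; case: (leP x 0%R); [left|right].
rewrite s0 ge0_integral_setU //=; last 2 first.
  by rewrite -s0.
  apply/disj_setPS => x [] /=; rewrite !in_itv /= andbT => x0 x1.
  by have := le_lt_trans x0 x1; rewrite ltxx.
rewrite ge0_integralD //; [|exact: measurable_funTS..].
rewrite addeC; congr (_ + _).
rewrite -integral_itv_bndo_bndc; last exact: measurable_funTS.
transitivity (\int[mu]_x (k \_ `]-oo, 0%R[%classic) (- x)%R).
  rewrite integral_mkcond; apply/esym; apply: ge0_integral_opp.
    by apply: measurable_patch => //; exact: measurable_itv.
  by move=> x; rewrite patchE; case: ifP.
rewrite [RHS]integral_mkcond; apply: eq_integral => x _; rewrite !patchE.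
by congr (if _ then _ else _); apply/idP/idP; rewrite !inE /= !in_itv /= andbT oppr_lt0.
Qed.

(** Substituting x = tan t turns both sides into integrals over ]0, pi/2[, and replacing t by pi/2 -
    t inverts the tangent. *)
Lemma ge0_integral_inv_pos (f : RR -> \bar R) : measurable_fun [set: RR] f -> (forall x, 0 <= f x) ->
  \int[mu]_(x in `]0%R, +oo[) (f (x^-1)%R * (x ^- 2)%:E) = \int[mu]_(x in `]0%R, +oo[) f x.
Proof.
move=> mf f0.
have mF : measurable_fun [set: RR] (fun x : RR => f (x^-1)%R * (x ^- 2)%:E).
  apply: emeasurable_funM; first exact: (measurableT_comp mf measurable_invr).
  apply/measurable_EFinP; apply: (measurableT_comp measurable_invr); exact: measurable_funX.
rewrite integral_mkcond [RHS]integral_mkcond.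
rewrite -[LHS]ge0_integral_tan; last 2 first.
- by apply: measurable_patch => //; exact: measurable_itv.
- by move=> x; rewrite patchE; case: ifP => // _; rewrite mule_ge0 // lee_fin invr_ge0 sqr_ge0.
rewrite -[RHS]ge0_integral_tan; last 2 first.
- by apply: measurable_patch => //; exact: measurable_itv.
- by move=> x; rewrite patchE; case: ifP.
rewrite integral_mkcond [RHS]integral_mkcond.
rewrite -[RHS](@ge0_integral_affine (-1) (pi / 2)); last 3 first.
- by rewrite oppr_eq0 oner_eq0.
- apply: measurable_patch; [exact: measurable_itv|apply: emeasurable_funM].
    apply: (measurableT_comp _ measurable_tan).
    by apply: measurable_patch => //; exact: measurable_itv.
  by apply/measurable_EFinP; apply: measurable_funD => //; apply: measurable_funX; exact: measurable_tan.
- move=> x; rewrite patchE; case: ifP => // _; rewrite mule_ge0 //.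
    by rewrite patchE; case: ifP.
  by rewrite lee_fin addr_ge0 ?sqr_ge0.
apply: eq_integral => x _; rewrite normrN1 mule1 mulN1r !patchE.
have p0 := pi_gt0 R.
have tan_gt0 (y : R) : y \in I -> (0 < tan y)%R = (0 < y)%R.
  by move=> yI; rewrite -{1}tan0 ltr_tan //; rewrite in_itv /=; lra.
have inPt (y : R) : (y \in `]0%R, +oo[%classic) = (0 < y)%R.
  by apply/idP/idP; rewrite inE /= in_itv /= andbT.
have inIt (y : R) : (y \in [set` I]) = (y \in I).
  by apply/idP/idP => [|h]; [rewrite inE|rewrite inE].
rewrite !inPt !inIt.
have [xI|xI] := boolP ((0 < x) && (x < pi / 2))%R; last first.
  transitivity (0 : \bar R).
    case: ifPn => // h; rewrite tan_gt0 //; case: ifP; rewrite ?mul0e // => x0.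
    by move: xI h; rewrite x0 in_itv /= => /negbTE ->; rewrite andbF.
  case: ifPn => // h; rewrite tan_gt0 //; case: ifP; rewrite ?mul0e // => x0.
  exfalso; move/negP: xI; apply; move: h x0; rewrite in_itv /=; lra.
have /andP[x0 x1] := xI.
have h1 : x \in I by rewrite in_itv /=; lra.
have h2 : (- x + pi / 2)%R \in I by rewrite in_itv /=; lra.
rewrite h1 h2 !tan_gt0 // x0 ifT; last by lra.
have c0 := cos_gt0_I h1; have s0 : (0 < sin x)%R.
  by have := tan_gt0 x h1; rewrite x0 /tan pmulr_lgt0 ?invr_gt0.
have -> : tan (- x + pi / 2) = (tan x)^-1%R.
  rewrite /tan sinD cosD sinN cosN sin_pihalf cos_pihalf.
  by rewrite !mulr0 !mulr1 add0r sub0r opprK invf_div.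
rewrite -muleA -EFinM; congr (_ * _%:E).
rewrite mulrDr mulr1 mulVf ?sqrf_eq0 ?gt_eqF ?divr_gt0 // exprVn addrC //.
Qed.

Lemma ge0_integral_inv (f : RR -> \bar R) : measurable_fun [set: RR] f -> (forall x, 0 <= f x) ->
  \int[mu]_x (f (x^-1)%R * (x ^- 2)%:E) = \int[mu]_x f x.
Proof.
move=> mf f0.
have mfN : measurable_fun [set: RR] (fun x : RR => f (- x)%R) by exact: (measurableT_comp mf measurable_opp).
rewrite integral_split0; last 2 first.
- apply: emeasurable_funM; first exact: (measurableT_comp mf measurable_invr).
  apply/measurable_EFinP; apply: (measurableT_comp measurable_invr); exact: measurable_funX.
- by move=> x; rewrite mule_ge0 // lee_fin invr_ge0 sqr_ge0.
rewrite [RHS]integral_split0 //.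
rewrite -(@ge0_integral_inv_pos (fun x => f x + f (- x)%R)); last 2 first.
- exact: emeasurable_funD.
- by move=> x; rewrite adde_ge0.
apply: eq_integral => x _; rewrite sqrrN invrN ge0_muleDl //.
Qed.

Definition null0 := @lebesgue_measure_set1 R 0%R.

Lemma ae_neq0 : {ae mu, forall x : RR, x != 0%R}.
Proof.
exists [set 0%R]; split => //; first exact: null0.
by move=> x /= /negP; rewrite negbK => /eqP.
Qed.

Lemma mfst : measurable_fun [set: RR * RR] (fst : RR * RR -> RR).
Proof. exact: measurable_fst. Qed.

Lemma msnd : measurable_fun [set: RR * RR] (snd : RR * RR -> RR).
Proof. exact: measurable_snd. Qed.

Section Slope.
Variable h : RR * RR -> \bar R.
Hypotheses (mh : measurable_fun [set: RR * RR] h) (h0 : forall z, 0 <= h z).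

Let k (z : RR * RR) := h (z.1, z.1 * z.2)%R * `|z.1|%:E.

Lemma measurable_slope : measurable_fun [set: RR * RR] k.
Proof.
apply: emeasurable_funM.
  apply: (measurableT_comp mh); apply: measurable_fun_pair; first exact: mfst.
  by apply: measurable_funM; [exact: mfst|exact: msnd].
apply/measurable_EFinP; apply: measurableT_comp; [exact: normr_measurable|exact: mfst].
Qed.

Let k0 z : 0 <= k z.
Proof. by rewrite mule_ge0 // lee_fin. Qed.

(** On the vertical line through x <> 0 the substitution y = x t has Jacobian |x|, and x = 0 is a
    null set. Tonelli then puts the slope t outside. *)
Lemma integral_slope : \int[mu2]_z h z = \int[mu]_t \int[mu]_x k (x, t).
Proof.
rewrite (fubini_tonelli1 _ mh h0) -(fubini_tonelli _ measurable_slope k0).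
apply: ge0_ae_eq_integral => //.
- exact: measurable_fun_fubini_tonelli_F.
- exact: measurable_fun_fubini_tonelli_F _ measurable_slope k0.
- by move=> x _; exact: integral_ge0.
- by move=> x _; exact: integral_ge0.
apply: filterS ae_neq0 => x x0 _; rewrite /fubini_F /k /=.
rewrite -(@ge0_integral_affine x 0 (fun y => h (x, y))) //.
  by apply: eq_integral => y _; rewrite addr0.
exact: (measurableT_comp mh (measurable_pair1 x)).
Qed.

(** Polar coordinates with a signed radius s and an angle in ]-pi/2, pi/2[: on the line of slope t
    the abscissa is s / sqrt (1 + t^2), and t is the tangent of the angle. *)
Lemma integral_circle : \int[mu2]_z h z =
  \int[mu]_s (`|s|%:E * \int[mu]_(t in [set` I]) h (s * cos t, s * sin t)%R).
Proof.
rewrite integral_slope.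
pose c (t : R) := (Num.sqrt (1 + t ^+ 2))^-1%R.
have c0 t : (0 < c t)%R by rewrite invr_gt0 sqrtr_gt0 ltr_pwDl // sqr_ge0.
pose m (z : RR * RR) := h (z.1 * c z.2, z.1 * c z.2 * z.2)%R * (`|z.1| * c z.2 ^+ 2)%:E.
have mc : measurable_fun [set: RR] c.
  apply: (measurableT_comp measurable_invr); apply: measurableT_comp.
    by apply: continuous_measurable_fun; exact: sqrt_continuous.
  by apply: measurable_funD => //; apply: measurable_funX.
have mcs : measurable_fun [set: RR * RR] (fun z : RR * RR => c z.2).
  exact: (measurableT_comp mc msnd).
have mm : measurable_fun [set: RR * RR] m.
  apply: emeasurable_funM.
    apply: (measurableT_comp mh); apply: measurable_fun_pair.
      by apply: measurable_funM => //; exact: mfst.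
    by apply: measurable_funM; [apply: measurable_funM => //; exact: mfst|exact: msnd].
  apply/measurable_EFinP; apply: measurable_funM; last exact: measurable_funX.
  by apply: measurableT_comp; [exact: normr_measurable|exact: mfst].
have m0 z : 0 <= m z by rewrite mule_ge0 // lee_fin mulr_ge0 // sqr_ge0.
transitivity (\int[mu]_t \int[mu]_s m (s, t)).
  apply: eq_integral => t _.
  rewrite -(@ge0_integral_affine (c t) 0 (fun x => k (x, t))); last 3 first.
  - by rewrite gt_eqF.
  - exact: (measurableT_comp measurable_slope (measurable_pair2 t)).
  - by move=> x; exact: k0.
  apply: eq_integral => s _; rewrite /k /m /= addr0 (mulrC (c t)) -muleA -EFinM.
  by congr (_ * _%:E); rewrite normrM (gtr0_norm (c0 t)); ring.
rewrite -(fubini_tonelli _ mm m0); apply: eq_integral => s _.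
have ms : measurable_fun [set: RR] (fun t => m (s, t)).
  exact: (measurableT_comp mm (measurable_pair1 s)).
rewrite -(ge0_integral_tan ms) // -ge0_integralZl //; last first.
- apply: measurable_funTS; apply: (measurableT_comp mh); apply: measurable_fun_pair.
    by apply: measurable_funM => //; apply: continuous_measurable_fun; exact: continuous_cos.
  by apply: measurable_funM => //; apply: continuous_measurable_fun; exact: continuous_sin.
apply: eq_integral => t /[!inE] /= tI; rewrite /m /=.
have ct := cos_gt0_I tI.
have E1 : (1 + tan t ^+ 2 = (cos t ^+ 2)^-1)%R by rewrite -cos2_tan2 ?gt_eqF.
have E2 : c (tan t) = cos t.
  by rewrite /c E1 sqrtrV ?sqr_ge0 // sqrtr_sqr gtr0_norm // invrK.
rewrite E2 E1 -muleA -EFinM muleC; congr (_%:E * h (_, _)).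
  by rewrite mulfK // expf_neq0 // gt_eqF.
by rewrite -mulrA /tan [(cos t * _)%R]mulrC divfK ?gt_eqF.
Qed.

End Slope.

(** Inversion in the unit circle keeps every line through 0. On the line of slope t it is therefore
    the map x -> 1 / x of the real line, rescaled by q = 1 + t^2. *)
Lemma integral_inversion (h : RR * RR -> \bar R) :
  measurable_fun [set: RR * RR] h -> (forall z, 0 <= h z) ->
  \int[mu2]_z h z = \int[mu2]_z (h (z.1 / (z.1 ^+ 2 + z.2 ^+ 2), z.2 / (z.1 ^+ 2 + z.2 ^+ 2))%R
    * ((z.1 ^+ 2 + z.2 ^+ 2) ^- 2)%:E).
Proof.
move=> mh h0.
have mq : measurable_fun [set: RR * RR] (fun z : RR * RR => z.1 ^+ 2 + z.2 ^+ 2 : RR)%R.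
  by apply: measurable_funD; apply: measurable_funX; [exact: mfst|exact: msnd].
have mqV : measurable_fun [set: RR * RR] (fun z : RR * RR => (z.1 ^+ 2 + z.2 ^+ 2)^-1 : RR)%R.
  exact: (measurableT_comp measurable_invr mq).
pose h' (z : RR * RR) := h (z.1 / (z.1 ^+ 2 + z.2 ^+ 2), z.2 / (z.1 ^+ 2 + z.2 ^+ 2))%R
    * ((z.1 ^+ 2 + z.2 ^+ 2) ^- 2)%:E.
have mh' : measurable_fun [set: RR * RR] h'.
  apply: emeasurable_funM.
    apply: (measurableT_comp mh); apply: measurable_fun_pair.
      by apply: measurable_funM => //; exact: mfst.
    by apply: measurable_funM => //; exact: msnd.
  apply/measurable_EFinP; apply: (measurableT_comp measurable_invr); exact: measurable_funX.
have h'0 z : 0 <= h' z by rewrite mule_ge0 // lee_fin invr_ge0 sqr_ge0.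
rewrite (integral_slope mh h0) [RHS](integral_slope mh' h'0) /h'.
apply: eq_integral => t _.
pose q : R := (1 + t ^+ 2)%R; have q0 : (0 < q)%R by rewrite ltr_pwDl // sqr_ge0.
pose f (y : RR) := h (y / q, y / q * t)%R * (`|y| / q ^+ 2)%:E.
have mf : measurable_fun [set: RR] f.
  apply: emeasurable_funM.
    apply: (measurableT_comp mh); apply: measurable_fun_pair; first exact: measurable_funM.
    by apply: measurable_funM => //; exact: measurable_funM.
  by apply/measurable_EFinP; apply: measurable_funM => //; apply: measurableT_comp => //; exact: normr_measurable.
have f0 y : 0 <= f y by rewrite mule_ge0 // lee_fin divr_ge0 // sqr_ge0.
transitivity (\int[mu]_y f y).
  rewrite -(@ge0_integral_affine q 0 f) ?gt_eqF //; apply: eq_integral => x _ /=.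
  rewrite /f addr0 (mulrC q) mulfK ?gt_eqF // -muleA -EFinM; congr (_ * _%:E).
  by rewrite normrM (gtr0_norm q0); field; rewrite gt_eqF.
rewrite -(ge0_integral_inv mf f0); apply: eq_integral => x _ /=.
have [->|x0] := eqVneq x 0%R; first by rewrite normr0 mule0 expr0n /= invr0 mule0.
have E : (x ^+ 2 + (x * t) ^+ 2 = x ^+ 2 * q)%R by rewrite /q; ring.
rewrite E /f -!muleA -!EFinM; congr (h (_, _) * _%:E).
- by field; rewrite gt_eqF.
- by field; rewrite gt_eqF.
rewrite normfV -(real_normK (num_real x)).
have : (`|x| != 0 :> R)%R by rewrite normr_eq0.
move: (`|x|%R : R) => y y0.
by field; rewrite gt_eqF.
Qed.

Lemma integral_shift (c d : R) (h : RR * RR -> \bar R) :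
  measurable_fun [set: RR * RR] h -> (forall z, 0 <= h z) ->
  \int[mu2]_z h z = \int[mu2]_z h (z.1 + c, z.2 + d)%R.
Proof.
move=> mh h0.
have mh' : measurable_fun [set: RR * RR] (fun z : RR * RR => h (z.1 + c, z.2 + d)%R).
  apply: (measurableT_comp mh); apply: measurable_fun_pair.
    by apply: measurable_funD => //; exact: mfst.
  by apply: measurable_funD => //; exact: msnd.
have mh'' : measurable_fun [set: RR * RR] (fun z : RR * RR => h (z.1, z.2 + d)%R).
  apply: (measurableT_comp mh); apply: measurable_fun_pair; first exact: mfst.
  by apply: measurable_funD => //; exact: msnd.
rewrite (fubini_tonelli1 _ mh h0) (fubini_tonelli1 _ mh' (fun z => h0 _)).
have H0 x : 0 <= fubini_F mu h x by exact: integral_ge0.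
rewrite -(@ge0_integral_affine 1 c (fubini_F mu h)) ?oner_eq0 //; last first.
  exact: measurable_fun_fubini_tonelli_F.
apply: eq_integral => x _; rewrite normr1 mule1 mul1r /fubini_F.
rewrite -(@ge0_integral_affine 1 d (fun y => h ((x + c)%R, y))) ?oner_eq0 //.
  by apply: eq_integral => y _; rewrite normr1 mule1 mul1r.
exact: (measurableT_comp mh (measurable_pair1 _)).
Qed.

Lemma integral_conj (h : RR * RR -> \bar R) :
  measurable_fun [set: RR * RR] h -> (forall z, 0 <= h z) ->
  \int[mu2]_z h z = \int[mu2]_z h (z.1, - z.2)%R.
Proof.
move=> mh h0.
have mh' : measurable_fun [set: RR * RR] (fun z : RR * RR => h (z.1, - z.2)%R).
  apply: (measurableT_comp mh); apply: measurable_fun_pair; first exact: mfst.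
  exact: (measurableT_comp measurable_opp msnd).
rewrite (fubini_tonelli1 _ mh h0) (fubini_tonelli1 _ mh' (fun z => h0 _)).
apply: eq_integral => x _; rewrite /fubini_F.
rewrite -(ge0_integral_opp (f := fun y => h (x, y))) //.
exact: (measurableT_comp mh (measurable_pair1 _)).
Qed.

(** 1 / u is the conjugate of u / |u|^2, so the map is composed of translations, a conjugation and
    an inversion. At the pole w = e the Jacobian factor is 0 by the convention on inverses. *)
Lemma integral_mobius (c e : R[i]) (H : R[i] -> \bar R) :
  measurable_fun [set: RR * RR] (fun z : RR * RR => H (cplx z)) -> (forall z, 0 <= H z) ->
  \int[mu2]_z H (cplx z) =
  \int[mu2]_z (H (c + (cplx z - e)^-1)%R * (modulus (cplx z - e) ^- 4)%:E).
Proof.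
move=> mH H0.
pose h1 (z : RR * RR) := H (cplx z).
have cE (z : RR * RR) : cplx (z.1 + complex.Re c, z.2 + complex.Im c)%R = (cplx z + c)%R.
  by case: (c).
pose h2 (z : RR * RR) := h1 (z.1 + complex.Re c, z.2 + complex.Im c)%R.
have mh2 : measurable_fun [set: RR * RR] h2.
  apply: (measurableT_comp mH); apply: measurable_fun_pair.
    by apply: measurable_funD => //; exact: mfst.
  by apply: measurable_funD => //; exact: msnd.
have h20 z : 0 <= h2 z by exact: H0.
have mq : measurable_fun [set: RR * RR] (fun z : RR * RR => z.1 ^+ 2 + z.2 ^+ 2 : RR)%R.
  by apply: measurable_funD; apply: measurable_funX; [exact: mfst|exact: msnd].
have mqV : measurable_fun [set: RR * RR] (fun z : RR * RR => (z.1 ^+ 2 + z.2 ^+ 2)^-1 : RR)%R.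
  exact: (measurableT_comp measurable_invr mq).
pose h3 (z : RR * RR) := h2 (z.1 / (z.1 ^+ 2 + z.2 ^+ 2), z.2 / (z.1 ^+ 2 + z.2 ^+ 2))%R
    * ((z.1 ^+ 2 + z.2 ^+ 2) ^- 2)%:E.
have mh3 : measurable_fun [set: RR * RR] h3.
  apply: emeasurable_funM.
    apply: (measurableT_comp mh2); apply: measurable_fun_pair.
      by apply: measurable_funM => //; exact: mfst.
    by apply: measurable_funM => //; exact: msnd.
  apply/measurable_EFinP; apply: (measurableT_comp measurable_invr); exact: measurable_funX.
have h30 z : 0 <= h3 z by rewrite mule_ge0 // lee_fin invr_ge0 sqr_ge0.
pose h4 (z : RR * RR) := h3 (z.1, - z.2)%R.
have mh4 : measurable_fun [set: RR * RR] h4.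
  apply: (measurableT_comp mh3); apply: measurable_fun_pair; first exact: mfst.
  exact: (measurableT_comp measurable_opp msnd).
have h40 z : 0 <= h4 z by exact: h30.
rewrite (integral_shift (complex.Re c) (complex.Im c) mH (fun z => H0 _)).
rewrite (integral_inversion mh2 h20) (integral_conj mh3 h30).
rewrite (integral_shift (- complex.Re e) (- complex.Im e) mh4 h40).
apply: eq_integral => z _; rewrite /h4 /h3 /h2 /h1 /=.
set u := (cplx z - e)%R.
have -> : (z.1 - complex.Re e = complex.Re u)%R by rewrite /u; case: (e).
have -> : (z.2 - complex.Im e = complex.Im u)%R by rewrite /u; case: (e).
rewrite sqrrN -modulus_sqr -exprM; congr (H _ * _).
rewrite modulus_sqr; case: (c) => a b; rewrite [in RHS]addrC.
by case: (u) => x y /=; apply/eqP; rewrite eq_complex /= mulNr !eqxx.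
Qed.

End Plane.

(** * Polar coordinates and discs *)
(** The integral of a nonnegative function is a supremum over the simple functions below it, and a
    larger function has more of them. *)
Lemma le_integral_ge0 d (T : measurableType d) (R : realType) (m : {measure set T -> \bar R})
    (A : set T) (f g : T -> \bar R) : (forall x, A x -> (0 <= f x <= g x)%E) ->
  (\int[m]_(x in A) f x <= \int[m]_(x in A) g x)%E.
Proof.
move=> fg; have f0 x : A x -> (0 <= f x)%E by move=> /fg/andP[].
have g0 x : A x -> (0 <= g x)%E by move=> /fg/andP[]; exact: le_trans.
rewrite !ge0_integralE //; apply: le_ereal_sup => _ [h hf <-]; exists h => // x.
apply: le_trans (hf x) _; rewrite !patchE; case: ifPn => //; rewrite inE => /fg/andP[] //.
Qed.

Section Area.
Context {R : realType}.
Local Notation mu := (@lebesgue_measure R).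
Local Notation RR := (measurableTypeR R).
Local Notation mu2 := (@lebesgue_measure R \x @lebesgue_measure R)%E.
Local Notation I := `](- (pi / 2)), (pi / 2)[%R.
Local Notation N := (@modulus R).
Implicit Types (D : set R[i]).

Definition preg D : set (RR * RR) := [set w | D (cplx w)].

(** An open set is the union of the boxes contained in it with rational centre and half-side 1 / (n
    + 1), a countable family of products of intervals. *)
Lemma measurable_open D : open D -> measurable (preg D).
Proof.
move=> /open_modulus oD.
pose del (n : nat) : R := n.+1%:R^-1.
have del0 n : 0 < del n by rewrite invr_gt0.
pose box (q r : rat) n : set (RR * RR) :=
  `](ratr q - del n), (ratr q + del n)[%classic `*` `](ratr r - del n), (ratr r + del n)[%classic.
pose B q r n := if `[< box q r n `<=` preg D >] then box q r n else set0.
have mB q r n : measurable (B q r n).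
  by rewrite /B; case: ifP => // _; apply: measurableX; exact: measurable_itv.
have -> : preg D = \bigcup_q \bigcup_r \bigcup_n B q r n.
  apply/seteqP; split => [[x y] Dxy|z [q _ [r _ [n _]]]]; last first.
    by rewrite /B; case: ifPn => // /asboolP; exact.
  have [d d0 Hd] := oD _ Dxy.
  have [n nd] : exists n, del n < d / 4.
    exists (Num.truncn (d / 4)^-1); rewrite /del invf_plt ?posrE ?divr_gt0 //.
    exact: truncnS_gt.
  have [q] := @rat_in_itvoo R (x - del n) (x + del n) ltac:(have := del0 n; lra).
  have [r] := @rat_in_itvoo R (y - del n) (y + del n) ltac:(have := del0 n; lra).
  rewrite !in_itv /= => hr hq.
  have sub : box q r n `<=` preg D.
    move=> [u v] [/=]; rewrite !in_itv /= => hu hv; apply: Hd.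
    apply: le_lt_trans (modulus_le _) _ => /=.
    have h1 : `|u - x| < 2 * del n by rewrite ltr_norml; lra.
    have h2 : `|v - y| < 2 * del n by rewrite ltr_norml; lra.
    by move: h1 h2 nd; lra.
  exists q => //; exists r => //; exists n => //; rewrite /B ifT; last exact/asboolP.
  by rewrite /box; split; rewrite /= in_itv /=; lra.
apply: bigcupT_measurable_rat => q; apply: bigcupT_measurable_rat => r.
exact: bigcupT_measurable.
Qed.

Definition rcont (phi : R[i] -> R) z := forall e : R, 0 < e -> exists2 d : R, 0 < d &
  forall w, N (w - z) < d -> `|phi w - phi z| < e.

Lemma measurable_rcont D (phi : R[i] -> R) : open D -> (forall z, D z -> rcont phi z) ->
  measurable_fun (preg D) (fun w => phi (cplx w) : RR).
Proof.
move=> oD cphi; have := oD => /open_modulus oD'.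
apply: (@measurability _ _ _ RR _ _ _ (RGenOInfty.measurableE R)) => _ [_ [a ->] <-].
have -> : preg D `&` (fun w => phi (cplx w)) @^-1` `]a, +oo[%classic =
    preg (D `&` [set z | a < phi z]).
  by apply/seteqP; split => w [Dw] /=; rewrite in_itv /= andbT.
apply: measurable_open; apply/open_modulus => z [Dz az].
have [d d0 Hd] := oD' z Dz; have [d' d'0 Hd'] := cphi z Dz (phi z - a) ltac:(by rewrite subr_gt0).
exists (Num.min d d'); first by rewrite lt_min d0.
move=> w; rewrite lt_min => /andP[/Hd Dw /Hd']; rewrite ltr_norml /= => h; split => //=.
by move: h; lra.
Qed.

Lemma measurable_plane (A : set (RR * RR)) : measurable A -> measurable (A : set (plane R)).
Proof. exact: caratheodory_measurable_mu_ext. Qed.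

Lemma area_mu2 (A : set (RR * RR)) : measurable A -> area R A = mu2 A.
Proof. exact: measurable_mu_extE. Qed.

Lemma measurable_fun_plane d (T : measurableType d) (A : set (RR * RR)) (f : RR * RR -> T) :
  measurable A -> measurable_fun A f -> measurable_fun (A : set (plane R)) (f : plane R -> T).
Proof. by move=> mA mf _ Y mY; apply: measurable_plane; exact: mf. Qed.

(** The identity from [plane R] to the product space is measurable and pushes [area] forward to the
    product measure; this makes Tonelli's theorem available for [area]. *)
Lemma integral_area (A : set (RR * RR)) (f : RR * RR -> \bar R) : measurable A ->
  measurable_fun A f -> (forall x, A x -> (0 <= f x)%E) ->
  (\int[area R]_(w in (A : set (plane R))) f w = \int[mu2]_(w in A) f w)%E.
Proof.
move=> mA mf f0.
have mid : measurable_fun [set: plane R] (id : plane R -> RR * RR).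
  by move=> _ Y mY; rewrite setTI; exact: measurable_plane.
have f0' : {in A, forall y, (0 <= f y)%E} by move=> x /[!inE]; exact: f0.
have := ge0_integral_pushforward mid (area R) mA mf f0'.
rewrite preimage_id => <-; apply: eq_measure_integral => B mB _.
exact: (area_mu2 mB).
Qed.

(** The radii s and - s are gathered on ]0, +oo[, so the two inner integrals are the right and the
    left half of the circle. *)
Lemma integral_polar (h : RR * RR -> \bar R) : measurable_fun [set: RR * RR] h ->
  (forall z, (0 <= h z)%E) ->
  (\int[mu2]_z h z = \int[mu]_(s in `]0%R, +oo[) (s%:E *
    (\int[mu]_(t in [set` I]) h (s * cos t, s * sin t)%R +
     \int[mu]_(t in [set` I]) h (- s * cos t, - s * sin t)%R)))%E.
Proof.
move=> mh h0; rewrite integral_circle //.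
pose k s := (`|s|%:E * \int[mu]_(t in [set` I]) h (s * cos t, s * sin t)%R)%E.
have k0 s : (0 <= k s)%E by apply: mule_ge0 => //; apply: integral_ge0.
have mk : measurable_fun [set: RR] k.
  apply: emeasurable_funM.
    by apply/measurable_EFinP; apply: measurableT_comp => //; exact: normr_measurable.
  pose m (z : RR * RR) := (h (z.1 * cos z.2, z.1 * sin z.2)%R * (\1_[set` I] z.2)%:E)%E.
  have mm : measurable_fun [set: RR * RR] m.
    apply: emeasurable_funM.
      apply: (measurableT_comp mh); apply: measurable_fun_pair.
        apply: measurable_funM; first exact: mfst.
        by apply: (measurableT_comp (f := cos : RR -> RR)); [apply: continuous_measurable_fun; exact: continuous_cos|exact: msnd].
      apply: measurable_funM; first exact: mfst.
        by apply: (measurableT_comp (f := sin : RR -> RR)); [apply: continuous_measurable_fun; exact: continuous_sin|exact: msnd].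
    apply/measurable_EFinP; apply: measurableT_comp; last exact: msnd.
    by apply: measurable_indic.
  have m0 z : (0 <= m z)%E by rewrite mule_ge0 // lee_fin.
  have := measurable_fun_fubini_tonelli_F (m2 := mu) _ mm m0.
  apply: eq_measurable_fun => s _; rewrite /fubini_F /m /= [RHS]integral_mkcond /=.
  by apply: eq_integral => t _; rewrite /patch indicE; case: ifP => _; rewrite ?mule1 ?mule0.
rewrite -/k integral_split0 //; apply: eq_integral => s; rewrite inE /= in_itv /= andbT => s0.
have i0 (c : R) : (0 <= \int[mu]_(t in [set` I]) h (c * cos t, c * sin t)%R)%E by apply: integral_ge0.
by rewrite normrN gtr0_norm // [RHS]ge0_muleDr.
Qed.

Definition disc (r : R) : set R[i] := [set z | N z < r].

Lemma measurable_disc (r : R) : measurable (preg (disc r)).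
Proof.
apply: measurable_open; apply/open_modulus => z zr; exists (r - N z); first by rewrite subr_gt0.
move=> w wz; rewrite /disc /=; have := modulus_dist w z; move: wz; lra.
Qed.

Lemma disc_polar (r : R) (F : R[i] -> R) : (forall z, 0 <= F z) ->
  measurable_fun (preg (disc r)) (fun w => F (cplx w)) ->
  (\int[mu2]_(w in preg (disc r)) (F (cplx w))%:E =
   \int[mu]_(s in `]0%R, r[) (s%:E *
    (\int[mu]_(t in [set` I]) (F (s%:C * cis t)%R)%:E +
     \int[mu]_(t in [set` I]) (F (- (s%:C * cis t))%R)%:E)))%E.
Proof.
move=> F0 mF; rewrite integral_mkcond integral_polar; last 2 first.
- by apply/(measurable_restrictT _ (measurable_disc r)); exact/measurable_EFinP.
- by move=> z; rewrite patchE; case: ifP => // _; rewrite lee_fin.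
rewrite [RHS]integral_mkcond [LHS]integral_mkcond; apply: eq_integral => s _.
have E (u t : R) : cplx (u * cos t, u * sin t) = u%:C * cis t.
  by apply/eqP; rewrite eq_complex /= !mul0r subr0 addr0 !eqxx.
rewrite !patchE; have [s0|s0] := ltP 0 s; last first.
  rewrite !ifF //; apply/negbTE; rewrite notin_setE /= in_itv /= ?andbT => h; move: h s0; lra.
have Ns t : N (s%:C * cis t) = s by rewrite modulusM modulus_cis mulr1 modulus_real gtr0_norm.
rewrite [LHS]ifT; last by rewrite inE /= in_itv /= s0.
have pd w : N (cplx w) < r -> w \in preg (disc r) by move=> h; apply/mem_set.
have [sr|sr] := ltP s r.
  rewrite ifT; last by rewrite inE /= in_itv /= s0.
  congr (_ * (_ + _))%E; apply: eq_integral => t _; rewrite patchE.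
    rewrite ifT; first exact: (congr1 (fun x => (F x)%:E) (E s t)).
    by apply: pd; rewrite E Ns.
  have E' : cplx (- s * cos t, - s * sin t) = - (s%:C * cis t) by rewrite E rmorphN mulNr.
  rewrite ifT; first exact: (congr1 (fun x => (F x)%:E) E').
  by apply: pd; rewrite E' modulusN Ns.
rewrite ifF; last by apply/negbTE; rewrite notin_setE /= in_itv /= => h; move: h sr; lra.
rewrite !integral0_eq ?adde0 ?mule0 // => t _; rewrite patchE ifF //; apply/negbTE; rewrite notin_setE;
  (change (~ (N (cplx (- s * cos t, - s * sin t)) < r)) || change (~ (N (cplx (s * cos t, s * sin t)) < r)));
  by rewrite E ?rmorphN ?mulNr ?modulusN Ns; apply/negP; rewrite -leNgt.
Qed.

Lemma integral_oo f a b : contseg f a b ->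
  (\int[mu]_(x in `]a, b[) (f x)%:E = (intg f a b)%:E)%E.
Proof.
move=> cf; have intf := contseg_integrable cf.
have mf := (measurable_int mu intf).
rewrite integral_itv_bndo_bndc; last by apply: measurable_funS mf => //; exact: subset_itvW.
rewrite integral_itv_obnd_cbnd //; last by apply: measurable_funS mf => //; exact: subset_itv_oc_cc.
by rewrite /intg /Rintegral fineK // integrable_fin_num.
Qed.

Lemma integral_power (C r : R) (m : nat) : 0 < r ->
  (\int[mu]_(s in `]0%R, r[) (s%:E * (2 * C * s ^+ (2 * m))%:E) = (C * r ^+ (2 * m + 2) / m.+1%:R)%:E)%E.
Proof.
move=> r0; under eq_integral do rewrite -EFinM.
pose F s := C / m.+1%:R * s ^+ (2 * m + 2).
have dF (s : R) : is_derive s (1 : R) F (s * (2 * C * s ^+ (2 * m))).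
  have h : is_derive s (1 : R) (fun x : R => x ^+ (2 * m).+2) ((2 * m).+2%:R * s ^+ (2 * m).+1).
    by apply: DeriveDef; [exact: exprn_derivable|rewrite exp_derive /GRing.scale /= mulr1].
  have := is_deriveZ (C / m.+1%:R) h; rewrite /F addn2 => h'.
  apply: (is_derive_eq h'); rewrite /GRing.scale /= exprS -[(2 * m).+2%:R]natr1 -[(2 * m).+1%:R]natr1 natrM -[m.+1%:R]natr1.
  by field; rewrite natr1.
rewrite (@integral_oo (fun s => s * (2 * C * s ^+ (2 * m)))); last first.
  move=> s _; apply: cvgM; first exact: cvg_id.
  by apply: cvgM; [exact: cvg_cst|exact: exprn_continuous].
rewrite (@intg_FTC _ F) //; last first.
  move=> s _; apply: cvgM; first exact: cvg_id.
  by apply: cvgM; [exact: cvg_cst|exact: exprn_continuous].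
by rewrite /F addn2 [in X in _ - X]exprS mul0r mulr0 subr0 mulrAC.
Qed.

Lemma cdiff_rcont_sqr (G : R[i] -> R[i]) z l : cdiff G z l -> rcont (fun w => N (G w) ^+ 2) z.
Proof.
move=> /cdiff_ccont cG e e0; set A := N (G z) + 1; have A0 : 0 < A by rewrite ltr_wpDl ?modulus_ge0.
have [d d0 Hd] := cG (Num.min 1 (e / (2 * A))) ltac:(by rewrite lt_min ltr01 divr_gt0 ?mulr_gt0).
exists d => // w /Hd; rewrite lt_min => /andP[h1 h2].
have h3 := modulus_dist (G w) (G z); have h4 := modulus_dist (G z) (G w).
rewrite modulusBC in h4.
have [g1 g2] : 0 <= N (G w) /\ 0 <= N (G z) by split; exact: modulus_ge0.
have h5 : `|N (G w) - N (G z)| <= N (G w - G z) by rewrite ler_norml; lra.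
rewrite subr_sqr normrM (ger0_norm (addr_ge0 g1 g2)).
apply: (@le_lt_trans _ _ (N (G w - G z) * (2 * A))); last by rewrite -ltr_pdivlMr ?mulr_gt0.
apply: ler_pM => //; first exact: addr_ge0.
rewrite /A; move: h1 h3; lra.
Qed.

Lemma measurable_sqr D (G : R[i] -> R[i]) : open D -> (forall z, D z -> exists l, cdiff G z l) ->
  measurable_fun (preg D) (fun w => N (G (cplx w)) ^+ 2).
Proof.
move=> oD dG; apply: (measurable_rcont oD (phi := fun z => N (G z) ^+ 2)) => z /dG[l].
exact: cdiff_rcont_sqr.
Qed.

Lemma rcont_circle (phi : R[i] -> R) (c : R[i]) (a b : R) :
  (forall z, N z = 1 -> rcont phi (c * z)) ->
  contseg (fun t => phi (c * cis t)) a b.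
Proof.
move=> cphi t _; apply/continuous_atP => e e0.
have [d d0 H] := cphi _ (modulus_cis t) e e0.
have c1 : 0 < N c + 1 by rewrite ltr_wpDl ?modulus_ge0.
have [d' d'0 H'] := cis_cont t (e := d / (N c + 1)) ltac:(by rewrite divr_gt0).
exists d' => // s /H'; rewrite ltr_pdivlMr // => h; apply: H.
rewrite -mulrBr modulusM mulrC; apply: le_lt_trans h; rewrite ler_wpM2l ?modulus_ge0 //.
by rewrite lerDl.
Qed.

Section DiscLower.
Variables (G : R[i] -> R[i]) (r : R) (m : nat) (b : R[i]).
Hypothesis dG : forall z, N z < r -> exists l, cdiff G z l.
Hypothesis Gb : forall e : R, 0 < e -> exists2 d : R, 0 < d &
     forall z, N z < d -> N (G z - b * z ^+ m) <= e * N z ^+ m.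

(** In place of orthogonality of monomials: |g|^2 >= 2 Re (conj c g) - |c|^2, with c the value of b
    z^m, is summed over opposite points and integrated; the cross term is the coefficient integral
    of [coef_circle]. *)
Lemma circle_lower (s : R) : 0 < s < r ->
  ((2 * (N b ^+ 2 * pi) * s ^+ (2 * m))%:E <=
  \int[mu]_(t in [set` I]) (N (G (s%:C * cis t)%R) ^+ 2)%:E +
  \int[mu]_(t in [set` I]) (N (G (- (s%:C * cis t))%R) ^+ 2)%:E)%E.
Proof.
move=> /andP[s0 sr]; have sC0 : s%:C != 0 :> R[i] by rewrite eq_complex /= gt_eqF.
have Ns z : N z = 1 -> N (s%:C * z) = s by move=> z1; rewrite modulusM z1 mulr1 modulus_real gtr0_norm.
have dG1 z : N z = 1 -> exists l, cdiff G (s%:C * z) l by move=> /Ns z1; apply: dG; rewrite z1.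
have dG2 z : N z = 1 -> exists l, cdiff G (- (s%:C * z)) l.
  by move=> /Ns z1; apply: dG; rewrite modulusN z1.
have c1 : contseg (fun t => N (G (s%:C * cis t)) ^+ 2) (- (pi / 2)) (pi / 2).
  apply: (@rcont_circle (fun z => N (G z) ^+ 2)) => z /dG1[l]; exact: cdiff_rcont_sqr.
have c2 : contseg (fun t => N (G (- (s%:C * cis t))) ^+ 2) (- (pi / 2)) (pi / 2).
  under eq_fun do rewrite -mulNr.
  apply: (@rcont_circle (fun z => N (G z) ^+ 2)) => z /dG2[l]; rewrite -mulNr; exact: cdiff_rcont_sqr.
rewrite (integral_oo c1) (integral_oo c2) -EFinD lee_fin -intgD //.
pose Phi z := (G (0 + s%:C * z) + (-1) ^+ m * G (0 - s%:C * z)) / (s%:C * z) ^+ m.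
have cPhi z : N z = 1 -> ccont Phi z.
  move=> z1; have [l1 h1] := dG1 z z1; have [l2 h2] := dG2 z z1.
  apply: ccontM.
    apply: ccontD; first by apply: ccont_circle; rewrite add0r; exact: cdiff_ccont h1.
    by apply: ccontM; [exact: ccont_cst|apply: ccont_circleN; rewrite sub0r; exact: cdiff_ccont h2].
  apply: ccontV; first by rewrite expf_neq0 // -modulus_eq0 Ns // gt_eqF.
  apply: (@ccont_comp _ (fun z => s%:C * z) (fun w => w ^+ m)).
    by have := @ccont_lin _ 0 s%:C z; under eq_fun do rewrite add0r.
  exact: cdiff_ccont (cdiffX _ _).
have cint_Phi : cint Phi = 2 * b * pi%:C.
  apply: (@coef_circle _ G 0 r _ m b) => //; last by rewrite s0.
  - by move=> z; rewrite subr0; exact: dG.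
  - by move=> e /Gb[d d0 H]; exists d => // z; rewrite add0r; exact: H.
(* On the circle of radius s, conj (z^m) = s^(2 m) / z^m; this factor turns the cross term into a
   multiple of [Phi]. *)
pose K := (s ^+ (2 * m))%:C * conjc b.
have cK z : N z = 1 -> ccont (fun z => K * Phi z) z.
  by move=> z1; apply: ccontM; [exact: ccont_cst|exact: cPhi].
have intK := cintZ K cPhi; rewrite cint_Phi in intK.
have [f1 _] := contseg_cis (- (pi / 2)) (pi / 2) cK.
have key z : N z = 1 -> 2 * complex.Re (K * Phi z) - 2 * (N b ^+ 2 * s ^+ (2 * m)) <=
    N (G (s%:C * z)) ^+ 2 + N (G (- (s%:C * z))) ^+ 2.
  move=> z1.
  have low (g c : R[i]) : 2 * complex.Re (conjc c * g) - N c ^+ 2 <= N g ^+ 2.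
    rewrite !modulus_sqr; case: g c => [x y] [u v] /=.
    have := sqr_ge0 (x - u); have := sqr_ge0 (y - v); nra.
  pose u := (s%:C * z) ^+ m; have Nu : N u = s ^+ m by rewrite modulusX Ns.
  have u0 : u != 0 by rewrite -modulus_eq0 Nu expf_neq0 // gt_eqF.
  have uu : conjc u * u = (s ^+ (2 * m))%:C.
    rewrite mulnC exprM -Nu modulus_sqr; case: (u) => x y.
    by apply/eqP; rewrite eq_complex /=; apply/andP; split; apply/eqP; ring.
  have h1 := low (G (s%:C * z)) (b * u).
  have h2 := low (G (- (s%:C * z))) (b * ((-1) ^+ m * u)).
  have sgn : N ((-1) ^+ m : R[i]) = 1 by rewrite modulusX modulusN modulus1 expr1n.
  rewrite !modulusM sgn mul1r in h1 h2.
  have E : K * Phi z = conjc (b * u) * G (s%:C * z) + conjc (b * ((-1) ^+ m * u)) * G (- (s%:C * z)).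
    rewrite /K -uu /Phi add0r sub0r -/u !rmorphM /= (_ : conjc ((-1) ^+ m) = (-1) ^+ m); last by rewrite -signr_odd; case: odd; apply/eqP; rewrite eq_complex /= ?oppr0 !eqxx.
    by field.
  rewrite E raddfD /= mulrDr.
  have NN : N b ^+ 2 * s ^+ (2 * m) = (N b * N u) ^+ 2 by rewrite Nu exprMn -exprM mulnC.
  rewrite NN; move: h1 h2; lra.
have h := le_intg _ (contsegD c1 c2) (fun x _ => key (cis x) (modulus_cis x)).
apply: le_trans (h _); last first.
  apply: contsegB; last exact: contseg_cst.
  by apply: contsegM => //; exact: contseg_cst.
rewrite intgB; last 2 first.
- by apply: contsegM => //; exact: contseg_cst.
- exact: contseg_cst.
rewrite (intgZ 2 f1) (intg_cst (2 * (N b ^+ 2 * s ^+ (2 * m))) (ltW (@pihalf_lt R))).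
have -> : intg (fun x => complex.Re (K * Phi (cis x))) (- (pi / 2)) (pi / 2) = complex.Re (K * (2 * b * pi%:C)).
  by rewrite -intK.
have -> : K * (2 * b * pi%:C) = (2 * s ^+ (2 * m) * N b ^+ 2 * pi)%:C.
  rewrite /K modulus_sqr; case: (b) => x y.
  by apply/eqP; rewrite eq_complex /=; apply/andP; split; apply/eqP; ring.
rewrite /=; lra.
Qed.

Lemma disc_lower : 0 < r -> ((N b ^+ 2 * pi * r ^+ (2 * m + 2) / m.+1%:R)%:E <=
  \int[mu2]_(w in preg (disc r)) (N (G (cplx w)) ^+ 2)%:E)%E.
Proof.
move=> r0.
have mG : measurable_fun (preg (disc r)) (fun w => N (G (cplx w)) ^+ 2).
  apply: measurable_sqr => //; apply/open_modulus => z zr; exists (r - N z); first by rewrite subr_gt0.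
  by move=> w wz; rewrite /disc /=; have := modulus_dist w z; move: wz; lra.
rewrite (disc_polar (F := fun z => N (G z) ^+ 2)) //; last by move=> z; exact: sqr_ge0.
rewrite -integral_power //.
apply: le_integral_ge0 => s /=; rewrite in_itv /= => /andP[s0 sr].
have sE : (0 <= s%:E)%E by rewrite lee_fin ltW.
have h0 : 0 <= N b ^+ 2 * pi by rewrite mulr_ge0 ?sqr_ge0 ?pi_ge0.
rewrite mule_ge0 //=; last by rewrite lee_fin; apply: mulr_ge0; [exact: mulr_ge0|exact: exprn_ge0 (ltW s0)].
by apply: lee_wpmul2l => //; apply: circle_lower; rewrite s0.
Qed.

End DiscLower.

Lemma disc_monomial (r : R) (m : nat) : 0 < r ->
  (\int[mu2]_(w in preg (disc r)) (N (cplx w) ^+ (2 * m))%:E =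
   (pi * r ^+ (2 * m + 2) / m.+1%:R)%:E)%E.
Proof.
move=> r0.
have E z : N z ^+ (2 * m) = N (z ^+ m) ^+ 2 by rewrite modulusX -exprM mulnC.
rewrite (disc_polar (F := fun z => N z ^+ (2 * m))); last 2 first.
- by move=> z; rewrite exprn_ge0 ?modulus_ge0.
- under eq_fun do rewrite E; apply: (@measurable_sqr _ (fun z => z ^+ m)).
    apply/open_modulus => z zr; exists (r - N z); first by rewrite subr_gt0.
    by move=> w wz; rewrite /disc /=; have := modulus_dist w z; move: wz; lra.
  by move=> z _; eexists; exact: cdiffX.
rewrite -integral_power //; apply: eq_integral => s hs.
have /andP[s0 sr] : 0 < s < r by move: hs; rewrite inE /= in_itv.
have Ns t : N (s%:C * cis t) = s by rewrite modulusM modulus_cis mulr1 modulus_real gtr0_norm.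
congr (_ * _)%E.
under eq_integral do rewrite Ns.
under [X in (_ + X)%E]eq_integral do rewrite modulusN Ns.
rewrite integral_oo; last exact: contseg_cst.
rewrite intg_cst ?(ltW (@pihalf_lt R)) // -EFinD.
by congr EFin; field.
Qed.

End Area.

(** * Order of vanishing and Moebius images of discs *)
Section Order.
Context {R : realType}.
Local Notation N := (@modulus R).
Implicit Types (f g q k : R[i] -> R[i]) (z a b : R[i]).

(** Order of vanishing and leading coefficient without derivatives. In this form they pass through a
    substitution, and [derive_order] converts them back. *)
Definition order_at f a m b := forall e : R, 0 < e -> exists2 d : R, 0 < d &
  forall z, N (z - a) < d -> N (f z - b * (z - a) ^+ m) <= e * N (z - a) ^+ m.

Lemma order_unique f a m b b' : order_at f a m b -> order_at f a m b' -> b = b'.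
Proof.
move=> h h'; apply/eqP; rewrite -subr_eq0 -modulus_eq0 -normr_le0 ger0_norm ?modulus_ge0 //.
apply/ler_addgt0Pl => e e0; rewrite addr0; have e20 : 0 < e / 2 by rewrite divr_gt0.
have [d d0 H] := h _ e20; have [d' d'0 H'] := h' _ e20.
pose r := Num.min d d' / 2; have r0 : 0 < r by rewrite divr_gt0 // lt_min d0.
have Nr : N (a + r%:C - a) = r by rewrite addrC addKr modulus_real gtr0_norm.
have rd : r < d /\ r < d'.
  have : Num.min d d' <= d /\ Num.min d d' <= d' by rewrite !ge_min !lexx orbT.
  by rewrite /r in r0 *; move: r0; lra.
have h1 := H (a + r%:C); have h2 := H' (a + r%:C).
rewrite Nr in h1 h2; have {}h1 := h1 rd.1; have {}h2 := h2 rd.2.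
have rm : 0 < r ^+ m by rewrite exprn_gt0.
rewrite -(ler_pM2r rm) -{1}Nr -modulusX -modulusM.
set u := f (a + r%:C) in h1 h2 *; set v := (a + r%:C - a) ^+ m in h1 h2 *.
have -> : (b - b') * v = (u - b' * v) - (u - b * v) by ring.
by apply: le_trans (modulusB _ _) _; apply: le_trans (lerD h2 h1) _; lra.
Qed.

Lemma order_lower f a m b j : order_at f a m b -> (j < m)%N -> order_at f a j 0.
Proof.
move=> h jm e e0; have [d d0 H] := h 1 ltr01.
have b1 : 0 < N b + 1 by rewrite ltr_wpDl ?modulus_ge0.
exists (Num.min d (Num.min 1 (e / (N b + 1)))); first by rewrite !lt_min d0 ltr01 divr_gt0.
move=> z; rewrite !lt_min ltr_pdivlMr // => /and3P[/H h1 h2 h3].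
rewrite mul0r subr0.
have h4 : N (f z) <= (N b + 1) * N (z - a) ^+ m.
  rewrite -[f z](subrK (b * (z - a) ^+ m)); apply: le_trans (modulusD _ _) _.
  by rewrite mulrDl addrC -modulusX -modulusM modulusX; apply: lerD.
apply: le_trans h4 _; set x := N (z - a) in h2 h3 *; have x0 : 0 <= x by exact: modulus_ge0.
have -> : m = (j + (m - j).-1.+1)%N by rewrite prednK ?subn_gt0 // subnKC // ltnW.
rewrite exprD mulrCA mulrC ler_wpM2r ?exprn_ge0 //.
rewrite exprS mulrA (mulrC _ x); apply: le_trans (ltW h3).
by rewrite ler_piMr ?mulr_ge0 ?(ltW b1) // exprn_ile1 // ltW.
Qed.

(** Leading coefficients are unique: compared with Taylor's formula, the one at each order below m
    must be 0 and the one at order m must be b. *)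
Lemma derive_order D f a m b : open D -> D a -> holomorphic D f -> order_at f a m b ->
  (forall j, (j < m)%N -> derive1n j f a = 0) /\ derive1n m f a = m`!%:R * b.
Proof.
move=> oD Da hf fb.
have van j : (j < m)%N -> derive1n j f a = 0.
  elim/ltn_ind: j => j IH jm.
  have hj i : (i < j)%N -> derive1n i f a = 0 by move=> ij; apply: IH => //; exact: ltn_trans jm.
  have /order_unique/(_ (order_lower fb jm))/eqP := taylor_vanish oD Da hf hj.
  rewrite mulf_eq0 invr_eq0 => /orP[/eqP //|].
  by rewrite -modulus_eq0 modulus_nat pnatr_eq0 eqn0Ngt fact_gt0.
split => //; have /order_unique/(_ fb) <- := taylor_vanish oD Da hf van.
by rewrite mulrC divfK // -modulus_eq0 modulus_nat pnatr_eq0 -lt0n fact_gt0.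
Qed.

(** [q] is the quotient of the substitution: near z0, (E w - a)^m equals (w - z0)^m q(w)^m, so the
    leading coefficient is multiplied by q(z0)^m k(z0). *)
Lemma order_comp f a m b (E : R[i] -> R[i]) q k z0 (d0 : R) : 0 < d0 -> order_at f a m b ->
  (forall w, N (w - z0) < d0 -> E w - a = (w - z0) * q w) -> ccont q z0 -> ccont k z0 ->
  order_at (fun w => f (E w) * k w) z0 m (b * q z0 ^+ m * k z0).
Proof.
move=> d00 fb Eq cq ck e e0.
have cqm : ccont (fun w => q w ^+ m) z0.
  by apply: (ccont_comp (g := fun w => w ^+ m) cq); exact: cdiff_ccont (cdiffX _ _).
have cqk := ccontM cqm ck.
have cbqk := ccontM (ccont_cst b z0) cqk.
set A := N (q z0 ^+ m * k z0) + 1; have A0 : 0 < A by rewrite ltr_wpDl ?modulus_ge0.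
have e20 : 0 < e / 2 by rewrite divr_gt0.
have [d1 d10 H1] := cqk 1 ltr01; have [d2 d20 H2] := cbqk _ e20.
have [d3 d30 H3] := fb (e / (2 * A)) ltac:(by rewrite divr_gt0 // mulr_gt0).
have [d4 d40 H4] := cq 1 ltr01.
set B := N (q z0) + 1; have B0 : 0 < B by rewrite ltr_wpDl ?modulus_ge0.
exists (Num.min d0 (Num.min d1 (Num.min d2 (Num.min d4 (d3 / B))))); first by rewrite !lt_min d00 d10 d20 d40 divr_gt0.
move=> w; rewrite !lt_min ltr_pdivlMr // => /and5P[/Eq Ew /H1 h1 /H2 h2 /H4 h4 h3].
set x := w - z0 in Ew h3 *.
have qB : N (q w) <= B by have := modulus_dist (q w) (q z0); move: h4; rewrite /B; lra.
have h5 : N (E w - a) < d3.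
  by rewrite Ew modulusM; apply: le_lt_trans h3; rewrite ler_wpM2l ?modulus_ge0.
have h6 := H3 _ h5.
set r := f (E w) - _ in h6.
have -> : f (E w) * k w - b * q z0 ^+ m * k z0 * x ^+ m =
    (b * (q w ^+ m * k w) - b * (q z0 ^+ m * k z0)) * x ^+ m + r * k w.
  by rewrite /r Ew exprMn; ring.
rewrite (splitr e) [leRHS]mulrDl; apply: le_trans (modulusD _ _) _; apply: lerD.
  by rewrite modulusM modulusX ler_wpM2r ?exprn_ge0 ?modulus_ge0 // ltW.
rewrite modulusM; apply: le_trans (ler_wpM2r (modulus_ge0 _) h6) _.
rewrite Ew modulusM exprMn -!modulusX.
have -> : e / (2 * A) * (N (x ^+ m) * N (q w ^+ m)) * N (k w) = e / 2 / A * N (x ^+ m) * N (q w ^+ m * k w).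
  by rewrite modulusM; field; rewrite gt_eqF.
have h7 : N (q w ^+ m * k w) <= A.
  by have := modulus_dist (q w ^+ m * k w) (q z0 ^+ m * k z0); move: h1; rewrite /A; lra.
have -> : e / 2 * N (x ^+ m) = e / 2 / A * N (x ^+ m) * A by field; rewrite gt_eqF.
by apply: ler_wpM2l h7; rewrite !mulr_ge0 ?modulus_ge0 ?invr_ge0 ?(ltW A0) ?(ltW e0).
Qed.

End Order.

Section Mobius.
Context {R : realType}.
Local Notation RR := (measurableTypeR R).
Local Notation mu2 := (@lebesgue_measure R \x @lebesgue_measure R)%E.
Local Notation N := (@modulus R).
Implicit Types (g : R[i] -> R[i]).

Definition cball (a : R[i]) (r : R) : set R[i] := [set z | N (z - a) < r].

Lemma open_cball (a : R[i]) (r : R) : open (cball a r).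
Proof.
apply/open_modulus => z /= zr; exists (r - N (z - a)); first by rewrite subr_gt0.
move=> w wz; rewrite /cball /=; have -> : w - a = (w - z) + (z - a) by ring.
by apply: le_lt_trans (modulusD _ _) _; rewrite -ltrBrDr.
Qed.

(** The case m = 0 of [disc_lower], that is the sub-mean value property of |g|^2, translated to the
    centre a. *)
Lemma ball_lower g (a : R[i]) (r : R) : 0 < r ->
  (forall z, N (z - a) < r -> exists l, cdiff g z l) ->
  ((N (g a) ^+ 2 * pi * r ^+ 2)%:E <=
   \int[mu2]_(w in preg (cball a r)) (N (g (cplx w)) ^+ 2)%:E)%E.
Proof.
move=> r0 dg; set S := preg _.
have mS : measurable S by apply: measurable_open; exact: open_cball.
have mg : measurable_fun S (fun w => N (g (cplx w)) ^+ 2) by apply: measurable_sqr => //; exact: open_cball.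
rewrite integral_mkcond (@integral_shift _ (complex.Re a) (complex.Im a)); last 2 first.
- by apply/(measurable_restrictT _ mS); exact/measurable_EFinP.
- by move=> z; rewrite patchE; case: ifP => // _; rewrite lee_fin sqr_ge0.
have dG z : N z < r -> exists l, cdiff (fun z => g (a + z)) z l.
  move=> zr; have [l hl] := dg (a + z) ltac:(by rewrite addrC addKr).
  exists (l * 1); apply: (@cdiff_comp _ (fun z => a + z) g) => //.
  have := @complex_lin_ext _ a 1 z; under eq_fun do rewrite mul1r; exact.
have Gb e : 0 < e -> exists2 d : R, 0 < d & forall z, N z < d ->
    N (g (a + z) - g a * z ^+ 0) <= e * N z ^+ 0.
  move=> e0; have [l hl] := dg a ltac:(by rewrite subrr modulus0).
  have [d d0 H] := cdiff_cont hl e0; exists d => // z zd.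
  by rewrite !expr0 !mulr1; apply/ltW/H; rewrite addrC addKr.
have := disc_lower dG Gb r0; rewrite muln0 add0n divr1; move/le_trans; apply.
rewrite integral_mkcond le_eqVlt; apply/orP; left; apply/eqP; apply: eq_integral => w _.
rewrite !patchE; have E : cplx (w.1 + complex.Re a, w.2 + complex.Im a) = a + cplx w.
  by apply/eqP; rewrite eq_complex /=; case: (a) => x y /=; rewrite !(addrC w.1) !(addrC w.2) !eqxx.
have -> : ((w.1 + complex.Re a, w.2 + complex.Im a) \in S) = (w \in preg (disc r)).
  by apply/idP/idP; rewrite !inE /S /preg /cball /disc /mkset E (addrC a (cplx w)) addrK.
by rewrite E.
Qed.

Variables (c e : R[i]) (r : R).
Hypotheses (r0 : 0 < r) (re : r <= N e).

Let W z := (z - c)^-1 + e.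
Let E w := c + (w - e)^-1.
Let Om := [set z | N (W z) < r].

Let WE w : W (E w) = w.
Proof. by rewrite /W /E addrAC subrr add0r invrK subrK. Qed.

Let e0 : e != 0.
Proof. by rewrite -modulus_gt0 (lt_le_trans r0). Qed.

(** The convention on inverses gives W c = e, and r <= |e| then leaves the pole out of [Om]. *)
Let Om_c z : Om z -> z != c.
Proof. by apply: contraTneq => ->; rewrite /Om /= /W subrr invr0 add0r -leNgt. Qed.

Lemma mobius_open : open Om.
Proof.
apply/open_modulus => z Oz; have zc := Om_c Oz.
have cW : ccont W z.
  apply: ccontD; last exact: ccont_cst.
  apply: (ccontV (f := fun z => z - c)); first by rewrite subr_eq0.
  by apply: ccontB; [exact: ccont_id|exact: ccont_cst].
have [d d0 H] := cW (r - N (W z)) ltac:(by rewrite subr_gt0).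
exists d => // w /H h; rewrite /Om /=; have := modulus_dist (W w) (W z); move: h; lra.
Qed.

(** G w = g(E w) (w - e)^-2 is, up to sign, g(E w) E'(w), so |G|^2 absorbs the Jacobian and
    [disc_lower] applies on the disc of radius r. The point c - 1 / e is E 0, and the power of |e|
    collects m factors from the substitution and one from E'. *)
Lemma mobius_lower g (a : R[i]) (m : nat) : (forall z, Om z -> exists l, cdiff g z l) ->
  order_at g (c - e^-1) m a ->
  ((N a ^+ 2 * N e ^- (4 * m.+1) * pi * r ^+ (2 * m + 2) / m.+1%:R)%:E <=
   \int[mu2]_(w in preg Om) (N (g (cplx w)) ^+ 2)%:E)%E.
Proof.
move=> dg ga.
have mOm : measurable (preg Om) by apply: measurable_open; exact: mobius_open.
have mg : measurable_fun (preg Om) (fun w => N (g (cplx w)) ^+ 2) by apply: measurable_sqr => //; exact: mobius_open.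
pose H z := if N (W z) < r then (N (g z) ^+ 2)%:E else 0%E.
have HE : (\int[mu2]_(w in preg Om) (N (g (cplx w)) ^+ 2)%:E = \int[mu2]_w H (cplx w))%E.
  rewrite integral_mkcond; apply: eq_integral => w _; rewrite patchE /H.
  have -> : (w \in preg Om) = (N (W (cplx w)) < r) by apply/idP/idP; rewrite inE.
  by [].
rewrite HE (@integral_mobius _ c e); last 2 first.
- have := (measurable_restrictT _ mOm).1 ((measurable_EFinP _ _).2 mg).
  apply: eq_measurable_fun => w _; rewrite patchE /H.
  have -> : (w \in preg Om) = (N (W (cplx w)) < r) by apply/idP/idP; rewrite inE.
  by [].
- by move=> z; rewrite /H; case: ifP => // _; rewrite lee_fin sqr_ge0.
pose G w := g (E w) * (w - e) ^- 2.
have we w : N w < r -> w - e != 0.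
  by move=> wr; rewrite subr_eq0; apply: contraTneq wr => ->; rewrite -leNgt.
have dlin w : cdiff (fun w => w - e) w 1.
  by have := @complex_lin_ext _ (- e) 1 w; under eq_fun do rewrite mul1r addrC; exact.
have dinv w : N w < r -> cdiff (fun w => (w - e)^-1) w (- (w - e) ^- 2 * 1).
  by move=> /we w0; apply: (cdiff_comp (f := fun w => w - e) (g := fun u => u^-1) (dlin w)); exact: cdiffV.
have dG w : N w < r -> exists l, cdiff G w l.
  move=> wr; have [l hl] := dg (E w) ltac:(by rewrite /Om /= WE).
  have dE := cdiffD (cdiff_cst c w) (dinv w wr).
  have dk := cdiff_comp (dinv w wr) (cdiffX 2 _).
  have := cdiffM (cdiff_comp dE hl) dk => h; eexists; move: h.
  by apply: (@cdiff_ext _ _ _ _ _ 1) => // u _; rewrite /G /= exprVn.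
have Gb : order_at G 0 m (a * (- e ^- 2) ^+ m * e ^- 2).
  have -> : - e ^- 2 = (e * (0 - e))^-1 by rewrite sub0r mulrN invrN -expr2.
  have -> : (e ^- 2) = (0 - e) ^- 2 by rewrite sub0r sqrrN.
  apply: (@order_comp _ g (c - e^-1) m a E (fun w => (e * (w - e))^-1) (fun w => (w - e) ^- 2) 0 r) => //.
  - move=> w; rewrite subr0 => /we w0; rewrite /E invfM; field; by rewrite w0 e0.
  - apply: (ccontV (f := fun w => e * (w - e))); first by rewrite mulf_neq0 // we // modulus0.
    by apply: ccontM; [exact: ccont_cst|exact: cdiff_ccont (dlin _)].
  - apply: (ccontV (f := fun w => (w - e) ^+ 2)); first by rewrite expf_neq0 // we // modulus0.
    by apply: (ccont_comp (g := fun w => w ^+ 2) (cdiff_ccont (dlin _))); exact: cdiff_ccont (cdiffX _ _).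
have Gb' x : 0 < x -> exists2 d : R, 0 < d & forall z, N z < d ->
    N (G z - (a * (- e ^- 2) ^+ m * e ^- 2) * z ^+ m) <= x * N z ^+ m.
  by move=> /Gb[d d0 hd]; exists d => // z zd; have := hd z; rewrite subr0; exact.
have := disc_lower dG Gb' r0.
have -> : N (a * (- e ^- 2) ^+ m * e ^- 2) ^+ 2 = N a ^+ 2 * N e ^- (4 * m.+1).
  rewrite !modulusM modulusX modulusN !modulusV !modulusX !exprMn -!exprM -exprVn -!exprM -!exprVn -mulrA -exprD.
  by congr (_ * _ ^+ _); lia.
move/le_trans; apply; rewrite integral_mkcond le_eqVlt; apply/orP; left; apply/eqP; apply: eq_integral => w _.
rewrite patchE /H -/(E _) WE.
have -> : (w \in preg (disc r)) = (N (cplx w) < r) by apply/idP/idP; rewrite inE.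
case: ifP => _; last by rewrite mul0e.
by rewrite -EFinM /G modulusM modulusV modulusX exprMn exprVn -exprM.
Qed.

Let Ex r' := [set z | z != c /\ N (W z) < r'].

(** Pulled back by E the integrand becomes |w|^(2 m) on the disc of radius r'. As r' may exceed |e|,
    the pole is excluded explicitly in [Ex]. *)
Lemma mobius_upper (r' : R) (m : nat) : 0 < r' ->
  (\int[mu2]_(w in preg (Ex r'))
     (N (W (cplx w) ^+ m * (cplx w - c) ^- 2) ^+ 2)%:E <=
   (pi * r' ^+ (2 * m + 2) / m.+1%:R)%:E)%E.
Proof.
move=> r'0; set S := Ex r'.
have oS : open S.
  apply/open_modulus => z [zc Oz].
  have cW : ccont W z.
    apply: ccontD; last exact: ccont_cst.
    apply: (ccontV (f := fun z => z - c)); first by rewrite subr_eq0.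
    by apply: ccontB; [exact: ccont_id|exact: ccont_cst].
  have [d d0 H] := cW (r' - N (W z)) ltac:(by rewrite subr_gt0).
  have zc0 : 0 < N (z - c) by rewrite modulus_gt0 subr_eq0.
  exists (Num.min d (N (z - c))); first by rewrite lt_min d0.
  move=> w; rewrite lt_min => /andP[/H h hc]; split.
    by apply: contraTneq hc => ->; rewrite modulusBC ltxx.
  rewrite /=; have := modulus_dist (W w) (W z); move: h; lra.
have mS : measurable (preg S) by exact: measurable_open.
have mg : measurable_fun (preg S) (fun w => N (W (cplx w) ^+ m * (cplx w - c) ^- 2) ^+ 2).
  apply: (@measurable_sqr _ S (fun z => W z ^+ m * (z - c) ^- 2)) => // z [zc _].
  have zc0 : z - c != 0 by rewrite subr_eq0.
  have dlin w : cdiff (fun w => w - c) w 1.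
    by have := @complex_lin_ext _ (- c) 1 w; under eq_fun do rewrite mul1r addrC; exact.
  have dinv : cdiff (fun w => (w - c)^-1) z (- (z - c) ^- 2 * 1).
    by apply: (cdiff_comp (f := fun w => w - c) (g := fun u => u^-1) (dlin z)); exact: cdiffV.
  have dW := cdiff_comp (cdiffD dinv (cdiff_cst e z)) (cdiffX m _).
  have := cdiffM dW (cdiff_comp dinv (cdiffX 2 _)) => h; eexists; move: h.
  by apply: (@cdiff_ext _ _ _ _ _ 1) => // u _; rewrite /= exprVn.
pose H z : \bar R := if (z != c) && (N (W z) < r') then (N (W z ^+ m * (z - c) ^- 2) ^+ 2)%:E else 0%E.
have SE w : (w \in preg S) = (cplx w != c) && (N (W (cplx w)) < r').
  by apply/idP/idP; rewrite inE /preg /S /=; [move=> [-> ->]|move=> /andP[]].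
have HE : (\int[mu2]_(w in preg S) (N (W (cplx w) ^+ m * (cplx w - c) ^- 2) ^+ 2)%:E = \int[mu2]_w H (cplx w))%E.
  by rewrite integral_mkcond; apply: eq_integral => w _; rewrite patchE /H SE.
rewrite HE (@integral_mobius _ c e); last 2 first.
- have := (measurable_restrictT _ mS).1 ((measurable_EFinP _ _).2 mg).
  by apply: eq_measurable_fun => w _; rewrite patchE /H SE.
- by move=> z; rewrite /H; case: ifP => // _; rewrite lee_fin sqr_ge0.
rewrite -disc_monomial // [leRHS]integral_mkcond; apply: le_integral_ge0 => w _.
rewrite patchE -/(E _) /H WE.
have -> : (w \in preg (disc r')) = (N (cplx w) < r') by apply/idP/idP; rewrite inE.
have Nm x : (0 <= (N x ^- 4)%:E :> \bar R)%E by rewrite lee_fin invr_ge0 exprn_ge0 ?modulus_ge0.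
case: ifPn => [/andP[wc ->]|_].
  rewrite -EFinM !lee_fin mulr_ge0 ?sqr_ge0 ?invr_ge0 ?exprn_ge0 ?modulus_ge0 //=.
  have we : N (cplx w - e) != 0.
    rewrite modulus_eq0; apply: contraNneq wc => h; by rewrite /E h invr0 addr0.
  rewrite /E addrAC subrr add0r modulusM modulusX modulusV modulusX modulusV exprVn invrK.
  rewrite exprMn -!exprM -mulrA (_ : (2 * 2 = 4)%N) // divff ?expf_neq0 // mulr1 mulnC //.
rewrite mul0e lexx /=; case: ifP => // _; by rewrite lee_fin exprn_ge0 ?modulus_ge0.
Qed.

End Mobius.

(** * Weighted square-integrable functions *)
Section WeightedL2.
Context d (T : measurableType d) {R : realType} (m : {measure set T -> \bar R}).
Local Notation N := (@modulus R).
Variables (A : set T) (mu : T -> R).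
Hypotheses (mA : measurable A) (mmu : measurable_fun A mu) (mu0 : forall x, A x -> 0 <= mu x).
Implicit Types (f g u v : T -> R[i]).

Definition cmeas f := measurable_fun A (fun x => complex.Re (f x)) /\
  measurable_fun A (fun x => complex.Im (f x)).

Definition dens f x : R := N (f x) ^+ 2 * mu x.

Definition esq f := (\int[m]_(x in A) (dens f x)%:E)%E.

Definition sqint f := cmeas f /\ (esq f < +oo)%E.

Definition en f : R := (\int[m]_(x in A) dens f x)%R.

Definition ipRe f g : R := (\int[m]_(x in A) (complex.Re (f x * conjc (g x)) * mu x))%R.

Definition ipIm f g : R := (\int[m]_(x in A) (complex.Im (f x * conjc (g x)) * mu x))%R.

Lemma dens_ge0 f x : A x -> 0 <= dens f x.
Proof. by move=> Ax; rewrite mulr_ge0 ?sqr_ge0 ?mu0. Qed.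

Lemma en_ge0 f : 0 <= en f.
Proof. by apply: Rintegral_ge0 => x; exact: dens_ge0. Qed.

Lemma cmeas_dens f : cmeas f -> measurable_fun A (dens f).
Proof.
move=> [m1 m2]; apply: measurable_funM => //.
by under eq_fun do rewrite modulus_sqr; apply: measurable_funD; apply: measurable_funX.
Qed.

Lemma sqintP f : cmeas f -> (sqint f <-> m.-integrable A (EFin \o dens f)).
Proof.
move=> mf; have E : (\int[m]_(x in A) `|(EFin \o dens f) x| = esq f)%E.
  by apply: eq_integral => x; rewrite inE => Ax; rewrite /= ger0_norm ?dens_ge0.
split=> [[_ fin]|/integrableP[_]]; last by rewrite E.
by apply/integrableP; split; [apply/measurable_EFinP; exact: cmeas_dens|rewrite E].
Qed.

Lemma sqint_integrable f : sqint f -> m.-integrable A (EFin \o dens f).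
Proof. by move=> Lf; exact: ((sqintP Lf.1).1 Lf). Qed.

Lemma esqE f : sqint f -> esq f = (en f)%:E.
Proof.
by move=> /sqint_integrable h; rewrite /en /Rintegral fineK //; exact: integrable_fin_num.
Qed.

Lemma ip_integrable u v : sqint u -> sqint v ->
  m.-integrable A (EFin \o (fun x => complex.Re (u x * conjc (v x)) * mu x)) /\
  m.-integrable A (EFin \o (fun x => complex.Im (u x * conjc (v x)) * mu x)).
Proof.
move=> Lu Lv; have [[u1 u2] _] := Lu; have [[v1 v2] _] := Lv.
have iD : m.-integrable A ((EFin \o dens u) \+ (EFin \o dens v))%E.
  by apply: integrableD => //; exact: sqint_integrable.
have key x : A x -> `|complex.Re (u x * conjc (v x)) * mu x| <= dens u x + dens v x /\
    `|complex.Im (u x * conjc (v x)) * mu x| <= dens u x + dens v x.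
  move=> Ax; have h : N (u x * conjc (v x)) <= N (u x) ^+ 2 + N (v x) ^+ 2.
    rewrite modulusM modulus_conj.
    have := sqr_ge0 (N (u x) - N (v x)).
    have := sqr_ge0 (N (u x)); have := sqr_ge0 (N (v x)); nra.
  rewrite !normrM (ger0_norm (mu0 Ax)) /dens -mulrDl; split; rewrite ler_wpM2r ?mu0 //;
    by apply: le_trans h; rewrite ?modulus_Re ?modulus_Im.
have mRe : measurable_fun A (fun x => complex.Re (u x * conjc (v x)) * mu x).
  apply: measurable_funM => //.
  have -> : (fun x => complex.Re (u x * conjc (v x))) =
     (fun x => complex.Re (u x) * complex.Re (v x) + complex.Im (u x) * complex.Im (v x)).
    by apply/funext => x; case: (u x) (v x) => [a b] [a' b'] /=; ring.
  by apply: measurable_funD; apply: measurable_funM.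
have mIm : measurable_fun A (fun x => complex.Im (u x * conjc (v x)) * mu x).
  apply: measurable_funM => //.
  have -> : (fun x => complex.Im (u x * conjc (v x))) =
     (fun x => complex.Im (u x) * complex.Re (v x) - complex.Re (u x) * complex.Im (v x)).
    by apply/funext => x; case: (u x) (v x) => [a b] [a' b'] /=; ring.
  by apply: measurable_funB; apply: measurable_funM.
split; apply: (le_integrable mA _ _ iD); try exact/measurable_EFinP;
  move=> x Ax; rewrite /= lee_fin (ger0_norm (addr_ge0 (dens_ge0 _ Ax) (dens_ge0 _ Ax)));
  by have [] := key x Ax.
Qed.

(** Integrability and the value of the integral come together from the expansion of |u + c v|^2 into
    integrable terms. *)
Lemma sqint_comb u v (c : R[i]) : sqint u -> sqint v ->
  sqint (fun x => u x + c * v x) /\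
  en (fun x => u x + c * v x) = en u +
    2 * (complex.Re c * ipRe u v + complex.Im c * ipIm u v) + N c ^+ 2 * en v.
Proof.
move=> Lu Lv; have [[u1 u2] _] := Lu; have [[v1 v2] _] := Lv.
have mw : cmeas (fun x => u x + c * v x).
  split.
    have -> : (fun x => complex.Re (u x + c * v x)) =
      (fun x => complex.Re (u x) + (complex.Re c * complex.Re (v x) - complex.Im c * complex.Im (v x))).
      by apply/funext => x; case: (u x) (v x) (c) => [a b] [a' b'] [a'' b''] /=; ring.
    by apply: measurable_funD => //; apply: measurable_funB; apply: measurable_funM.
  have -> : (fun x => complex.Im (u x + c * v x)) =
    (fun x => complex.Im (u x) + (complex.Im c * complex.Re (v x) + complex.Re c * complex.Im (v x))).
    by apply/funext => x; case: (u x) (v x) (c) => [a b] [a' b'] [a'' b''] /=; ring.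
  by apply: measurable_funD => //; apply: measurable_funD; apply: measurable_funM.
have [iX iY] := ip_integrable Lu Lv.
have iu := sqint_integrable Lu; have iv := sqint_integrable Lv.
pose X x := complex.Re (u x * conjc (v x)) * mu x.
pose Y x := complex.Im (u x * conjc (v x)) * mu x.
have iZ k (h : T -> R) : m.-integrable A (EFin \o h) ->
    m.-integrable A (EFin \o (fun x => k * h x)).
  by move=> ih; exact: (integrableZl mA k ih).
have iA (h k : T -> R) : m.-integrable A (EFin \o h) -> m.-integrable A (EFin \o k) ->
    m.-integrable A (EFin \o (fun x => h x + k x)).
  by move=> ih ik; exact: (integrableD mA ih ik).
have E x : dens (fun x => u x + c * v x) x =
    dens u x + (2 * (complex.Re c * X x + complex.Im c * Y x) + N c ^+ 2 * dens v x).
  rewrite /dens /X /Y !modulus_sqr; case: (u _) (v _) (c) => [a b] [a' b'] [a'' b''] /=; ring.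
have i1 := iA _ _ (iZ (complex.Re c) _ iX) (iZ (complex.Im c) _ iY).
have i2 := iA _ _ (iZ 2 _ i1) (iZ (N c ^+ 2) _ iv).
split.
  by apply: (sqintP mw).2; have := iA _ _ iu i2; congr (m.-integrable A _); apply/funext => x; rewrite /= E.
rewrite /en; under eq_Rintegral do rewrite E.
rewrite RintegralD // RintegralD //; last 2 first.
- exact: iZ i1.
- exact: iZ iv.
rewrite RintegralZl // RintegralZl // RintegralD //; last 2 first.
- exact: iZ iX.
- exact: iZ iY.
by rewrite RintegralZl // RintegralZl // addrA.
Qed.

Lemma ip_sym u v : sqint u -> sqint v -> ipRe v u = ipRe u v /\ ipIm v u = - ipIm u v.
Proof.
move=> Lu Lv; have [iX iY] := ip_integrable Lu Lv; split.
  by apply: eq_Rintegral => x _; case: (u x) (v x) => [a b] [a' b'] /=; ring.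
rewrite -mulN1r /ipIm -RintegralZl //.
by apply: eq_Rintegral => x _; case: (u x) (v x) => [a b] [a' b'] /=; ring.
Qed.

Definition ip u v : R[i] := ipRe u v +i* ipIm u v.

Lemma ip_conj u v : sqint u -> sqint v -> ip v u = conjc (ip u v).
Proof. by move=> Lu Lv; have [r1 r2] := ip_sym Lu Lv; rewrite /ip r1 r2. Qed.

Lemma ip_self v : ip v v = (en v)%:C.
Proof.
rewrite /ip; congr (_ +i* _).
  by apply: eq_Rintegral => x _; rewrite /dens modulus_sqr; case: (v x) => a b /=; ring.
rewrite /ipIm (_ : (fun x => _) = (fun=> 0)); first by rewrite /Rintegral integral0.
by apply/funext => x; case: (v x) => a b /=; ring.
Qed.

Lemma ip_combl u v w (c : R[i]) : sqint u -> sqint v -> sqint w ->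
  ip (fun x => u x + c * v x) w = ip u w + c * ip v w.
Proof.
move=> Lu Lv Lw; have [iX iY] := ip_integrable Lu Lw; have [iX' iY'] := ip_integrable Lv Lw.
have iZ k (h : T -> R) : m.-integrable A (EFin \o h) -> m.-integrable A (EFin \o (fun x => k * h x)).
  by move=> ih; exact: (integrableZl mA k ih).
have iB (h k : T -> R) : m.-integrable A (EFin \o h) -> m.-integrable A (EFin \o k) ->
    m.-integrable A (EFin \o (fun x => h x - k x)).
  by move=> ih ik; exact: (integrableB mA ih ik).
have iA (h k : T -> R) : m.-integrable A (EFin \o h) -> m.-integrable A (EFin \o k) ->
    m.-integrable A (EFin \o (fun x => h x + k x)).
  by move=> ih ik; exact: (integrableD mA ih ik).
case: c => a b; apply/eqP; rewrite eq_complex /=; apply/andP; split; apply/eqP.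
  have i1 := iZ a _ iX'; have i2 := iZ b _ iY'.
  rewrite /ipRe /ipIm -!RintegralZl // -RintegralB // -RintegralD //; last exact: iB.
  by apply: eq_Rintegral => x _; case: (u x) (v x) (w x) => [u1 u2] [v1 v2] [w1 w2] /=; ring.
have i1 := iZ a _ iY'; have i2 := iZ b _ iX'.
rewrite /ipRe /ipIm -!RintegralZl // -RintegralD // -RintegralD //; last exact: iA.
by apply: eq_Rintegral => x _; case: (u x) (v x) (w x) => [u1 u2] [v1 v2] [w1 w2] /=; ring.
Qed.

Lemma ip_scalel v w (c : R[i]) : sqint v -> sqint w -> ip (fun x => c * v x) w = c * ip v w.
Proof.
move=> Lv Lw; have := ip_combl (c - 1) Lv Lv Lw.
rewrite (_ : (fun x => _) = (fun x => c * v x)); last by apply/funext => x; ring.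
by move=> ->; ring.
Qed.

Lemma sqint_scale v (c : R[i]) : sqint v -> sqint (fun x => c * v x) /\
  en (fun x => c * v x) = N c ^+ 2 * en v.
Proof.
move=> Lv; have [] := sqint_comb (c - 1) Lv Lv.
rewrite (_ : (fun x => _) = (fun x => c * v x)); last by apply/funext => x; ring.
have := ip_self v => -[-> ->] h ->; split => //.
by rewrite !modulus_sqr; case: c {h} => a b /=; ring.
Qed.

Lemma clim_cmeas (s : nat -> T -> R[i]) h : (forall k, cmeas (s k)) ->
  (forall x, A x -> clim (s^~ x) (h x)) -> cmeas h.
Proof.
move=> ms sh; split.
  apply: (@measurable_fun_cvg _ _ _ A (fun k x => complex.Re (s k x))) => [k|x Ax]; first by case: (ms k).
  apply/cvgrPdist_le => e e0; have [K HK] := sh _ Ax e e0; exists K => // k /HK; apply: le_trans.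
  by rewrite distrC -raddfB; exact: modulus_Re.
apply: (@measurable_fun_cvg _ _ _ A (fun k x => complex.Im (s k x))) => [k|x Ax]; first by case: (ms k).
apply/cvgrPdist_le => e e0; have [K HK] := sh _ Ax e e0; exists K => // k /HK; apply: le_trans.
by rewrite distrC -raddfB; exact: modulus_Im.
Qed.

Lemma fatou_bound (s : nat -> T -> R[i]) h (a : R) (K : nat) : (forall k, cmeas (s k)) ->
  (forall x, A x -> clim (s^~ x) (h x)) -> (forall k, (K <= k)%N -> (esq (s k) <= a%:E)%E) ->
  (esq h <= a%:E)%E.
Proof.
move=> ms sh sa.
have := @fatou _ _ _ m A mA (fun k x => (dens (s k) x)%:E).
move/(_ (fun k => (measurable_EFinP _ _).2 (cmeas_dens (ms k)))).
have dge0 k x : A x -> (0 <= (dens (s k) x)%:E)%E by move=> Ax; rewrite lee_fin dens_ge0.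
move/(_ dge0) => F.
have -> : esq h = (\int[m]_(x in A) limn_einf (fun k => (dens (s k) x)%:E))%E.
  apply: eq_integral => x; rewrite inE => Ax; apply/esym.
  have cv : (dens (s k) x)%:E @[k --> \oo] --> (dens h x)%:E.
    apply: cvg_EFin; first exact: nearW.
    apply: cvgM; last exact: cvg_cst.
    apply: (@cvg_comp _ _ _ (fun k => N (s k x)) (fun y => y ^+ 2)); last exact: exprn_continuous.
    apply/cvgrPdist_le => e e0; have [K0 HK] := sh _ Ax e e0; exists K0 => // k /HK; apply: le_trans.
    have := modulus_dist (s k x) (h x).
    have := modulus_dist (h x) (s k x); rewrite modulusBC ler_norml; lra.
  by have := is_cvg_limn_einfE (cvgP _ cv) => ->; exact: cvg_lim.
apply: le_trans F _; rewrite limn_einf_lim; apply: lime_le; first exact: is_cvg_einfs.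
apply: nearW => k; apply: le_trans (sa (maxn K k) (leq_maxl _ _)); apply: ereal_inf_lbound.
by exists (maxn K k) => //=; exact: leq_maxr.
Qed.

Lemma en_ae f g : cmeas f -> cmeas g -> {ae m, forall x, A x -> f x = g x} -> en f = en g.
Proof.
move=> mf mg fg; rewrite /en /Rintegral; congr fine.
apply: ge0_ae_eq_integral => //.
- by apply/measurable_EFinP; exact: cmeas_dens.
- by apply/measurable_EFinP; exact: cmeas_dens.
- by move=> x Ax; rewrite lee_fin; exact: dens_ge0.
- by move=> x Ax; rewrite lee_fin; exact: dens_ge0.
by apply: filterS fg => x fg Ax; rewrite /dens fg.
Qed.

End WeightedL2.

(** * Weighted Bergman spaces *)
(* The energy and the pairing are sealed: comparing two of their instances by
   conversion would unfold the Lebesgue integral. *)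
Fact energy_exists (R : realType) :
  {e : set R[i] -> (R[i] -> R) -> (R[i] -> R[i]) -> R | forall D mu f,
    e D mu f = en (area R) (region D) (fun w => mu (cplx w)) (fun w => f (cplx w))}.
Proof. by eexists => D mu f; reflexivity. Qed.

Definition energy (R : realType) (D : set R[i]) mu f : R := sval (energy_exists R) D mu f.

Lemma energyE (R : realType) (D : set R[i]) mu f : energy D mu f =
  en (area R) (region D) (fun w => mu (cplx w)) (fun w => f (cplx w)).
Proof. exact: (svalP (energy_exists R)). Qed.

Fact pairing_exists (R : realType) :
  {e : set R[i] -> (R[i] -> R) -> (R[i] -> R[i]) -> (R[i] -> R[i]) -> R[i] | forall D mu f g,
    e D mu f g = ip (area R) (region D) (fun w => mu (cplx w)) (fun w => f (cplx w)) (fun w => g (cplx w))}.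
Proof. by eexists => D mu f g; reflexivity. Qed.

Definition pairing (R : realType) (D : set R[i]) mu f g : R[i] := sval (pairing_exists R) D mu f g.

Lemma pairingE (R : realType) (D : set R[i]) mu f g : pairing D mu f g =
  ip (area R) (region D) (fun w => mu (cplx w)) (fun w => f (cplx w)) (fun w => g (cplx w)).
Proof. exact: (svalP (pairing_exists R)). Qed.

Section Energy.
Context {R : realType}.
Local Notation N := (@modulus R).
Variables (D : set R[i]) (mu : R[i] -> R).
Hypotheses (oD : open D) (mu_weight : weight D mu).
Implicit Types (f g h u v : R[i] -> R[i]) (z : R[i]).

Let rg := region D.
Let muc (w : plane R) := mu (cplx w).
Let pl f (w : plane R) : R[i] := f (cplx w).

Lemma measurable_region : measurable rg.
Proof. by apply: measurable_plane; exact: measurable_open. Qed.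

Let mrg := measurable_region.
Let mmu : measurable_fun rg muc. Proof. exact: mu_weight.1. Qed.
Let mu0 (w : plane R) : rg w -> 0 <= muc w.
Proof. by move=> Dw; apply/ltW; exact: (mu_weight.2 _ Dw). Qed.

Lemma L2_sqint f : L2 D mu f -> sqint (area R) rg muc (pl f).
Proof. exact. Qed.

Lemma sqint_L2 f : sqint (area R) rg muc (pl f) -> L2 D mu f.
Proof. exact. Qed.

Lemma energy_ge0 f : 0 <= energy D mu f.
Proof. by rewrite energyE; exact: (en_ge0 (area R) mu0). Qed.

Lemma L2sqE f : L2 D mu f -> L2sq D mu f = (energy D mu f)%:E.
Proof. by move=> Lf; rewrite energyE; exact: (esqE mrg mmu mu0 (L2_sqint Lf)). Qed.

Lemma L2sq_eq f g : (forall z, D z -> f z = g z) -> L2sq D mu f = L2sq D mu g.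
Proof. by move=> fg; apply: eq_integral => w; rewrite inE => Dw; rewrite fg. Qed.

Lemma energy_eq f g : (forall z, D z -> f z = g z) -> energy D mu f = energy D mu g.
Proof. by move=> fg; rewrite !energyE; apply: eq_Rintegral => w; rewrite inE => Dw; rewrite /dens fg. Qed.

Lemma pairing_eq f f' g g' : (forall z, D z -> f z = f' z) -> (forall z, D z -> g z = g' z) ->
  pairing D mu f g = pairing D mu f' g'.
Proof.
move=> ff gg; rewrite !pairingE; congr (_ +i* _); apply: eq_Rintegral => w; rewrite inE => Dw;
  by rewrite ff ?gg.
Qed.

Lemma holomorphic_cmeasurable f : holomorphic D f -> cmeasurable D f.
Proof.
move=> hf; have cf z : D z -> ccont f z by move=> /hf/derivable_cdiff; exact: cdiff_ccont.
have mp := measurable_open oD.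
split; apply: (@measurable_fun_plane R _ _ (preg D)) => //.
  apply: (@measurable_rcont R D (fun z => complex.Re (f z))) => // z /cf h e /h[d d0 H].
  by exists d => // w /H; apply: le_lt_trans; rewrite -raddfB; exact: modulus_Re.
apply: (@measurable_rcont R D (fun z => complex.Im (f z))) => // z /cf h e /h[d d0 H].
by exists d => // w /H; apply: le_lt_trans; rewrite -raddfB; exact: modulus_Im.
Qed.

Lemma A2_intro f : holomorphic D f -> (L2sq D mu f < +oo)%E -> A2 D mu f.
Proof. by move=> hf ff; exact: conj (conj (holomorphic_cmeasurable hf) ff) hf. Qed.

Lemma A2_zero : A2 D mu (fun=> 0).
Proof.
apply: A2_intro.
  exact: (@holomorphic_cst R D 0).
rewrite /L2sq (_ : (fun w => _) = (fun=> 0%E)); first by rewrite integral0.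
by apply/funext => w; rewrite modulus0 expr0n mul0r.
Qed.

Lemma A2_holomorphic f : A2 D mu f -> holomorphic D f.
Proof. by case. Qed.

Lemma A2_L2 f : A2 D mu f -> L2 D mu f.
Proof. by case. Qed.

Lemma L2_comb u v c : L2 D mu u -> L2 D mu v -> L2 D mu (fun z => u z + c * v z).
Proof. by move=> Lu Lv; exact: (sqint_L2 (sqint_comb mrg mmu mu0 c (L2_sqint Lu) (L2_sqint Lv)).1). Qed.

Lemma A2_comb u v c : A2 D mu u -> A2 D mu v -> A2 D mu (fun z => u z + c * v z).
Proof.
move=> [Lu hu] [Lv hv]; split; first exact: L2_comb.
exact: (holomorphicD hu (@holomorphicZ _ D c v hv)).
Qed.

Lemma A2_scale v c : A2 D mu v -> A2 D mu (fun z => c * v z).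
Proof.
move=> [Lv hv]; split; last exact: (@holomorphicZ _ D c v hv).
exact: (sqint_L2 (sqint_scale mrg mmu mu0 c (L2_sqint Lv)).1).
Qed.

Lemma energy_comb u v c : L2 D mu u -> L2 D mu v -> energy D mu (fun z => u z + c * v z) = energy D mu u +
  2 * (complex.Re c * complex.Re (pairing D mu u v) + complex.Im c * complex.Im (pairing D mu u v)) +
  N c ^+ 2 * energy D mu v.
Proof. by move=> Lu Lv; rewrite !energyE pairingE; exact: (sqint_comb mrg mmu mu0 c (L2_sqint Lu) (L2_sqint Lv)).2. Qed.

Lemma energy_scale v c : L2 D mu v -> energy D mu (fun z => c * v z) = N c ^+ 2 * energy D mu v.
Proof. by move=> Lv; rewrite !energyE; exact: (sqint_scale mrg mmu mu0 c (L2_sqint Lv)).2. Qed.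

Lemma pairing_conj u v : L2 D mu u -> L2 D mu v -> pairing D mu v u = conjc (pairing D mu u v).
Proof. by move=> Lu Lv; rewrite !pairingE; exact: (ip_conj mrg mmu mu0 (L2_sqint Lu) (L2_sqint Lv)). Qed.

Lemma pairing_self v : pairing D mu v v = (energy D mu v)%:C.
Proof. by rewrite pairingE energyE; exact: ip_self. Qed.

Lemma pairing_combl u v (w : R[i] -> R[i]) c : L2 D mu u -> L2 D mu v -> L2 D mu w ->
  pairing D mu (fun z => u z + c * v z) w = pairing D mu u w + c * pairing D mu v w.
Proof.
by move=> Lu Lv Lw; rewrite !pairingE; exact: (ip_combl mrg mmu mu0 c (L2_sqint Lu) (L2_sqint Lv) (L2_sqint Lw)).
Qed.

Lemma pairing_scalel v (w : R[i] -> R[i]) c : L2 D mu v -> L2 D mu w -> pairing D mu (fun z => c * v z) w = c * pairing D mu v w.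
Proof. by move=> Lv Lw; rewrite !pairingE; exact: (ip_scalel mrg mmu mu0 c (L2_sqint Lv) (L2_sqint Lw)). Qed.

Lemma clim_fatou (s : nat -> R[i] -> R[i]) h (a : R) K : (forall k, L2 D mu (s k)) ->
  (forall z, D z -> clim (s^~ z) (h z)) -> (forall k, (K <= k)%N -> energy D mu (s k) <= a) ->
  L2 D mu h /\ energy D mu h <= a.
Proof.
move=> Ls sh sa.
have ms k : cmeas rg (pl (s k)) := (L2_sqint (Ls k)).1.
have cl x : rg x -> clim ((fun k => pl (s k))^~ x) (pl h x) := fun Dx => sh _ Dx.
have sa' k : (K <= k)%N -> (esq (area R) rg muc (pl (s k)) <= a%:E)%E.
  by move=> /sa; rewrite energyE => h1; rewrite (esqE mrg mmu mu0 (L2_sqint (Ls k))) lee_fin.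
have F := fatou_bound mrg mmu mu0 ms cl sa'.
have Lh : sqint (area R) rg muc (pl h).
  by split; [exact: (clim_cmeas ms cl)|exact: le_lt_trans F (ltry _)].
by split; [exact: Lh|rewrite energyE -lee_fin -(esqE mrg mmu mu0 Lh)].
Qed.

Lemma energy_ae f g : L2 D mu f -> L2 D mu g ->
  {ae area R, forall x, rg x -> f (cplx x) = g (cplx x)} -> energy D mu f = energy D mu g.
Proof.
by move=> Lf Lg; rewrite !energyE; exact: (en_ae mrg mmu mu0 (L2_sqint Lf).1 (L2_sqint Lg).1).
Qed.

End Energy.

(* Unification diverges when it unfolds these. *)
Local Opaque A2 L2 L2sq.

(** * Bounded evaluations and the uniform boundedness principle *)

Section Reproducing.
Context {R : realType}.
Local Notation N := (@modulus R).
Variables (D : set R[i]) (mu : R[i] -> R).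
Hypotheses (oD : open D) (mu_weight : weight D mu).
Implicit Types (f g h u v : R[i] -> R[i]) (z : R[i]).

Local Notation A2mu := (A2 D mu).
Local Notation EE := (energy D mu).

Definition eval_bounded z := exists2 C : R, 0 <= C & forall g, A2mu g -> N (g z) ^+ 2 <= C * EE g.

Definition eval_loc_bounded z := exists r C : R, [/\ 0 < r, 0 <= C & forall w, N (w - z) < r ->
  forall g, A2mu g -> N (g w) ^+ 2 <= C * EE g].

(** Completeness with a rate: the limit is approached at the very rate [a] of the Cauchy condition,
    which the uniform boundedness argument uses quantitatively. *)
Definition A2_complete := forall (s : nat -> R[i] -> R[i]) (a : nat -> R), (forall k, A2mu (s k)) ->
  (forall j k, (k <= j)%N -> EE (fun z => s j z - s k z) <= a k) ->
  (forall e : R, 0 < e -> exists K, forall k, (K <= k)%N -> a k <= e) ->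
  exists2 h, A2mu h & forall k, EE (fun z => s k z - h z) <= a k.

Lemma sub_comb u v : (fun z => u z - v z) = (fun z => u z + (-1) * v z).
Proof. by apply/funext => z; rewrite mulN1r. Qed.

Lemma A2_sub u v : A2mu u -> A2mu v -> A2mu (fun z => u z - v z).
Proof. by move=> Au Av; rewrite sub_comb; exact: (A2_comb oD mu_weight _ Au Av). Qed.

Lemma L2_sub u v : L2 D mu u -> L2 D mu v -> L2 D mu (fun z => u z - v z).
Proof. by move=> Au Av; rewrite sub_comb; exact: (L2_comb oD mu_weight _ Au Av). Qed.

Lemma energy_sub u v : L2 D mu u -> L2 D mu v ->
  EE (fun z => u z - v z) = EE u - 2 * complex.Re (pairing D mu u v) + EE v.
Proof.
move=> Lu Lv; rewrite sub_comb energy_comb // modulusN modulus1 /=.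
by ring.
Qed.

Lemma energy_add u v : L2 D mu u -> L2 D mu v ->
  EE (fun z => u z + v z) = EE u + 2 * complex.Re (pairing D mu u v) + EE v.
Proof.
move=> Lu Lv; rewrite (_ : (fun z => _) = (fun z => u z + 1 * v z)); last by apply/funext => z; rewrite mul1r.
by rewrite energy_comb // modulus1 /=; ring.
Qed.

(** This is nonnegativity of the energy of u - v / t, multiplied by t. The free parameter stands in
    for square roots of energies. *)
Lemma energy_triangle u v (t : R) : 0 < t -> L2 D mu u -> L2 D mu v ->
  EE (fun z => u z + v z) <= (1 + t) * EE u + (1 + t^-1) * EE v.
Proof.
move=> t0 Lu Lv; rewrite energy_add //.
have := energy_ge0 mu_weight (fun z => u z + (- t^-1)%:C * v z).
rewrite energy_comb // modulus_real normrN (gtr0_norm (_ : 0 < t^-1)) ?invr_gt0 //.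
set X := complex.Re (pairing D mu u v) => /= h0.
have h : 0 <= EE u + 2 * (- t^-1 * X) + t^-1 ^+ 2 * EE v by move: h0; rewrite mul0r addr0.
have : 0 <= t * (EE u + 2 * (- t^-1 * X) + t^-1 ^+ 2 * EE v) by rewrite mulr_ge0 // ltW.
have -> : t * (EE u + 2 * (- t^-1 * X) + t^-1 ^+ 2 * EE v) = t * EE u - 2 * X + t^-1 * EE v.
  by field; rewrite gt_eqF.
by lra.
Qed.

(** Continuity at the zero function, tested on a multiple of g scaled into the ball of radius d. *)
Lemma eval_continuous_bounded z : Defs.eval_continuous D mu z -> eval_bounded z.
Proof.
move=> ec; have A0 := A2_zero mu oD.
have [d d0 H] := ec _ A0 1 ltr01.
exists (4 / d ^+ 2); first by rewrite divr_ge0 ?exprn_ge0 // ltW.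
move=> g Ag; have Lg := A2_L2 Ag.
apply/ler_addgt0Pl => e e0.
(* This summand keeps the scale [q] positive even when g has energy 0; it accounts for exactly [e]
   in the final bound. *)
pose eta := e * d ^+ 2 / 4; have eta0 : 0 < eta by rewrite divr_gt0 ?mulr_gt0 ?exprn_gt0.
have E0 := energy_ge0 mu_weight g.
have s0 : 0 < EE g + eta by rewrite ltr_wpDl.
pose q := Num.sqrt (EE g + eta); have q0 : 0 < q by rewrite sqrtr_gt0.
have q2 : q ^+ 2 = EE g + eta by rewrite sqr_sqrtr // ltW.
pose t := d / (2 * q); have t0 : 0 < t by rewrite divr_gt0 ?mulr_gt0.
have := H (fun z => t%:C * g z) (A2_scale oD mu_weight _ Ag).
rewrite (_ : (_ \- _) = (fun z => t%:C * g z)); last by apply/funext => x /=; rewrite subr0.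
rewrite (L2sqE oD mu_weight (A2_L2 (A2_scale oD mu_weight t%:C Ag))).
rewrite (energy_scale oD mu_weight _ Lg) lte_fin modulus_real gtr0_norm // subr0 modulusM modulus_real gtr0_norm // => h.
have {}h : t * N (g z) < 1.
  apply: h; rewrite /t exprMn exprVn exprMn q2 -mulrA gtr_pMr ?exprn_gt0 //.
  rewrite mulrC ltr_pdivrMr ?mulr_gt0 ?exprn_gt0 // mul1r; move: E0 eta0; lra.
have -> : e + 4 / d ^+ 2 * EE g = (t^-1) ^+ 2.
  by rewrite /t invf_div exprMn exprVn exprMn q2 /eta; field; rewrite gt_eqF.
by rewrite lerXn2r ?nnegrE ?modulus_ge0 ?invr_ge0 ?(ltW t0) // ltW // -[_^-1]mul1r ltr_pdivlMr // mulrC.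
Qed.

Lemma pow_small (C q : R) : 0 <= C -> 0 <= q < 1 -> forall e : R, 0 < e ->
  exists K : nat, forall k, (K <= k)%N -> C * q ^+ k <= e.
Proof.
move=> C0 /andP[q0 q1] e e0.
have : C * q ^+ k @[k --> \oo] --> C * 0.
  by apply: cvgM; [exact: cvg_cst|apply: cvg_expr; rewrite ger0_norm].
rewrite mulr0 => /cvgrPdist_le /(_ e e0) [K _ HK]; exists K => k /HK.
by rewrite sub0r normrN; apply: le_trans; exact: ler_norm.
Qed.

(* Sokal's proof of the uniform boundedness principle: if the evaluation norms
   were unbounded along w_k -> z, a series of near-extremal functions with
   coefficients +-3^-k would converge to an element of A^2 that is unbounded
   along w_k. *)
Lemma uniform_boundedness : (forall z, D z -> eval_bounded z) -> A2_complete ->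
  forall z, D z -> eval_loc_bounded z.
Proof.
move=> H1 complete z Dz; apply: contrapT => nb.
have [r0 r00 Hr0] := (open_modulus D).1 oD z Dz.
(* [q] is the norm of evaluation at w, a supremum over the unit ball, and g attains at least two
   thirds of it. Failure of the local bound supplies points w within 1 / (k + 1) of z with q as
   large as wanted. *)
have step k : exists p : R[i] * (R[i] -> R[i]) * R, let: (w, g, q) := p in
    [/\ N (w - z) < Num.min r0 k.+1%:R^-1, A2mu g /\ EE g <= 1, 0 <= q,
        forall f, A2mu f -> N (f w) ^+ 2 <= q ^+ 2 * EE f &
        6 * 3 ^+ k * k%:R <= q /\ 2 / 3 * q <= N (g w)].
  pose r := Num.min r0 k.+1%:R^-1; have r_gt0 : 0 < r by rewrite /r lt_min r00 invr_gt0 ltr0n.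
  pose Q : R := 6 * 3 ^+ k * k%:R + 1.
  have Q0 : 0 < Q by rewrite ltr_wpDl // !mulr_ge0 // exprn_ge0.
  have [w [g [wr Ag hg]]] : exists w g, [/\ N (w - z) < r, A2mu g & Q ^+ 2 * EE g < N (g w) ^+ 2].
    apply: contrapT => no; apply: nb; exists r, (Q ^+ 2); split => //; first exact: sqr_ge0.
    move=> w wr g Ag; rewrite leNgt; apply/negP => hg; apply: no; by exists w, g.
  have Dw : D w by apply: Hr0; move: wr; rewrite lt_min => /andP[].
  have [C C0 HC] := H1 w Dw.
  pose S := [set x | exists2 f, A2mu f /\ EE f <= 1 & x = N (f w)].
  have bS : ubound S (Num.sqrt C).
    move=> _ [f [Af f1] ->]; rewrite -[leLHS]ger0_norm ?modulus_ge0 // -sqrtr_sqr ler_sqrt //.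
    apply: le_trans (HC _ Af) _; rewrite -[leRHS]mulr1; exact: ler_wpM2l.
  have norm1 f : A2mu f -> 0 < EE f -> S (N (f w) / Num.sqrt (EE f)).
    move=> Af f0; exists (fun z => ((Num.sqrt (EE f))^-1)%:C * f z).
      split; first exact: (A2_scale oD mu_weight _ Af).
      by rewrite (energy_scale oD mu_weight _ (A2_L2 Af)) modulus_real normfV exprVn real_normK ?num_real // sqr_sqrtr ?(ltW f0) // mulVf // gt_eqF.
    by rewrite modulusM modulus_real normfV ger0_norm ?sqrtr_ge0 // mulrC.
  have Eg : 0 < EE g.
    rewrite lt_neqAle energy_ge0 // andbT; apply/negP => /eqP E0.
    have := HC g Ag; rewrite -E0 mulr0 leNgt => /negP; apply.
    by apply: le_lt_trans hg; rewrite -E0 mulr0.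
  pose q := sup S.
  have hS : has_sup S by split; [exists (N (g w) / Num.sqrt (EE g)); exact: norm1|exists (Num.sqrt C)].
  have qQ : Q < q.
    apply: lt_le_trans (ub_le_sup hS.2 (norm1 g Ag Eg)).
    rewrite ltr_pdivlMr ?sqrtr_gt0 // -ltr_sqr ?nnegrE ?modulus_ge0 ?mulr_ge0 ?sqrtr_ge0 ?(ltW Q0) //.
    by rewrite exprMn sqr_sqrtr // ltW.
  have q0 : 0 < q by exact: lt_trans qQ.
  have q3 : 0 < q / 3 by rewrite divr_gt0.
  have [x Sx hf] := sup_adherent q3 hS; case: Sx hf => f [Af f1] -> hf.
  exists (w, f, q); split => //.
  - exact: ltW.
  - move=> u Au; have [E0|E0] := ltP 0 (EE u).
      have := ub_le_sup hS.2 (norm1 u Au E0); rewrite -/q ler_pdivrMr ?sqrtr_gt0 // => h.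
      have -> : q ^+ 2 * EE u = (q * Num.sqrt (EE u)) ^+ 2 by rewrite exprMn sqr_sqrtr // ltW.
      by rewrite ler_sqr ?nnegrE ?modulus_ge0 // mulr_ge0 ?sqrtr_ge0 // ltW.
    have Eu : EE u = 0 by apply/eqP; rewrite eq_le E0 energy_ge0.
    by rewrite Eu mulr0; have := HC u Au; rewrite Eu mulr0.
  - split; first by apply: ltW; apply: lt_trans qQ; rewrite ltrDl.
    by apply: ltW; apply: le_lt_trans hf; rewrite -/q; lra.
have [P HP] := choice step.
pose w k := (P k).1.1; pose g k := (P k).1.2; pose q k := (P k).2.
have {}HP k : [/\ N (w k - z) < Num.min r0 k.+1%:R^-1, A2mu (g k) /\ EE (g k) <= 1, 0 <= q k,
        forall f, A2mu f -> N (f (w k)) ^+ 2 <= (q k) ^+ 2 * EE f &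
        6 * 3 ^+ k * k%:R <= q k /\ 2 / 3 * q k <= N (g k (w k))].
  by have := HP k; rewrite /w /g /q; case: (P k) => [[? ?] ?].
pose c k : R := (3 ^+ k)^-1; have c0 k : 0 < c k by rewrite invr_gt0 exprn_gt0.
have cS k : c k.+1 = c k / 3 by rewrite /c exprS invfM mulrC.
(* s(w) + c g(w) and s(w) - c g(w) differ by 2 c g(w), so they cannot both have modulus below c
   |g(w)|; the sign is chosen accordingly. *)
pose nxt k (s : R[i] -> R[i]) : R[i] -> R[i] :=
  if c k * N (g k (w k)) <= N (s (w k) + (c k)%:C * g k (w k)) then fun z => s z + (c k)%:C * g k z
  else fun z => s z + (- c k)%:C * g k z.
pose s := fix s k := if k is k'.+1 then nxt k' (s k') else (fun=> 0).
have s_step k : exists2 b : R, `|b| = c k & s k.+1 = (fun z => s k z + b%:C * g k z).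
  rewrite /= /nxt; case: ifP => _; [exists (c k)|exists (- c k)] => //; by rewrite ?normrN gtr0_norm.
have s_big k : c k * N (g k (w k)) <= N (s k.+1 (w k)).
  rewrite /= /nxt; case: ifPn => //; rewrite -ltNge => h.
  set a := s k (w k) in h *; set b := g k (w k) in h *.
  have : N ((c k)%:C * b) = c k * N b by rewrite modulusM modulus_real gtr0_norm.
  have -> : a + (- c k)%:C * b = (a + (c k)%:C * b) - 2 * ((c k)%:C * b).
    by rewrite rmorphN /=; ring.
  have := modulus_dist (2 * ((c k)%:C * b)) (a + (c k)%:C * b).
  rewrite modulusBC modulusM (modulus_nat 2) => h1 h2; move: h1 h; rewrite h2; lra.
have As k : A2mu (s k).
  elim: k => [|k IH].
    exact: (A2_zero mu oD).
  have [b _ ->] := s_step k; have [_ [Ag _] _ _ _] := HP k; exact: (A2_comb oD mu_weight _ IH Ag).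
(* 9 / 4 is the square of 3 / 2, the sum of the series of 3^-j. With parameter 1 / 2 in
   [energy_triangle] the induction closes exactly: 3 / 2 + 3 / 4 = 9 / 4. *)
have s_cauchy i k : EE (fun z => s (i + k)%N z - s k z) <= 9 / 4 * (c k) ^+ 2.
  elim: i k => [|i IH] k.
    rewrite add0n (_ : (fun z => _) = (fun z => 0 * s k z)); last by apply/funext => x; ring.
    by rewrite (energy_scale oD mu_weight _ (A2_L2 (As k))) modulus0 expr0n mul0r mulr_ge0 ?sqr_ge0.
  have [b bc sE] := s_step k; have [_ [Ag Eg] _ _ _] := HP k.
  have -> : (fun z => s (i.+1 + k)%N z - s k z) =
     (fun z => (s k.+1 z - s k z) + (s (i + k.+1)%N z - s k.+1 z)).
    by apply/funext => x; rewrite addSnnS; ring.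
  have h2 : 0 < 1 / 2 :> R by rewrite divr_gt0.
  apply: le_trans (energy_triangle h2 (A2_L2 (A2_sub (As k.+1) (As k))) (A2_L2 (A2_sub (As (i + k.+1)%N) (As k.+1)))) _.
  have e1 : EE (fun z => s k.+1 z - s k z) <= (c k) ^+ 2.
    rewrite sE (_ : (fun z => _) = (fun z => b%:C * g k z)); last by apply/funext => x; ring.
    rewrite (energy_scale oD mu_weight _ (A2_L2 Ag)).
    by rewrite modulus_real bc -[leRHS]mulr1 ler_wpM2l // sqr_ge0.
  have := IH k.+1; have -> : c k.+1 ^+ 2 = (c k) ^+ 2 / 9 by rewrite cS; field.
  have -> : (1 / 2 : R)^-1 = 2 by field.
  move: e1; have := sqr_ge0 (c k); lra.
have cE k : c k ^+ 2 = (9^-1) ^+ k.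
  by rewrite /c -exprVn -exprM mulnC exprM; congr (_ ^+ _); field.
have [||h Ah Hh] := complete s (fun k => 9 / 4 * (c k) ^+ 2) As.
- by move=> j k kj; rewrite -(subnK kj); exact: s_cauchy.
- move=> e e0; have [||K HK] := @pow_small (9 / 4) 9^-1 _ _ e e0.
  + by rewrite divr_ge0.
  + by rewrite invr_ge0 ler0n invf_lt1 // ltr1n.
  by exists K => k /HK; rewrite cE.
(* Step k ensures |s_(k+1)(w_k)| >= (2 / 3) c_k q_k, the tail of the series takes away at most c_k
   q_k / 2, and the remaining c_k q_k / 6 is at least k. This contradicts continuity of h at z. *)
have big k : k%:R <= N (h (w k)).
  have [_ _ qk Hq [q1 q2]] := HP k.
  have := Hq _ (A2_sub (As k.+1) Ah).
  have e2 := Hh k.+1.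
  have -> : N (h (w k)) = N (s k.+1 (w k) - (s k.+1 (w k) - h (w k))) by congr N; ring.
  set A := s k.+1 (w k); set B := A - h (w k) => e3.
  have e4 : N B <= c k / 2 * q k.
    rewrite -ler_sqr ?nnegrE ?modulus_ge0 ?mulr_ge0 ?divr_ge0 ?(ltW (c0 _)) //.
    apply: le_trans e3 _; apply: le_trans (ler_wpM2l (sqr_ge0 _) e2) _.
    have -> : c k.+1 ^+ 2 = (c k) ^+ 2 / 9 by rewrite cS; field.
    by rewrite le_eqVlt; apply/orP; left; apply/eqP; field.
  have e5 := modulus_dist A B.
  have e6 : c k * (2 / 3 * q k) <= N A by apply: le_trans (s_big k); rewrite ler_pM2l.
  have e7 : k%:R <= c k * (q k / 6).
    rewrite /c mulrC ler_pdivlMr ?exprn_gt0 //; move: q1; lra.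
  by move: e4 e5 e6 e7; set ck := c k; set qk' := q k; nra.
have hh := A2_holomorphic Ah; have [d d0 Hd] := cdiff_cont (derivable_cdiff (hh z Dz)) ltr01.
pose K1 := Num.truncn d^-1; pose K2 := Num.truncn (N (h z) + 1).
pose k := maxn K1 K2.+1.
have wk : N (w k - z) < d.
  have [] := HP k; rewrite lt_min => /andP[_ h1] _ _ _ _; apply: lt_trans h1 _.
  rewrite invf_plt ?posrE //; apply: lt_le_trans (truncnS_gt _) _.
  by rewrite ler_nat ltnS leq_maxl.
have := Hd _ wk; have := modulus_dist (h (w k)) (h z); have := big k.
have : N (h z) + 1 < k%:R.
  apply: lt_le_trans (truncnS_gt _) _; by rewrite ler_nat leq_maxr.
lra.
Qed.

End Reproducing.

(** * Extremal functions and the reduced kernel *)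
Lemma le_integral_subset d (T : measurableType d) (R : realType) (m : {measure set T -> \bar R})
    (A B : set T) (f g : T -> \bar R) : A `<=` B -> (forall x, A x -> (0 <= f x <= g x)%E) ->
  (forall x, B x -> (0 <= g x)%E) ->
  (\int[m]_(x in A) f x <= \int[m]_(x in B) g x)%E.
Proof.
move=> AB fg g0; rewrite integral_mkcond [leRHS]integral_mkcond.
apply: le_integral_ge0 => x _; rewrite !patchE.
have [xA|xA] := boolP (x \in A); last first.
  have -> : point = 0%E :> \bar R by []; rewrite lexx /=; case: ifPn => // xB.
  by apply: g0; exact: set_mem.
by rewrite mem_set; [apply/fg/set_mem|apply/AB/set_mem].
Qed.

Section Lower.
Context {R : realType}.
Local Notation N := (@modulus R).
Local Notation mu2 := (@lebesgue_measure R \x @lebesgue_measure R)%E.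
Variables (D : set R[i]) (mu : R[i] -> R).
Hypotheses (mu_weight : weight D mu).

Lemma L2sq_lower (Om : set R[i]) (g : R[i] -> R[i]) (c : R) : open Om -> Om `<=` D ->
  (forall z, Om z -> exists l, cdiff g z l) -> 0 <= c -> (forall z, Om z -> c <= mu z) ->
  (c%:E * \int[mu2]_(w in preg Om) (N (g (cplx w)) ^+ 2)%:E <= L2sq D mu g)%E.
Proof.
move=> oOm OmD dg c0 cmu.
have mOm := measurable_open oOm.
have mg := measurable_sqr oOm dg.
rewrite -ge0_integralZl //; last 2 first.
- exact/measurable_EFinP.
- by move=> w _; rewrite lee_fin sqr_ge0.
rewrite -(integral_area mOm); last 2 first.
- by apply: emeasurable_funM => //; exact/measurable_EFinP.
- by move=> w _; rewrite -EFinM lee_fin mulr_ge0 // sqr_ge0.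
apply: le_integral_subset.
- by move=> w /OmD.
- move=> w Ow; rewrite -EFinM !lee_fin mulr_ge0 ?sqr_ge0 //= mulrC.
  by apply: ler_wpM2l; [exact: sqr_ge0|exact: cmu].
- by move=> w Dw; rewrite lee_fin mulr_ge0 ?sqr_ge0 // ltW //; exact: (mu_weight.2 _ Dw).
Qed.

End Lower.

Lemma weight_one (R : realType) (D : set R[i]) : weight D (fun=> 1 : R).
Proof. by split => // *; exact: measurable_cst. Qed.

(** * Completeness of weighted Bergman spaces *)

Section Completeness.
Context {R : realType}.
Local Notation N := (@modulus R).
Variables (D : set R[i]) (mu : R[i] -> R).
Hypotheses (oD : open D) (mu_weight : weight D mu).
Implicit Types (f g h u v : R[i] -> R[i]) (z : R[i]).

Local Notation A2mu := (A2 D mu).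
Local Notation EE := (energy D mu).

Lemma energy_subC u v : L2 D mu u -> L2 D mu v -> EE (fun z => u z - v z) = EE (fun z => v z - u z).
Proof.
move=> Lu Lv; rewrite (_ : (fun z => u z - v z) = (fun z => (-1) * (v z - u z))).
  rewrite (energy_scale oD mu_weight _ (L2_sub oD mu_weight Lv Lu)).
  by rewrite modulusN modulus1 expr1n mul1r.
by apply/funext => z; ring.
Qed.

Lemma sqr_bound (x : R[i]) (C a e : R) : 0 <= C -> 0 < e -> N x ^+ 2 <= C * a -> a <= e ^+ 2 / (C + 1) -> N x <= e.
Proof.
move=> C0 e0 h ha; have C1 : 0 < C + 1 by rewrite ltr_wpDl.
rewrite -ler_sqr ?nnegrE ?modulus_ge0 ?(ltW e0) //; apply: le_trans h _.
apply: le_trans (ler_wpM2l C0 ha) _.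
rewrite mulrA ler_pdivrMr // mulrC; apply: ler_wpM2l; first exact: sqr_ge0.
by rewrite lerDl.
Qed.

Section Sequence.
Variables (s : nat -> R[i] -> R[i]) (a : nat -> R).
Hypotheses (As : forall k, A2mu (s k))
  (s_cauchy : forall j k, (k <= j)%N -> EE (fun z => s j z - s k z) <= a k)
  (a0 : forall e : R, 0 < e -> exists K, forall k, (K <= k)%N -> a k <= e).

Let a_small (C e : R) : 0 <= C -> 0 < e -> exists K, forall k, (K <= k)%N -> a k <= e ^+ 2 / (C + 1).
Proof. by move=> C0 e0; apply: a0; rewrite divr_gt0 ?exprn_gt0 // ltr_wpDl. Qed.

(** Evaluation bounds produce a pointwise limit; Fatou's lemma, applied to s_k - s_j as j grows,
    gives its distance to s_k. *)
Lemma cauchy_limit : (forall z, D z -> eval_bounded D mu z) ->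
  exists h, [/\ forall z, D z -> clim (s^~ z) (h z), L2 D mu h &
    forall k, EE (fun z => s k z - h z) <= a k].
Proof.
move=> bdd.
have lim z : exists l, D z -> clim (s^~ z) l.
  have [Dz|nDz] := pselect (D z); last by exists 0.
  have [C C0 HC] := bdd z Dz.
  have [|l Hl] := @clim_cauchy _ (s^~ z); last by exists l.
  move=> e e0; have [K HK] := a_small C0 e0; exists K => j k Kj Kk.
  wlog kj : j k Kj Kk / (k <= j)%N.
    by move=> W; have [/W|/ltnW/W] := leqP k j; [exact|rewrite modulusBC; exact].
  have := HC _ (A2_sub oD mu_weight (As j) (As k)) => h.
  apply: (sqr_bound (a := a k) C0 e0) (HK _ Kk); apply: le_trans h _.
  by apply: ler_wpM2l => //; exact: s_cauchy.
have [h Hh] := choice lim.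
have Lsub j k := A2_L2 (A2_sub oD mu_weight (As j) (As k)).
have F k : L2 D mu (fun z => s k z - h z) /\ EE (fun z => s k z - h z) <= a k.
  apply: (clim_fatou oD mu_weight (s := fun j z => s k z - s j z) (K := k)) => [j|z Dz|j kj].
  - exact: Lsub.
  - move=> e /(Hh z Dz)[K HK]; exists K => j /HK.
    have -> : s k z - s j z - (s k z - h z) = - (s j z - h z) by ring.
    by rewrite modulusN.
  - rewrite (energy_subC (A2_L2 (As k)) (A2_L2 (As j))); exact: s_cauchy.
have Lh : L2 D mu h.
  have := L2_sub oD mu_weight (A2_L2 (As 0)) (F 0).1.
  by rewrite (_ : (fun z => _) = h) //; apply/funext => z; ring.
by exists h; split; [exact: Hh|exact: Lh|move=> k; exact: (F k).2].
Qed.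

Lemma cauchy_lunif h : (forall z, D z -> eval_loc_bounded D mu z) ->
  (forall z, D z -> clim (s^~ z) (h z)) -> lunif D s h.
Proof.
move=> bdd sh z Dz; have [r1 [C [r10 C0 HC]]] := bdd z Dz.
have [r2 r20 H2] := (open_modulus D).1 oD z Dz.
exists (Num.min r1 r2); first by rewrite lt_min r10.
move=> e e0; have [K HK] := a_small C0 e0; exists K => k Kk w.
rewrite lt_min => /andP[w1 /H2 Dw]; rewrite modulusBC.
apply: (modulus_clim_le (sh w Dw) (K := k)) => j kj.
have := HC _ w1 _ (A2_sub oD mu_weight (As j) (As k)) => h1.
apply: (sqr_bound (a := a k) C0 e0) (HK _ Kk); apply: le_trans h1 _.
by apply: ler_wpM2l => //; exact: s_cauchy.
Qed.

End Sequence.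

Lemma eval_loc_boundedW z : eval_loc_bounded D mu z -> eval_bounded D mu z.
Proof.
by move=> [r [C [r0 C0 H]]]; exists C => // g; apply: H; rewrite subrr modulus0.
Qed.

(** Locally uniform evaluation bounds make the convergence locally uniform, and Weierstrass's
    theorem makes the limit holomorphic. *)
Lemma loc_bounded_complete : (forall z, D z -> eval_loc_bounded D mu z) -> A2_complete D mu.
Proof.
move=> bdd s a As sc a0.
have [h [sh Lh Eh]] := cauchy_limit As sc a0 (fun z Dz => eval_loc_boundedW (bdd z Dz)).
exists h => //; apply: (A2_intro oD).
  apply: (weierstrass oD (fun k => A2_holomorphic (As k))).
  exact: (cauchy_lunif As sc a0 bdd sh).
by rewrite (L2sqE oD mu_weight Lh) ltry.
Qed.

(** The pointwise limit is a priori only in L^2; closedness replaces it by an A^2 function equal to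
    it almost everywhere, at the same distances. Only pointwise bounds enter, so this can feed the
    uniform boundedness principle without circularity. *)
Lemma closed_complete : (forall z, D z -> eval_bounded D mu z) -> A2_closed D mu -> A2_complete D mu.
Proof.
move=> bdd closed s a As sc a0.
have [h0 [_ Lh Eh]] := cauchy_limit As sc a0 bdd.
have [|h Ah hh] := closed h0 Lh.
  move=> e e0; have [K HK] := a0 (e ^+ 2 / 2) ltac:(by rewrite divr_gt0 ?exprn_gt0).
  exists (s K); first exact: As.
  have Ls := A2_L2 (As K).
  rewrite (L2sqE oD mu_weight (L2_sub oD mu_weight Lh Ls)) (energy_subC Lh Ls) lte_fin.
  apply: le_lt_trans (Eh K) _; apply: le_lt_trans (HK K (leqnn _)) _.
  by rewrite ltr_pdivrMr // ltr_pMr ?exprn_gt0 // ltr1n.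
exists h => // k; apply: le_trans (Eh k); rewrite le_eqVlt; apply/orP; left; apply/eqP.
apply: (energy_ae oD mu_weight (L2_sub oD mu_weight (A2_L2 (As k)) (A2_L2 Ah))
  (L2_sub oD mu_weight (A2_L2 (As k)) Lh)).
by apply: filterS hh => x hx Dx; rewrite hx.
Qed.

End Completeness.

Lemma admissible_complete (R : realType) (D : set R[i]) (mu : R[i] -> R) : open D -> admissible D mu ->
  (forall z, D z -> eval_loc_bounded D mu z) /\ A2_complete D mu.
Proof.
move=> oD [mw cl ev].
have bdd z : D z -> eval_bounded D mu z by move=> /ev; exact: (eval_continuous_bounded oD mw).
have complete := closed_complete oD mw bdd cl.
by split => //; exact: (uniform_boundedness oD mw bdd complete).
Qed.

(** For the constant weight, the sub-mean value property on discs of radius d / 2 around all points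
    near z bounds evaluation locally uniformly. *)
Lemma one_complete (R : realType) (D : set R[i]) : open D ->
  (forall z, D z -> eval_loc_bounded D (fun=> 1 : R) z) /\ A2_complete D (fun=> 1 : R).
Proof.
move=> oD; have mw := weight_one D.
suff bdd z : D z -> eval_loc_bounded D (fun=> 1 : R) z.
  by split => //; exact: (loc_bounded_complete oD mw bdd).
move=> Dz; have [d d0 Hd] := (open_modulus D).1 oD z Dz.
have r0 : 0 < d / 2 by rewrite divr_gt0.
have p0 : 0 < pi * (d / 2) ^+ 2 :> R by rewrite mulr_gt0 ?pi_gt0 ?exprn_gt0.
exists (d / 2), ((pi * (d / 2) ^+ 2)^-1); split => //; first by rewrite invr_ge0 ltW.
move=> w wz g Ag.
have sub : cball w (d / 2) `<=` D.
  move=> u /= uw; apply: Hd; have -> : u - z = (u - w) + (w - z) by ring.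
  by apply: le_lt_trans (modulusD _ _) _; rewrite [ltRHS](splitr d); exact: ltrD.
have dg u : modulus (u - w) < d / 2 -> exists l, cdiff g u l.
  by move=> uw; exists (derive1 g u); apply/derivable_cdiff/(A2_holomorphic Ag)/sub.
have h1 := ball_lower r0 dg.
have h2 := L2sq_lower mw (@open_cball R w (d / 2)) sub dg ler01 (fun _ _ => lexx 1).
rewrite mul1e (L2sqE oD mw (A2_L2 Ag)) in h2.
by rewrite mulrC ler_pdivlMr // mulrA -lee_fin; exact: le_trans h1 h2.
Qed.

(* Sealed complex derivatives: unfolding [derive1] makes unification diverge. *)
Fact dd_exists (R : realType) :
  {d : nat -> (R[i] -> R[i]) -> R[i] -> R[i] | forall j f, d j f = derive1n j f}.
Proof. by eexists => j f; reflexivity. Qed.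

Definition dd (R : realType) j (f : R[i] -> R[i]) : R[i] -> R[i] := sval (dd_exists R) j f.

Section SealedDerivative.
Context {R : realType}.
Implicit Types (f g h : R[i] -> R[i]) (D : set R[i]).

Lemma ddE j f : dd j f = derive1n j f.
Proof. exact: (svalP (dd_exists R)). Qed.

Lemma dd1E f : dd 1 f = derive1 f.
Proof. exact: (ddE 1 f). Qed.

Lemma dd0 f : dd 0 f = f.
Proof. exact: (ddE 0 f). Qed.

Lemma ddSn j f : dd j.+1 f = dd j (dd 1 f).
Proof. by rewrite !ddE derive1Sn. Qed.

Lemma dd_zero j : dd j (fun=> 0 : R[i]) = (fun=> 0).
Proof.
rewrite ddE; elim: j => // j IH; rewrite derive1nS IH; apply/funext => z.
exact: cdiff_derive1 (cdiff_cst _ _).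
Qed.

Lemma dd_comb D j f g c z : open D -> D z -> holomorphic D f -> holomorphic D g ->
  dd j (fun z => f z + c * g z) z = dd j f z + c * dd j g z.
Proof. by move=> oD Dz hf hg; rewrite !ddE; exact: (derive1nDZ c j oD Dz hf hg). Qed.

Lemma dd_holomorphic D j f : open D -> holomorphic D f -> holomorphic D (dd j f).
Proof. by move=> oD hf; rewrite ddE; exact: (holomorphic_derive1n oD hf). Qed.

Lemma dd_cdiff D f z : holomorphic D f -> D z -> cdiff f z (dd 1 f z).
Proof. by move=> hf Dz; rewrite dd1E; exact: derivable_cdiff (hf z Dz). Qed.

Lemma cdiff_dd f z l : cdiff f z l -> dd 1 f z = l.
Proof. by rewrite dd1E; exact: cdiff_derive1. Qed.

Lemma dd_eq D f g j z : open D -> D z -> (forall z, D z -> f z = g z) -> holomorphic D f ->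
  dd j f z = dd j g z.
Proof. by move=> oD Dz fg hf; rewrite !ddE; exact: (derive1n_eq j oD Dz fg hf). Qed.

Lemma dd_clim D (G : nat -> R[i] -> R[i]) h a (r : R) j : open D -> 0 < r ->
  (forall z, modulus (z - a) < r -> D z) ->
  (forall k, holomorphic D (G k)) -> holomorphic D h ->
  (forall e : R, 0 < e -> exists K : nat, forall k, (K <= k)%N ->
    forall w, modulus (w - a) < r -> modulus (G k w - h w) <= e) ->
  clim (fun k => dd j (G k) a) (dd j h a).
Proof.
move=> oD r0 rD hG hh H; have cl := clim_derive1n j oD r0 rD hG hh H.
by move=> e /cl[K HK]; exists K => k /HK; rewrite !ddE.
Qed.

Lemma AD_dd D mu n zeta f : AD D mu n zeta f <->
  [/\ holomorphic D f, forall j, (j < n)%N -> dd j f zeta = 0 & (L2sq D mu (dd 1 f) < +oo)%E].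
Proof.
rewrite dd1E; split=> -[h1 h2 h3]; split => // j jn; first by rewrite ddE; exact: h2.
by have := h2 j jn; rewrite ddE.
Qed.

End SealedDerivative.

Lemma AD_innerE (R : realType) (D : set R[i]) (mu : R[i] -> R) (f g : R[i] -> R[i]) :
  AD_inner D mu f g = pairing D mu (dd 1 f) (dd 1 g).
Proof.
have E (z : R[i]) (x : R) : complex.Re (z * x%:C) = complex.Re z * x /\ complex.Im (z * x%:C) = complex.Im z * x.
  by case: z => a b /=; split; ring.
rewrite !dd1E /AD_inner /cintegral pairingE /ip /ipRe /ipIm; congr (_ +i* _); apply: eq_Rintegral => w _.
  exact: (E _ _).1.
exact: (E _ _).2.
Qed.

(** [xget] returns an element of the specified set as soon as there is one, so exhibiting one
    representing function is enough. *)
Lemma kernelM_spec (R : realType) (D : set R[i]) (mu : R[i] -> R) n (zeta : R[i]) M0 :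
  AD D mu n zeta M0 ->
  (forall f, AD D mu n zeta f -> dd n f zeta = pairing D mu (dd 1 f) (dd 1 M0)) ->
  AD D mu n zeta (kernelM D mu n zeta) /\
  forall f, AD D mu n zeta f -> dd n f zeta = pairing D mu (dd 1 f) (dd 1 (kernelM D mu n zeta)).
Proof.
move=> V0 H0.
pose P := [set M | AD D mu n zeta M /\
  forall f, AD D mu n zeta f -> derive1n n f zeta = AD_inner D mu f M].
have P0 : P M0 by split; [exact: V0|move=> f Vf; rewrite AD_innerE -ddE; exact: H0].
have [VM HM] : P (kernelM D mu n zeta) := @xgetI _ (fun=> 0) P M0 P0.
split; first exact: VM.
by move=> f Vf; rewrite -AD_innerE ddE; exact: HM.
Qed.

(** * Extremal functions and the representing function *)

Section Kernel.
Context {R : realType}.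
Local Notation N := (@modulus R).
Variables (D : set R[i]) (mu : R[i] -> R) (n : nat) (zeta : R[i]).
Hypotheses (oD : open D) (cD : connected D) (Dzeta : D zeta) (n0 : (0 < n)%N)
  (mu_weight : weight D mu) (bdd : forall z, D z -> eval_loc_bounded D mu z)
  (complete : A2_complete D mu).
Implicit Types (f g h u v : R[i] -> R[i]) (z : R[i]).

Local Notation EE := (energy D mu).
Definition V f := [/\ holomorphic D f, forall j, (j < n)%N -> dd j f zeta = 0 &
  (L2sq D mu (dd 1 f) < +oo)%E].

Lemma AD_A2 f : V f -> A2 D mu (dd 1 f).
Proof. by move=> [hf _ ff]; exact: (A2_intro oD (dd_holomorphic (j := 1) oD hf) ff). Qed.

Lemma AD_comb f g c : V f -> V g -> V (fun z => f z + c * g z).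
Proof.
move=> Vf Vg; have [hf f0 _] := Vf; have [hg g0 _] := Vg; split.
- exact: (holomorphicD hf (@holomorphicZ _ D c g hg)).
- by move=> j jn; rewrite (dd_comb j c oD Dzeta hf hg) f0 // g0 // mulr0 addr0.
have A := A2_L2 (A2_comb oD mu_weight c (AD_A2 Vf) (AD_A2 Vg)).
rewrite (L2sq_eq mu (fun z Dz => dd_comb 1 c oD Dz hf hg)).
by rewrite (L2sqE oD mu_weight A) ltry.
Qed.

Lemma AD_zero : V (fun=> 0).
Proof.
split; [exact: holomorphic_cst|by move=> j _; rewrite dd_zero|rewrite dd_zero].
by rewrite (L2sqE oD mu_weight (A2_L2 (A2_zero mu oD))) ltry.
Qed.

Lemma AD_scale f c : V f -> V (fun z => c * f z).
Proof.
move=> Vf; have := AD_comb c AD_zero Vf.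
by rewrite (_ : (fun z => 0 + c * f z) = (fun z => c * f z)) //; apply/funext => z; rewrite add0r.
Qed.

Lemma dd_scale f c j : V f -> dd j (fun z => c * f z) zeta = c * dd j f zeta.
Proof.
move=> [hf _ _]; have := dd_comb j c oD Dzeta (@holomorphic_cst R D 0) hf.
by rewrite dd_zero add0r => <-; congr (dd j _ zeta); apply/funext => z; rewrite add0r.
Qed.

Lemma energy_dd_comb f g c : V f -> V g ->
  EE (dd 1 (fun z => f z + c * g z)) = EE (fun z => dd 1 f z + c * dd 1 g z).
Proof.
move=> [hf _ _] [hg _ _]; apply: energy_eq => z Dz; exact: (dd_comb 1 c oD Dz hf hg).
Qed.

Definition normalized f := V f /\ dd n f zeta = 1.

Lemma normalized_mean f g : normalized f -> normalized g ->
  normalized (fun z => 2^-1 * (f z + 1 * g z)).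
Proof.
move=> [Vf f1] [Vg g1]; split; first exact: AD_scale (AD_comb _ _ _).
rewrite dd_scale; last exact: AD_comb.
have [hf _ _] := Vf; have [hg _ _] := Vg.
by rewrite (dd_comb n 1 oD Dzeta hf hg) f1 g1 mul1r -mulr2n -[1 *+ 2]/(2%:R) mulVf // -modulus_eq0 modulus_nat pnatr_eq0.
Qed.

(** Midpoints of normalized functions are normalized, so their energy is at least m, and the
    parallelogram law makes the derivatives Cauchy. Their limit h is integrated by
    [termwise_primitive], for which all f_k have the same value 0 at [zeta] since n > 0. *)
Lemma minimizing_sequence (m : R) (f : nat -> R[i] -> R[i]) :
  (forall g, normalized g -> m <= EE (dd 1 g)) ->
  (forall k, normalized (f k)) -> (forall k, EE (dd 1 (f k)) <= m + 4^-1 ^+ k) ->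
  exists F, normalized F /\ EE (dd 1 F) = m.
Proof.
move=> mmin nf fm.
have Vf k := (nf k).1; have hf k : holomorphic D (f k) by case: (Vf k).
pose s k := dd 1 (f k); have As k : A2 D mu (s k) := AD_A2 (Vf k).
pose a k : R := 4 * 4^-1 ^+ k.
have q4 : 0 <= (4^-1 : R) < 1 by rewrite invr_ge0 ler0n invf_lt1 // ltr1n.
have a0 e : 0 < e -> exists K, forall k, (K <= k)%N -> a k <= e by exact: pow_small.
have sc j k : (k <= j)%N -> EE (fun z => s j z - s k z) <= a k.
  move=> kj; have Lj := A2_L2 (As j); have Lk := A2_L2 (As k).
  (* Parallelogram law in numbers: with energies at most m + 4^-j and m + 4^-k and a midpoint of
     energy at least m, the difference has energy at most 2 / 4^j + 2 / 4^k. *)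
  have key (x1 x2 x3 x4 x5 : R) : x1 <= m + x4 -> x2 <= m + x5 -> x4 <= x5 ->
      m <= 4^-1 * (x1 + 2 * x3 + x2) -> x1 - 2 * x3 + x2 <= 4 * x5 by lra.
  have := mmin _ (normalized_mean (nf j) (nf k)).
  have -> : EE (dd 1 (fun z => 2^-1 * (f j z + 1 * f k z))) = 4^-1 * EE (fun z => s j z + s k z).
    have Vjk := AD_comb 1 (Vf j) (Vf k).
    rewrite (_ : (fun z => 2^-1 * _) = (fun z => (fun=> 0) z + 2^-1 * (fun z => f j z + 1 * f k z) z)); last by apply/funext => z; rewrite add0r.
    rewrite (energy_dd_comb _ AD_zero Vjk).
    rewrite (@energy_eq _ D mu _ (fun z => 2^-1 * (s j z + s k z))).
      have L1 : L2 D mu (fun z => s j z + s k z).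
        have := L2_comb oD mu_weight 1 Lj Lk.
        by rewrite (_ : (fun z => s j z + 1 * s k z) = (fun z => s j z + s k z)) //; apply/funext => z; rewrite mul1r.
      rewrite (energy_scale oD mu_weight _ L1) modulusV modulus_nat; congr (_ * _); by field.
    move=> z Dz; rewrite (dd_comb 1 _ oD Dz (hf j) (hf k)) mul1r.
    by rewrite dd_zero add0r.
  rewrite (energy_add oD mu_weight Lj Lk) (energy_sub oD mu_weight Lj Lk).
  have h1 : EE (s j) <= m + 4^-1 ^+ j := fm j; have h2 : EE (s k) <= m + 4^-1 ^+ k := fm k.
  have h3 : 4^-1 ^+ j <= 4^-1 ^+ k :> R by case/andP: q4 => q0 q1; rewrite ler_wiXn2l // ltW.
  exact: (key _ _ _ _ _ h1 h2 h3).
have [h Ah Eh] := complete As sc a0.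
have lu : lunif D s h.
  move=> z Dz; have [r [C [r0 C0 HC]]] := bdd Dz; exists r => // e e0.
  have [K HK] := a0 (e ^+ 2 / (C + 1)) ltac:(by rewrite divr_gt0 ?exprn_gt0 // ltr_wpDl).
  exists K => k Kk w wz; apply: (sqr_bound (a := a k) C0 e0) (HK _ Kk).
  apply: le_trans (HC w wz _ (A2_sub oD mu_weight (As k) Ah)) _.
  by apply: ler_wpM2l => //; exact: Eh.
have hh := A2_holomorphic Ah.
have lu' : lunif D (fun k => derive1 (f k)) h.
  by rewrite (_ : (fun k => _) = s) //; apply/funext => k; rewrite /s dd1E.
have [|F dF F0] := termwise_primitive oD cD Dzeta hf _ lu'.
  by move=> k; have [_ /(_ 0 n0) + _] := Vf k; rewrite dd0.
have hF : holomorphic D F by move=> z /dF; exact: cdiff_derivable.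
have dFh z : D z -> dd 1 F z = h z by move=> /dF; exact: cdiff_dd.
(* Conditions of order at least 1 at [zeta] pass to the limit as derivatives of h, of order one
   less; the value at [zeta] comes from the choice of primitive. *)
have lim j : clim (fun k => dd j.+1 (f k) zeta) (dd j.+1 F zeta).
  rewrite ddSn; under eq_fun do rewrite ddSn.
  rewrite (dd_eq j oD Dzeta dFh (dd_holomorphic (j := 1) oD hF)).
  have [r1 r10 H1] := lu _ Dzeta; have [r2 r20 H2] := (open_modulus D).1 oD _ Dzeta.
  have r0 : 0 < Num.min r1 r2 by rewrite lt_min r10.
  have rD z : N (z - zeta) < Num.min r1 r2 -> D z by rewrite lt_min => /andP[_ /H2].
  apply: (dd_clim j oD r0 rD (fun k => A2_holomorphic (As k)) hh).
  move=> e /H1[K HK]; exists K => k Kk w; rewrite lt_min => /andP[w1 _]; exact: HK.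
have EF : EE (dd 1 F) = EE h by apply: energy_eq.
have VF : V F.
  split => //.
  - case=> [|j] jn; first by rewrite dd0; exact: F0.
    apply: (clim_unique (lim j)); rewrite (_ : (fun k => _) = (fun=> 0)); first exact: clim_cst.
    by apply/funext => k; have [_ + _] := Vf k; exact.
  - by rewrite (L2sq_eq mu dFh) (L2sqE oD mu_weight (A2_L2 Ah)) ltry.
have nF : normalized F.
  split => //; rewrite -(prednK n0); apply: (clim_unique (lim n.-1)).
  rewrite (_ : (fun k => _) = (fun=> 1)); first exact: clim_cst.
  by apply/funext => k; rewrite prednK //; exact: (nf k).2.
exists F; split => //; apply/eqP; rewrite eq_le mmin // andbT EF.
apply/ler_addgt0Pl => e e0.
have [K HK] := @pow_small R 1 4^-1 ler01 q4 e e0.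
have cl z : D z -> clim (s^~ z) (h z).
  move=> Dz e' e'0; have [r r0 H] := lu z Dz; have [K' HK'] := H e' e'0.
  by exists K' => k Kk; apply: HK' => //; rewrite subrr modulus0.
have sK k : (K <= k)%N -> EE (s k) <= e + m.
  move=> Kk; apply: le_trans (fm k) _; rewrite addrC lerD2r.
  by have := HK k Kk; rewrite mul1r.
exact: (clim_fatou oD mu_weight (fun k => A2_L2 (As k)) cl sK).2.
Qed.

(** T, once rescaled, shows that the class of normalized functions is nonempty, so that the infimum
    of the energy is meaningful. *)
Lemma exists_minimizer T : V T -> dd n T zeta != 0 ->
  exists F, normalized F /\ forall g, normalized g -> EE (dd 1 F) <= EE (dd 1 g).
Proof.
move=> VT T0.
pose S := [set x | exists2 f, normalized f & x = EE (dd 1 f)].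
have iS : has_inf S.
  split; last by exists 0 => _ [f _ ->]; exact: (energy_ge0 mu_weight).
  exists (EE (dd 1 (fun z => (dd n T zeta)^-1 * T z))).
  eexists; last reflexivity; split; first exact: AD_scale.
  by rewrite dd_scale // mulVf.
pose m := inf S.
have step k : exists f, normalized f /\ EE (dd 1 f) <= m + 4^-1 ^+ k.
  have q4 : 0 < 4^-1 ^+ k :> R by rewrite exprn_gt0 // invr_gt0.
  have [_ [f nf ->] hf] := inf_adherent q4 iS.
  by exists f; split => //; exact: ltW.
have [f Hf] := choice step.
have mmin g : normalized g -> m <= EE (dd 1 g).
  by move=> ng; apply: (ge_inf iS.2); exists g.
have [F [nF EF]] := minimizing_sequence mmin (fun k => (Hf k).1) (fun k => (Hf k).2).
exists F; split; first exact: nF.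
have Fm : EE (dd 1 F) <= m by rewrite EF.
by move=> g ng; exact: (le_trans Fm (mmin g ng)).
Qed.

(** The choice t = - x / (e + 1) makes the expression negative unless x = 0, and it remains
    legitimate when e = 0. *)
Lemma real_quadratic_ge0 (x e : R) : 0 <= e -> (forall t : R, 0 <= 2 * (t * x) + t ^+ 2 * e) -> x = 0.
Proof.
move=> e0 H; have e1 : 0 < e + 1 by rewrite ltr_wpDl.
have := H (- x / (e + 1)).
have -> : 2 * (- x / (e + 1) * x) + (- x / (e + 1)) ^+ 2 * e = - (x ^+ 2 * ((e + 2) / (e + 1) ^+ 2)).
  by field; rewrite gt_eqF.
rewrite oppr_ge0 pmulr_lle0; last by rewrite divr_gt0 ?exprn_gt0 // ltr_wpDl.
by move=> h; apply/eqP; rewrite -sqrf_eq0 eq_le h sqr_ge0.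
Qed.

(** First variation of the energy at F along g, once with real and once with imaginary
    coefficient. *)
Lemma minimizer_orthogonal F g : normalized F ->
  (forall f, normalized f -> EE (dd 1 F) <= EE (dd 1 f)) ->
  V g -> dd n g zeta = 0 -> pairing D mu (dd 1 F) (dd 1 g) = 0.
Proof.
move=> [VF F1] Fmin Vg g0; have [hF _ _] := VF; have [hg _ _] := Vg.
have LF := A2_L2 (AD_A2 VF); have Lg := A2_L2 (AD_A2 Vg).
have H c : 0 <= 2 * (complex.Re c * complex.Re (pairing D mu (dd 1 F) (dd 1 g)) +
    complex.Im c * complex.Im (pairing D mu (dd 1 F) (dd 1 g))) + N c ^+ 2 * EE (dd 1 g).
  have nc : normalized (fun z => F z + c * g z).
    split; first exact: AD_comb.
    by rewrite (dd_comb n c oD Dzeta hF hg) F1 g0 mulr0 addr0.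
  have := Fmin _ nc; rewrite (energy_dd_comb c VF Vg) (energy_comb oD mu_weight c LF Lg).
  by rewrite -addrA lerDl.
have E0 := energy_ge0 mu_weight (dd 1 g).
have X0 : complex.Re (pairing D mu (dd 1 F) (dd 1 g)) = 0.
  apply: (real_quadratic_ge0 E0) => t.
  by have := H t%:C; rewrite modulus_sqr /= mul0r addr0 expr0n addr0.
have Y0 : complex.Im (pairing D mu (dd 1 F) (dd 1 g)) = 0.
  apply: (real_quadratic_ge0 E0) => t.
  by have := H (0 +i* t); rewrite modulus_sqr /= mul0r add0r expr0n add0r.
by apply/eqP; rewrite eq_complex X0 Y0 /= eqxx.
Qed.

(** Energy 0 would force F' = 0 on D by the evaluation bounds, against F^(n)(zeta) = 1 with n >
    0. *)
Lemma minimizer_energy_gt0 F : normalized F -> 0 < EE (dd 1 F).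
Proof.
move=> [VF F1]; rewrite lt_neqAle (energy_ge0 mu_weight) andbT; apply/negP => /eqP E0.
have d0 z : D z -> dd 1 F z = 0.
  move=> Dz; have [C C0 HC] := eval_loc_boundedW (bdd Dz).
  have := HC _ (AD_A2 VF); rewrite -E0 mulr0 => h.
  by apply/eqP; rewrite -modulus_eq0 -sqrf_eq0 eq_le h sqr_ge0.
have [hF _ _] := VF; move: F1; rewrite -(prednK n0) ddSn.
rewrite (dd_eq _ oD Dzeta d0 (dd_holomorphic (j := 1) oD hF)).
rewrite dd_zero => /eqP; rewrite eq_sym; exact/negP/oner_neq0.
Qed.

(** For f in the space, f - f^(n)(zeta) F has n-th derivative 0 at [zeta], hence is orthogonal to F.
    Therefore M0 = F / m represents the functional. *)
Lemma kernel_energy T : V T -> dd n T zeta != 0 ->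
  exists F, [/\ normalized F, forall f, normalized f -> EE (dd 1 F) <= EE (dd 1 f) &
    reduced_kernel_deriv D mu n n.-1 zeta zeta = ((EE (dd 1 F))^-1)%:C].
Proof.
move=> VT T0; have [F [nF Fmin]] := exists_minimizer VT T0.
have [VF F1] := nF; have m0 := minimizer_energy_gt0 nF.
set m := EE (dd 1 F) in m0 *.
pose M0 z := (m^-1)%:C * F z; have VM0 : V M0 := AD_scale _ VF.
have [hF _ _] := VF.
have dM0 z : D z -> dd 1 M0 z = (m^-1)%:C * dd 1 F z.
  by move=> Dz; apply: cdiff_dd; exact: cdiffZ (dd_cdiff hF Dz).
have LF := A2_L2 (AD_A2 VF).
have mC : (m^-1)%:C * m%:C = 1 :> R[i] by rewrite -rmorphM /= mulVf ?gt_eqF.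
have rep0 f : V f -> dd n f zeta = pairing D mu (dd 1 f) (dd 1 M0).
  move=> Vf; set t := dd n f zeta; have [hf _ _] := Vf.
  pose g z := f z + (- t) * F z.
  have Vg : V g := AD_comb _ Vf VF.
  have g0 : dd n g zeta = 0 by rewrite (dd_comb n (- t) oD Dzeta hf hF) F1 mulr1 subrr.
  have [hg _ _] := Vg; have Lg := A2_L2 (AD_A2 Vg).
  have ort := minimizer_orthogonal nF Fmin Vg g0.
  have Lf := A2_L2 (AD_A2 Vf).
  have E z : D z -> dd 1 f z = dd 1 g z + t * dd 1 F z.
    by move=> Dz; rewrite (dd_comb 1 _ oD Dz hf hF); ring.
  rewrite (pairing_eq mu E dM0).
  have LmF : L2 D mu (fun z => (m^-1)%:C * dd 1 F z) := A2_L2 (A2_scale oD mu_weight _ (AD_A2 VF)).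
  rewrite (pairing_combl oD mu_weight t Lg LF LmF).
  rewrite (pairing_conj oD mu_weight LmF Lg) (pairing_conj oD mu_weight LmF LF).
  rewrite (pairing_scalel oD mu_weight _ LF Lg) (pairing_scalel oD mu_weight _ LF LF) ort pairing_self.
  by rewrite mulr0 -/m mC !rmorph0 rmorph1 add0r mulr1.
have [] := kernelM_spec ((AD_dd _ _ _ _ _).2 VM0) (fun f Vf => rep0 f ((AD_dd _ _ _ _ _).1 Vf)).
set K := kernelM D mu n zeta => /AD_dd VM HM.
exists F; split; [exact: nF|exact: Fmin|].
have -> : reduced_kernel_deriv D mu n n.-1 zeta zeta = dd n K zeta.
  by rewrite -[in RHS](prednK n0) ddE derive1Sn.
(* Both K and M0 represent the functional; pairing one with the other gives K^(n)(zeta) as the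
   conjugate of M0^(n)(zeta) = 1 / m. *)
rewrite (rep0 _ VM) (pairing_conj oD mu_weight (A2_L2 (AD_A2 VM0)) (A2_L2 (AD_A2 VM))).
rewrite -(HM _ ((AD_dd _ _ _ _ _).2 VM0)).
rewrite dd_scale // F1 mulr1.
by apply/eqP; rewrite eq_complex /= oppr0 !eqxx.
Qed.

End Kernel.

Local Transparent A2 L2 L2sq.

(** * Energy bounds from inscribed and circumscribed discs *)
(** The comparison is almost everywhere because the weight is bounded only essentially. *)
Lemma esq_ae_le d (T : measurableType d) (R : realType) (m : {measure set T -> \bar R})
    (A : set T) (mu : T -> R) (f : T -> R[i]) (h : T -> R) : measurable A -> measurable_fun A mu ->
  (forall x, A x -> 0 <= mu x) -> cmeas A f -> measurable_fun A h -> (forall x, A x -> 0 <= h x) ->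
  {ae m, forall x, A x -> modulus (f x) ^+ 2 * mu x <= h x} ->
  (esq m A mu f <= \int[m]_(x in A) (h x)%:E)%E.
Proof.
move=> mA mmu mu0 mf mh h0 fh; apply: ae_ge0_le_integral => //.
- by move=> x Ax; rewrite lee_fin; exact: (dens_ge0 mu0).
- by apply/measurable_EFinP; exact: (cmeas_dens mmu mf).
- exact/measurable_EFinP.
Qed.

Section TestFunction.
Context {R : realType}.
Local Notation N := (@modulus R).
Local Notation mu2 := (@lebesgue_measure R \x @lebesgue_measure R)%E.
Variables (D : set R[i]) (n : nat) (zeta d : R[i]).
Hypotheses (oD : open D) (Dzeta : D zeta) (n0 : (0 < n)%N) (d0 : d != 0).

Let c := zeta + d.
(* [W] is the Moebius map with [W zeta = 0] and pole [c]; on a disc centred at 0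
   the extremal function of order n is a multiple of [w ^+ n]. *)
Let W z := (z - c)^-1 + d^-1.
Let T z := W z ^+ n * n%:R^-1.

Hypothesis Dc : ~ D c.

Let Dzc z : D z -> z - c != 0.
Proof. by move=> Dz; rewrite subr_eq0; apply/eqP => zc; apply: Dc; rewrite -zc. Qed.

Let nC : n%:R != 0 :> R[i].
Proof. by rewrite -modulus_eq0 modulus_nat pnatr_eq0 -lt0n. Qed.

Let lin z : cdiff (fun w : R[i] => w - c) z 1.
Proof. by have := @complex_lin_ext _ (- c) 1 z; under eq_fun do rewrite mul1r addrC; exact. Qed.

Lemma cdiff_test z : z - c != 0 -> cdiff T z (- (W z ^+ n.-1 * (z - c) ^- 2)).
Proof.
move=> zc.
have dinv : cdiff (fun w => (w - c)^-1) z (- (z - c) ^- 2 * 1).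
  by apply: (cdiff_comp (f := fun w => w - c) (g := fun u => u^-1) (lin z)); exact: cdiffV.
have dW := cdiff_comp (cdiffD dinv (cdiff_cst d^-1 z)) (cdiffX n _).
have := cdiffZ n%:R^-1 dW.
have -> : n%:R^-1 * (n%:R * ((z - c)^-1 + d^-1) ^+ n.-1 * (- (z - c) ^- 2 * 1 + 0)) =
    - (W z ^+ n.-1 * (z - c) ^- 2).
  by rewrite addr0 mulr1 [X in _ * X]mulrN mulrN -mulrA mulKf.
by apply: (@cdiff_ext _ _ _ _ _ 1) => // w _; rewrite /T mulrC.
Qed.

Lemma holomorphic_test : holomorphic D T.
Proof. by move=> z /Dzc zc; exact: cdiff_derivable (cdiff_test zc). Qed.

Lemma modulus_dd_test z : D z -> N (dd 1 T z) = N (W z ^+ n.-1 * (z - c) ^- 2).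
Proof. by move=> /Dzc zc; rewrite (cdiff_dd (cdiff_test zc)) modulusN. Qed.

(** W z = (z - zeta) / (d (z - c)) and d (zeta - c) = - d^2, so T vanishes at [zeta] to order n with
    leading coefficient (- d^2)^-n / n. *)
Lemma dd_test : (forall j, (j < n)%N -> dd j T zeta = 0) /\
  N (dd n T zeta) = n.-1`!%:R * N d ^- (2 * n).
Proof.
have oT : order_at T zeta n (1 * (d * (zeta - c))^-1 ^+ n * n%:R^-1).
  apply: (@order_comp _ (fun w => w ^+ n) 0 n 1 W (fun z => (d * (z - c))^-1) (fun=> n%:R^-1) zeta (N d)).
  - by rewrite modulus_gt0.
  - move=> e e0; exists 1 => // z _; rewrite subr0 mul1r subrr modulus0.
    by rewrite mulr_ge0 ?exprn_ge0 ?modulus_ge0 // ltW.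
  - move=> w wd; have wc : w - c != 0.
      rewrite subr_eq0; apply: contraTneq wd => ->.
      by rewrite /c addrC addKr ltxx.
    rewrite subr0 /W /c in wc *; field; by rewrite d0 wc.
  - apply: (ccontV (f := fun w => d * (w - c))).
      by rewrite mulf_neq0 // /c opprD addrA subrr add0r oppr_eq0.
    by apply: ccontM; [exact: ccont_cst|exact: cdiff_ccont (lin _)].
  - exact: ccont_cst.
have [h1 h2] := derive_order oD Dzeta holomorphic_test oT.
split=> [j jn|]; first by rewrite ddE; exact: h1.
rewrite ddE h2 mul1r modulusM !modulus_nat modulusM modulusX modulusV modulusM modulusV modulus_nat.
have -> : N (zeta - c) = N d by rewrite /c opprD addrA subrr add0r modulusN.
rewrite -(prednK n0) factS natrM /= exprM -exprVn -expr2 exprVn.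
by field; rewrite gt_eqF ?exprn_gt0 ?modulus_gt0 // nat1r pnatr_eq0.
Qed.

Variables (mu : R[i] -> R) (hi B M Rb r : R).
Hypotheses (mu_weight : weight D mu) (hi0 : 0 <= hi) (B0 : 0 <= B) (M0 : 0 <= M) (Rb0 : 0 < Rb)
  (r0 : 0 < r) (muB : {ae area R, forall w, region D w -> mu (cplx w) <= B})
  (Db : forall z, D z -> N z < Rb) (DW : forall z, D z -> N (W z) < r)
  (far : forall z, D z -> mu z <= hi \/ N (dd 1 T z) ^+ 2 <= M).

Let S := [set z | z != c /\ N (W z) < r].

(** By [far] and [muB] the integrand is at most hi |T'|^2 + B M almost everywhere on D: the bounds
    of the two cases are added instead of splitting D. The first term is integrated in the
    coordinate W, the second over the disc of radius Rb, which contains D. *)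
Lemma test_energy : AD D mu n zeta T /\
  energy D mu (dd 1 T) <= hi * (pi * r ^+ (2 * n) / n%:R) + B * M * (pi * Rb ^+ 2).
Proof.
have hT' := dd_holomorphic (j := 1) oD holomorphic_test.
have mD := measurable_open oD.
have mrg := measurable_region oD.
have muc0 (w : plane R) : region D w -> 0 <= mu (cplx w).
  by move=> Dw; apply/ltW; exact: (mu_weight.2 _ Dw).
have dT' z : D z -> exists l, cdiff (dd 1 T) z l.
  by move=> Dz; eexists; exact: (derivable_cdiff (hT' z Dz)).
have msq := measurable_sqr oD dT'.
pose h (w : R * R) := hi * N (dd 1 T (cplx w)) ^+ 2 + B * M.
have mh : measurable_fun (preg D) (h : measurableTypeR R * measurableTypeR R -> R).
  by apply: measurable_funD => //; apply: measurable_funM.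
have h0 w : 0 <= h w by apply: addr_ge0; apply: mulr_ge0 => //; exact: sqr_ge0.
have le1 : (L2sq D mu (dd 1 T) <= \int[area R]_(w in region D) (h w)%:E)%E.
  apply: (esq_ae_le mrg mu_weight.1 muc0 (holomorphic_cmeasurable oD hT')
    (measurable_fun_plane mD mh) (fun w _ => h0 w)).
  apply: filterS muB => w hB Dw; rewrite /h.
  have sq0 := sqr_ge0 (N (dd 1 T (cplx w))).
  have BM0 : 0 <= B * M by exact: mulr_ge0.
  have [hhi|hM] := far Dw.
    by apply: (@le_trans _ _ (hi * N (dd 1 T (cplx w)) ^+ 2)); rewrite ?lerDl // mulrC ler_wpM2r.
  apply: (@le_trans _ _ (B * M)); last by rewrite lerDr mulr_ge0.
  by rewrite mulrC; apply: ler_pM => //; [exact: muc0|exact: hB].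
have le2 : (\int[area R]_(w in region D) (h w)%:E <=
    (hi * (pi * r ^+ (2 * n) / n%:R) + B * M * (pi * Rb ^+ 2))%:E)%E.
  rewrite (integral_area mD (f := fun w => (h w)%:E)); last 2 first.
  - exact/measurable_EFinP.
  - by move=> w _; rewrite lee_fin.
  under eq_integral do rewrite EFinD.
  rewrite ge0_integralD //; last 3 first.
  - by move=> w _; rewrite lee_fin mulr_ge0 ?sqr_ge0.
  - by apply/measurable_EFinP; apply: measurable_funM.
  - by move=> w _; rewrite lee_fin mulr_ge0.
  rewrite EFinD; apply: leeD.
    under eq_integral do rewrite EFinM.
    rewrite ge0_integralZl //; last 2 first.
    - exact/measurable_EFinP.
    - by move=> w _; rewrite lee_fin sqr_ge0.
    rewrite EFinM; apply: lee_wpmul2l; first by rewrite lee_fin.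
    have := @mobius_upper R c d^-1 r n.-1 r0.
    have -> : (2 * n.-1 + 2 = 2 * n)%N by rewrite -{2}(prednK n0) mulnS addnC.
    rewrite prednK // => /(le_trans _); apply; apply: le_integral_subset.
    - by move=> w Dw; split; [rewrite -subr_eq0; exact: Dzc|exact: DW].
    - by move=> w Dw; rewrite !lee_fin sqr_ge0 /= modulus_dd_test.
    - by move=> w _; rewrite lee_fin sqr_ge0.
  have E : (\int[mu2]_(w in preg (disc Rb)) 1 = (pi * Rb ^+ 2)%:E)%E.
    have := @disc_monomial R Rb 0 Rb0; rewrite muln0 add0n divr1 => <-.
    by apply: eq_integral => w _; rewrite expr0.
  rewrite [leRHS]EFinM -E -ge0_integralZl //; last 2 first.
  - exact: measurable_disc.
  - by rewrite lee_fin mulr_ge0.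
  apply: le_integral_subset.
  - by move=> w Dw; exact: Db.
  - by move=> w _; rewrite mule1 lexx lee_fin andbT mulr_ge0.
  - by move=> w _; rewrite mule1 lee_fin mulr_ge0.
have fin : (L2sq D mu (dd 1 T) < +oo)%E by apply: le_lt_trans (le_trans le1 le2) (ltry _).
split; first by apply/AD_dd; split; [exact: holomorphic_test|exact: dd_test.1|exact: fin].
by rewrite -lee_fin -(L2sqE oD mu_weight (A2_L2 (A2_intro oD hT' fin))); exact: le_trans le1 le2.
Qed.

End TestFunction.

Section LowerBound.
Context {R : realType}.
Local Notation N := (@modulus R).
Variables (D : set R[i]) (mu : R[i] -> R) (n : nat) (zeta d : R[i]).
Hypotheses (oD : open D) (mu_weight : weight D mu) (Dzeta : D zeta) (n0 : (0 < n)%N) (d0 : d != 0).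

Let c := zeta + d.
Let W z := (z - c)^-1 + d^-1.

(** [mobius_lower] applied to F', which has order n - 1 at [zeta] with leading coefficient 1 / (n -
    1)!. The centre c - d is [zeta], and the weight enters only through its lower bound on the inner
    disc. *)
Lemma energy_lower F (lo r : R) : 0 <= lo -> 0 < r -> r <= N d^-1 ->
  (forall z, N (W z) < r -> D z) -> (forall z, N (W z) < r -> lo <= mu z) ->
  AD D mu n zeta F -> dd n F zeta = 1 ->
  lo * (N d ^+ (4 * n) * pi * r ^+ (2 * n) / n%:R / n.-1`!%:R ^+ 2) <= energy D mu (dd 1 F).
Proof.
move=> lo0 r0 rd WD Wlo /AD_dd[hF F0 finF] F1.
have hF' := dd_holomorphic (j := 1) oD hF.
have dF' z : N (W z) < r -> exists l, cdiff (dd 1 F) z l.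
  by move=> /WD Dz; eexists; exact: (derivable_cdiff (hF' z Dz)).
have ord : order_at (dd 1 F) (c - d^-1^-1) n.-1 (1 / n.-1`!%:R).
  rewrite invrK /c addrK.
  have van j : (j < n.-1)%N -> derive1n j (dd 1 F) zeta = 0.
    by move=> jn; rewrite -ddE -ddSn F0 // -(prednK n0).
  have := taylor_vanish oD Dzeta hF' van.
  by rewrite -ddE -ddSn prednK // F1.
have h1 := @mobius_lower R c d^-1 r r0 rd (dd 1 F) _ n.-1 dF' ord.
have h2 := L2sq_lower mu_weight (@mobius_open R c d^-1 r rd) WD dF' lo0 Wlo.
rewrite (L2sqE oD mu_weight (A2_L2 (A2_intro oD hF' finF))) in h2.
have h3 := le_trans (lee_wpmul2l (_ : (0 <= lo%:E)%E) h1) h2.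
have {}h3 := h3 _; rewrite -EFinM !lee_fin in h3.
apply: le_trans (h3 lo0); apply: ler_wpM2l => //.
have -> : (2 * n.-1 + 2 = 2 * n)%N by rewrite -{2}(prednK n0) mulnS addnC.
rewrite prednK // div1r modulusV modulus_nat modulusV !exprVn invrK.
by rewrite le_eqVlt; apply/orP; left; apply/eqP; ring.
Qed.

End LowerBound.

(** * Tangent discs at a C^2 boundary point *)
Section Taylor.
Context {R : realType}.

(** Stated without an order between x and y, with the intermediate point kept both within d of q and
    no farther from x than y is. *)
Lemma mean_value (f f' : R -> R) (q d x y : R) :
  (forall s, `|s - q| < d -> is_derive s 1 f (f' s)) -> `|x - q| < d -> `|y - q| < d ->
  exists c, [/\ `|c - q| < d, `|c - x| <= `|y - x| & f y - f x = f' c * (y - x)].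
Proof.
move=> df hx hy.
have main (a b : R) : a <= b -> `|a - q| < d -> `|b - q| < d ->
    exists c, [/\ a <= c, c <= b & f b - f a = f' c * (b - a)].
  move=> ab ha hb; have I s : a <= s <= b -> `|s - q| < d.
    by move: ha hb; rewrite !ltr_norml; lra.
  have [s||c] := @MVT_segment _ f f' a b ab.
  - by rewrite in_itv /= => /andP[s1 s2]; apply/df/I; rewrite !ltW.
  - by apply: contseg_within => s /I/df; exact: is_derive_continuous.
  by rewrite in_itv /= => /andP[c1 c2] h; exists c.
have [xy|/ltW yx] := leP x y.
  have [c [c1 c2 h]] := main x y xy hx hy; exists c; split => //.
    by move: hx hy; rewrite !ltr_norml; lra.
  by rewrite !ger0_norm; lra.
have [c [c1 c2 h]] := main y x yx hy hx; exists c; split => //.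
- by move: hx hy; rewrite !ltr_norml; lra.
- by rewrite !ler0_norm; lra.
- by rewrite -[LHS]opprB h -mulrN opprB.
Qed.

Lemma partial1 (rho : R * R -> R) (x y : R) : derivable rho (x, y) ((1, 0) : R * R) ->
  is_derive x 1 (fun s => rho (s, y)) ('D_((1, 0) : R * R) rho (x, y)).
Proof.
have E : (fun h : R => h^-1 *: (rho (h *: ((1, 0) : R * R) + (x, y)) - rho (x, y))) =
    (fun h : R => h^-1 *: (rho (h *: (1 : R) + x, y) - rho (x, y))).
  apply/funext => h; congr (_ *: (rho _ - _)).
  by rewrite -[LHS]/(h *: (1 : R) + x, h *: (0 : R) + y) scaler0 add0r.
by rewrite /derivable /derive E => ?; apply: DeriveDef.
Qed.

Lemma partial2 (rho : R * R -> R) (x y : R) : derivable rho (x, y) ((0, 1) : R * R) ->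
  is_derive y 1 (fun s => rho (x, s)) ('D_((0, 1) : R * R) rho (x, y)).
Proof.
have E : (fun h : R => h^-1 *: (rho (h *: ((0, 1) : R * R) + (x, y)) - rho (x, y))) =
    (fun h : R => h^-1 *: (rho (x, h *: (1 : R) + y) - rho (x, y))).
  apply/funext => h; congr (_ *: (rho _ - _)).
  by rewrite -[LHS]/(h *: (0 : R) + x, h *: (1 : R) + y) scaler0 add0r.
by rewrite /derivable /derive E => ?; apply: DeriveDef.
Qed.

Definition box (q : R * R) (d : R) (w : R * R) := `|w.1 - q.1| < d /\ `|w.2 - q.2| < d.

Lemma nbhs_box (q : R * R) (P : set (R * R)) : nbhs q P ->
  exists2 d : R, 0 < d & forall w, box q d w -> P w.
Proof.
move=> /nbhs_ballP[d /= d0 H]; exists d => // w [w1 w2]; apply: H.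
by split; rewrite /ball /= distrC.
Qed.

Lemma continuous_box (g : R * R -> R) q (e : R) : {for q, continuous g} -> 0 < e ->
  exists2 d : R, 0 < d & forall w, box q d w -> `|g w - g q| < e.
Proof.
move=> /cvgrPdist_lt cg e0; have [d d0 H] := nbhs_box (cg e e0).
by exists d => // w /H; rewrite distrC.
Qed.

Section Expansion.
Variables (rho P1 P2 Q11 Q12 Q22 : R * R -> R) (q : R * R) (d B : R).
Hypotheses (B0 : 0 <= B)
  (d1 : forall x y, box q d (x, y) -> is_derive x 1 (fun s => rho (s, y)) (P1 (x, y)))
  (d2 : forall x y, box q d (x, y) -> is_derive y 1 (fun s => rho (x, s)) (P2 (x, y)))
  (d11 : forall x y, box q d (x, y) -> is_derive x 1 (fun s => P1 (s, y)) (Q11 (x, y)))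
  (d12 : forall x y, box q d (x, y) -> is_derive y 1 (fun s => P1 (x, s)) (Q12 (x, y)))
  (d22 : forall x y, box q d (x, y) -> is_derive y 1 (fun s => P2 (x, s)) (Q22 (x, y)))
  (b11 : forall w, box q d w -> `|Q11 w| <= B)
  (b12 : forall w, box q d w -> `|Q12 w| <= B)
  (b22 : forall w, box q d w -> `|Q22 w| <= B).

(** The path passes through the corner (x, y'), with one mean value on each side. *)
Lemma increment x y x' y' : box q d (x, y) -> box q d (x', y') -> exists c c',
  [/\ box q d (c, y'), box q d (x, c'), `|c - x| <= `|x' - x|, `|c' - y| <= `|y' - y| &
      rho (x', y') - rho (x, y) = P1 (c, y') * (x' - x) + P2 (x, c') * (y' - y)].
Proof.
move=> [/= hx hy] [/= hx' hy'].
have [s hs|c [c1 c2 E1]] := @mean_value (fun s => rho (s, y')) (fun s => P1 (s, y')) q.1 d x x' _ hx hx'.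
  exact: d1.
have [s hs|c' [c'1 c'2 E2]] := @mean_value (fun s => rho (x, s)) (fun s => P2 (x, s)) q.2 d y y' _ hy hy'.
  exact: d2.
exists c, c'; split => //; rewrite -E1 -E2; ring.
Qed.

(** Along that path P1 is displaced in both variables and P2 only in the second, which is why Q11,
    Q12 and Q22 are the second derivatives that occur. *)
Lemma taylor2 x y x' y' : box q d (x, y) -> box q d (x', y') ->
  `|rho (x', y') - rho (x, y) - (P1 (x, y) * (x' - x) + P2 (x, y) * (y' - y))| <=
  B * (`|x' - x| + `|y' - y|) ^+ 2.
Proof.
move=> hw hw'; have [hx hy] := hw; have [hx' hy'] := hw'.
have [c [c' [[/= hc _] [/= _ hc'] cx cy ->]]] := increment hw hw'.
set a := x' - x in cx *; set b := y' - y in cy *.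
have e1 : `|P1 (c, y') - P1 (x, y)| <= B * (`|a| + `|b|).
  have [s hs|s [s1 s2 E1]] := @mean_value (fun s => P1 (s, y')) (fun s => Q11 (s, y')) q.1 d x c _ hx hc.
    exact: d11.
  have [u hu|u [u1 u2 E2]] := @mean_value (fun s => P1 (x, s)) (fun s => Q12 (x, s)) q.2 d y y' _ hy hy'.
    exact: d12.
  have -> : P1 (c, y') - P1 (x, y) = Q11 (s, y') * (c - x) + Q12 (x, u) * b by rewrite -E1 -E2; ring.
  apply: le_trans (ler_normD _ _) _; rewrite !normrM mulrDr; apply: lerD; apply: ler_pM => //.
  - by apply: b11.
  - by apply: b12.
have e2 : `|P2 (x, c') - P2 (x, y)| <= B * `|b|.
  have [u hu|u [u1 u2 E2]] := @mean_value (fun s => P2 (x, s)) (fun s => Q22 (x, s)) q.2 d y c' _ hy hc'.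
    exact: d22.
  by rewrite E2 normrM; apply: ler_pM => //; exact: b22.
have -> : P1 (c, y') * a + P2 (x, c') * b - (P1 (x, y) * a + P2 (x, y) * b) =
  (P1 (c, y') - P1 (x, y)) * a + (P2 (x, c') - P2 (x, y)) * b by ring.
apply: le_trans (ler_normD _ _) _; rewrite !normrM.
have a0 := normr_ge0 a; have b0 := normr_ge0 b.
apply: (@le_trans _ _ (B * (`|a| + `|b|) * `|a| + B * `|b| * `|b|)).
  by apply: lerD; apply: ler_wpM2r.
have -> : B * (`|a| + `|b|) * `|a| + B * `|b| * `|b| = B * ((`|a| + `|b|) * `|a| + `|b| * `|b|) by ring.
by apply: ler_wpM2l => //; nra.
Qed.

End Expansion.
End Taylor.

Section Geometry.
Context {R : realType}.
Local Notation N := (@modulus R).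
Implicit Types (D : set R[i]) (p z zeta : R[i]).

Let pt z : R * R := (complex.Re z, complex.Im z).

Let cplx_pt z : cplx (pt z) = z.
Proof. by apply/eqP; rewrite eq_complex /= !eqxx. Qed.

(** Intended with [G zeta] the gradient of a defining function, read as a complex number, and
    [t zeta] minus its value, both taken at [zeta] itself so as to avoid projecting to the boundary.
    The first inequality describes a disc inside D, the second, for small t, the exterior of a
    disc. *)
Definition tangent_discs D p (R0 L0 Ga ga : R) (G : R[i] -> R[i]) (t : R[i] -> R) :=
  forall zeta, D zeta -> N (zeta - p) < R0 ->
      [/\ 0 < t zeta, t zeta <= Ga * N (zeta - p), ga <= N (G zeta), N (G zeta) <= Ga &
       forall z, N (z - p) < R0 ->
        (complex.Re (conjc (G zeta) * (z - zeta)) + L0 * N (z - zeta) ^+ 2 < t zeta -> D z) /\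
        (D z -> complex.Re (conjc (G zeta) * (z - zeta)) - L0 * N (z - zeta) ^+ 2 < t zeta)].

(** A gradient varying by at most g / 4 in each coordinate keeps its modulus between g / 8 and 4 g,
    with room to spare. The constant 2 B comes from (|a| + |b|)^2 <= 2 (a^2 + b^2). *)
Lemma tangent_discs_of_expansion D p (rho P1 P2 : R * R -> R) (d B g : R) (q := pt p) :
  0 < d -> 0 < B -> 0 < g -> g = `|P1 q| + `|P2 q| ->
  (forall w, box q d w -> [/\ `|P1 w| <= `|P1 q| + g / 4, `|P1 q| <= `|P1 w| + g / 4,
     `|P2 w| <= `|P2 q| + g / 4 & `|P2 q| <= `|P2 w| + g / 4]) ->
  (forall w, box q d w -> (D (cplx w) <-> rho w < 0)) -> ~ D p ->
  (forall x y, box q d (x, y) -> `|rho q - rho (x, y)| <=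
     (`|P1 q| + g / 4) * `|q.1 - x| + (`|P2 q| + g / 4) * `|q.2 - y|) ->
  (forall x y x' y', box q d (x, y) -> box q d (x', y') ->
    `|rho (x', y') - rho (x, y) - (P1 (x, y) * (x' - x) + P2 (x, y) * (y' - y))| <=
    B * (`|x' - x| + `|y' - y|) ^+ 2) ->
  tangent_discs D p d (2 * B) (2 * (g + g)) (g / 8) (fun z => P1 (pt z) +i* P2 (pt z))
    (fun z => - rho (pt z)).
Proof.
move=> d0 B0 g0 gE bP def Dp lip T zeta Dz zp.
have inbox z : N (z - p) < d -> box q d (pt z).
  by move=> h; split; apply: le_lt_trans h; rewrite /= -raddfB; [exact: modulus_Re|exact: modulus_Im].
have hz := inbox _ zp.
have qbox : box q d q by split; rewrite subrr normr0.
have zl : rho (pt zeta) < 0 by apply: (def _ hz).1; rewrite cplx_pt.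
(* p is outside D, so rho is nonnegative there, and - rho(zeta) is at most the increment of rho from
   [zeta] to p, which is linear in |zeta - p|. *)
have ql : 0 <= rho q.
  by rewrite leNgt; apply/negP => /(def _ qbox).2; rewrite cplx_pt.
have [n1 n1' n2 n2'] := bP _ hz.
have NG : N (P1 (pt zeta) +i* P2 (pt zeta)) <= `|P1 (pt zeta)| + `|P2 (pt zeta)|.
  exact: (modulus_le (P1 (pt zeta) +i* P2 (pt zeta))).
have NG1 : `|P1 (pt zeta)| <= N (P1 (pt zeta) +i* P2 (pt zeta)).
  exact: (modulus_Re (P1 (pt zeta) +i* P2 (pt zeta))).
have NG2 : `|P2 (pt zeta)| <= N (P1 (pt zeta) +i* P2 (pt zeta)).
  exact: (modulus_Im (P1 (pt zeta) +i* P2 (pt zeta))).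
split.
- by rewrite oppr_gt0.
- have E := lip _ _ hz.
  have m3 : `|q.1 - complex.Re zeta| <= N (zeta - p).
    by rewrite modulusBC /q /pt /= -raddfB; exact: modulus_Re.
  have m4 : `|q.2 - complex.Im zeta| <= N (zeta - p).
    by rewrite modulusBC /q /pt /= -raddfB; exact: modulus_Im.
  apply: (@le_trans _ _ (rho q - rho (pt zeta))); first by rewrite lerDr.
  apply: le_trans (ler_norm _) _; apply: le_trans E _.
  apply: (@le_trans _ _ ((`|P1 q| + g / 4) * N (zeta - p) + (`|P2 q| + g / 4) * N (zeta - p))).
    by apply: lerD; apply: ler_wpM2l => //; rewrite addr_ge0 // divr_ge0 // ltW.
  rewrite -mulrDl; apply: ler_wpM2r; first exact: modulus_ge0.
  by move: g0; rewrite gE; lra.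
- by move: n1' n2' NG1 NG2 g0; rewrite gE; lra.
- by apply: le_trans NG _; move: n1 n2 g0; rewrite gE; lra.
move=> z zp'; have hz' := inbox _ zp'.
have := T _ _ _ _ hz hz'.
set a := complex.Re z - complex.Re zeta; set b := complex.Im z - complex.Im zeta.
have -> : complex.Re (conjc (P1 (pt zeta) +i* P2 (pt zeta)) * (z - zeta)) = P1 (pt zeta) * a + P2 (pt zeta) * b.
  by rewrite /a /b; case: (z) (zeta) => [x y] [x' y'] /=; ring.
have ab : B * (`|a| + `|b|) ^+ 2 <= 2 * B * N (z - zeta) ^+ 2.
  rewrite modulus_sqr !raddfB -/a -/b -[a ^+ 2]real_normK ?num_real // -[b ^+ 2]real_normK ?num_real //.
  rewrite (_ : 2 * B * _ = B * (2 * (`|a| ^+ 2 + `|b| ^+ 2))); last by ring.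
  apply: ler_wpM2l; first exact: ltW.
  by have := sqr_ge0 (`|a| - `|b|); nra.
rewrite -/(pt z) -/(pt zeta) ler_norml => /andP[l1 l2].
split=> [h|Dz'].
  by rewrite -(cplx_pt z); apply: (def _ hz').2; move: h l2 ab; lra.
have : rho (pt z) < 0 by apply: (def _ hz').1; rewrite cplx_pt.
by move: l1 ab; lra.
Qed.

Lemma C2_tangent_discs D p : open D -> boundary D p -> C2_boundary_near D p ->
  exists (R0 L0 Ga ga : R) (G : R[i] -> R[i]) (t : R[i] -> R),
    [/\ 0 < R0, 0 < L0, 0 < Ga, 0 < ga & tangent_discs D p R0 L0 Ga ga G t].
Proof.
move=> oD [_ nD] [U [rho [oU Up [c1 c2 c3] grad def]]].
have Dp : ~ D p by move=> Dp; apply: nD; rewrite ((interior_id D).1 oD).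
set P1 := 'D_((1, 0) : R * R) rho in c2 grad; set P2 := 'D_((0, 1) : R * R) rho in c3 grad.
pose q := pt p.
pose Q11 := 'D_((1, 0) : R * R) P1; pose Q12 := 'D_((0, 1) : R * R) P1.
pose Q22 := 'D_((0, 1) : R * R) P2.
have or1 : ((1, 0) : R * R) = (1, 0) \/ ((1, 0) : R * R) = (0, 1) by left.
have or2 : ((0, 1) : R * R) = (1, 0) \/ ((0, 1) : R * R) = (0, 1) by right.
pose g := `|P1 q| + `|P2 q|.
have g0 : 0 < g.
  rewrite /g; have [/eqP h|/eqP h] := grad _ Up.
    by apply: ltr_wpDr => //; rewrite normr_gt0.
  by apply: ltr_wpDl => //; rewrite normr_gt0.
have g8 : 0 < g / 4 by rewrite divr_gt0.
have [dU dU0 HU] := nbhs_box (open_nbhs_nbhs (conj oU Up)).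
have [e1 e10 H1] := continuous_box (c1 _ or1 _ Up).2 g8.
have [e2 e20 H2] := continuous_box (c1 _ or2 _ Up).2 g8.
have [e3 e30 H3] := continuous_box (c2 _ or1 _ Up).2 ltr01.
have [e4 e40 H4] := continuous_box (c2 _ or2 _ Up).2 ltr01.
have [e5 e50 H5] := continuous_box (c3 _ or2 _ Up).2 ltr01.
pose d := Num.min dU (Num.min (Num.min e1 e2) (Num.min e3 (Num.min e4 e5))).
have d0 : 0 < d by rewrite !lt_min dU0 e10 e20 e30 e40 e50.
have sub w : box q d w -> [/\ U w, `|P1 w - P1 q| < g / 4, `|P2 w - P2 q| < g / 4 &
    [/\ `|Q11 w - Q11 q| < 1, `|Q12 w - Q12 q| < 1 & `|Q22 w - Q22 q| < 1]].
  move=> [h1 h2]; have h e : d <= e -> box q e w by move=> de; split; exact: lt_le_trans de.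
  have [m1 [m2 [m3 [m4 [m5 m6]]]]] : d <= dU /\ d <= e1 /\ d <= e2 /\ d <= e3 /\ d <= e4 /\ d <= e5.
    by rewrite /d !ge_min !lexx !orbT.
  by split; [exact/HU/h|exact/H1/h|exact/H2/h|split; [exact/H3/h|exact/H4/h|exact/H5/h]].
pose B := `|Q11 q| + `|Q12 q| + `|Q22 q| + 1.
have B0 : 0 < B by rewrite ltr_wpDl // !addr_ge0.
have near1 (x y e : R) : `|x - y| < e -> `|x| <= `|y| + e.
  move=> h; rewrite -[x](subrK y); apply: le_trans (ler_normD _ _) _.
  by rewrite addrC lerD2l ltW.
have D1 x y : box q d (x, y) -> is_derive x 1 (fun s => rho (s, y)) (P1 (x, y)).
  by move=> /sub[Uw _ _ _]; apply: partial1; exact: (c1 _ or1 _ Uw).1.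
have D2 x y : box q d (x, y) -> is_derive y 1 (fun s => rho (x, s)) (P2 (x, y)).
  by move=> /sub[Uw _ _ _]; apply: partial2; exact: (c1 _ or2 _ Uw).1.
have D11 x y : box q d (x, y) -> is_derive x 1 (fun s => P1 (s, y)) (Q11 (x, y)).
  by move=> /sub[Uw _ _ _]; apply: partial1; exact: (c2 _ or1 _ Uw).1.
have D12 x y : box q d (x, y) -> is_derive y 1 (fun s => P1 (x, s)) (Q12 (x, y)).
  by move=> /sub[Uw _ _ _]; apply: partial2; exact: (c2 _ or2 _ Uw).1.
have D22 x y : box q d (x, y) -> is_derive y 1 (fun s => P2 (x, s)) (Q22 (x, y)).
  by move=> /sub[Uw _ _ _]; apply: partial2; exact: (c3 _ or2 _ Uw).1.
have b11 w : box q d w -> `|Q11 w| <= B.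
  move=> /sub[_ _ _ [h _ _]]; apply: le_trans (near1 _ _ _ h) _; rewrite /B lerD2r.
  by rewrite -addrA lerDl addr_ge0.
have b12 w : box q d w -> `|Q12 w| <= B.
  move=> /sub[_ _ _ [_ h _]]; apply: le_trans (near1 _ _ _ h) _; rewrite /B lerD2r.
  by rewrite addrAC lerDr addr_ge0.
have b22 w : box q d w -> `|Q22 w| <= B.
  by move=> /sub[_ _ _ [_ _ h]]; apply: le_trans (near1 _ _ _ h) _; rewrite /B lerD2r lerDr addr_ge0.
have T := taylor2 (ltW B0) D1 D2 D11 D12 D22 b11 b12 b22.
have gg : 0 < g + g by rewrite addr_gt0.
have qbox : box q d q by split; rewrite subrr normr0.
have bP w : box q d w -> [/\ `|P1 w| <= `|P1 q| + g / 4, `|P1 q| <= `|P1 w| + g / 4,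
     `|P2 w| <= `|P2 q| + g / 4 & `|P2 q| <= `|P2 w| + g / 4].
  move=> /sub[_ h1 h2 _]; split; [exact: near1 h1| |exact: near1 h2|].
    by rewrite distrC in h1; exact: near1 h1.
  by rewrite distrC in h2; exact: near1 h2.
have lip x y : box q d (x, y) -> `|rho q - rho (x, y)| <=
     (`|P1 q| + g / 4) * `|q.1 - x| + (`|P2 q| + g / 4) * `|q.2 - y|.
  move=> hw; have [c [c' [k1 k2 _ _ E]]] := increment D1 D2 hw qbox.
  have -> : rho q - rho (x, y) = P1 (c, q.2) * (q.1 - x) + P2 (x, c') * (q.2 - y) by rewrite -E.
  apply: le_trans (ler_normD _ _) _; rewrite !normrM.
  have [m1 _ _ _] := bP _ k1; have [_ _ m2 _] := bP _ k2.
  apply: lerD; first exact: (ler_wpM2r (normr_ge0 _) m1).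
  exact: (ler_wpM2r (normr_ge0 _) m2).
have defw w : box q d w -> (D (cplx w) <-> rho w < 0) by move=> /sub[/def].
have := tangent_discs_of_expansion d0 B0 g0 (erefl _) bP defw Dp lip T.
move=> H; exists d, (2 * B), (2 * (g + g)), (g / 8); do 2 eexists; split; last exact: H.
- exact: d0.
- exact: mulr_gt0.
- exact: mulr_gt0.
- exact: divr_gt0.
Qed.

(** [d] is the mirror image of 0 in the line Re (conj G v) = t, and |v - d|^2 = |v|^2 + (4 t /
    |G|^2) (t - Re (conj G v)). As the transformed point has modulus |v| / (|v - d| |d|), both
    tangent discs become conditions on this modulus alone; [la] is 4 t / |G|^2 times L. *)
Lemma mobius_disc (G v : R[i]) (t L : R) : G != 0 -> 0 < t -> 0 < L ->
  let d := (2 * t / N G ^+ 2)%:C * G in let la := 4 * L * t / N G ^+ 2 in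
  [/\ d != 0, N d = 2 * t / N G, 0 < la & v != d ->
   (N ((v - d)^-1 + d^-1) ^+ 2 < N d^-1 ^+ 2 / (1 + la) <->
      complex.Re (conjc G * v) + L * N v ^+ 2 < t) /\
   (la < 1 -> complex.Re (conjc G * v) - L * N v ^+ 2 < t ->
      N ((v - d)^-1 + d^-1) ^+ 2 < N d^-1 ^+ 2 / (1 - la))].
Proof.
move=> G0 t0 L0 d la; have NG : 0 < N G by rewrite modulus_gt0.
have NG2 : 0 < N G ^+ 2 by rewrite exprn_gt0.
have k0 : 0 < 2 * t / N G ^+ 2 by rewrite divr_gt0 ?mulr_gt0.
have d0 : d != 0 by rewrite mulf_neq0 // eq_complex /= gt_eqF.
have la0 : 0 < la by rewrite divr_gt0 ?mulr_gt0.
have Nd : N d = 2 * t / N G.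
  by rewrite modulusM modulus_real gtr0_norm //; field; rewrite gt_eqF.
split => // vd; have vd0 : v - d != 0 by rewrite subr_eq0.
have E : (v - d)^-1 + d^-1 = v / ((v - d) * d) by field; rewrite vd0 d0.
have NE : N ((v - d)^-1 + d^-1) ^+ 2 = N d^-1 ^+ 2 * (N v ^+ 2 / N (v - d) ^+ 2).
  by rewrite E modulusM !modulusV modulusM; field; rewrite ?gt_eqF ?modulus_gt0.
have w0 : 0 < N (v - d) ^+ 2 by rewrite exprn_gt0 // modulus_gt0.
have D0 : 0 < N d^-1 ^+ 2 by rewrite exprn_gt0 // modulus_gt0 invr_eq0.
set X := complex.Re (conjc G * v).
have key : N (v - d) ^+ 2 = N v ^+ 2 + 4 * t / N G ^+ 2 * (t - X).
  rewrite /d /X !modulus_sqr; have := NG2; rewrite modulus_sqr; case: (G) (v) => [x y] [a b] /= h.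
  by field; rewrite gt_eqF.
have kk : 0 < 4 * t / N G ^+ 2 by rewrite divr_gt0 ?mulr_gt0.
have laE : la = 4 * t / N G ^+ 2 * L by rewrite /la; ring.
rewrite NE; split.
  rewrite ltr_pM2l // ltr_pdivrMr // mulrC ltr_pdivlMr ?addr_gt0 // key laE.
  set k := 4 * t / N G ^+ 2 in kk *; set V := N v ^+ 2.
  have -> : (V * (1 + k * L) < V + k * (t - X)) = (k * (X + L * V) < k * t).
    by apply/idP/idP; nra.
  by rewrite ltr_pM2l.
move=> la1 h; rewrite ltr_pM2l // ltr_pdivrMr // mulrC ltr_pdivlMr ?subr_gt0 // key laE.
set k := 4 * t / N G ^+ 2 in kk *; set V := N v ^+ 2 in h *.
have : k * (X - L * V) < k * t by rewrite ltr_pM2l.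
by nra.
Qed.

End Geometry.

(** * Asymptotics at the boundary *)
Lemma energy_dd_scale (R : realType) (D : set R[i]) (mu : R[i] -> R) n zeta f (c : R[i]) :
  open D -> weight D mu -> V D mu n zeta f ->
  energy D mu (dd 1 (fun z => c * f z)) = modulus c ^+ 2 * energy D mu (dd 1 f).
Proof.
move=> oD mw Vf; have [hf _ _] := Vf.
rewrite (@energy_eq _ D mu _ (fun z => c * dd 1 f z)).
  by rewrite (energy_scale oD mw c (A2_L2 (AD_A2 oD Vf))).
by move=> z Dz; exact: (cdiff_dd (cdiffZ c (dd_cdiff hf Dz))).
Qed.

Lemma pow_one_plus (R : realType) (y : R) n : 0 <= y <= 1 -> (1 + y) ^+ n <= 1 + 3 ^+ n * y.
Proof.
move=> /andP[y0 y1]; elim: n => [|n IH]; first by rewrite !expr0; lra.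
have h3 : 1 <= 3 ^+ n :> R by rewrite exprn_ege1 // ler1n.
rewrite exprS; apply: (@le_trans _ _ ((1 + y) * (1 + 3 ^+ n * y))).
  by apply: ler_wpM2l => //; rewrite addr_ge0.
rewrite (exprS 3); move: (3 ^+ n : R) h3 => k k1.
have h1 : k * y * y <= k * y by apply: ler_piMr => //; apply: mulr_ge0 => //; lra.
have h2 : y <= k * y by apply: ler_peMl.
have -> : (1 + y) * (1 + k * y) = 1 + y + k * y + k * y * y by ring.
have -> : 1 + 3 * k * y = 1 + k * y + k * y + k * y by ring.
by rewrite lerD // lerD // lerD.
Qed.

Section Asymptotics.
Context {R : realType}.
Local Notation N := (@modulus R).
Variables (D : set R[i]) (p : R[i]) (n : nat) (R0 L0 Ga ga Rb : R) (G : R[i] -> R[i]) (t : R[i] -> R).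
Hypotheses (oD : open D) (cD : connected D) (n0 : (0 < n)%N) (R00 : 0 < R0) (L00 : 0 < L0)
  (Ga0 : 0 < Ga) (ga0 : 0 < ga) (Rb0 : 0 < Rb) (Db : forall z, D z -> N z < Rb)
  (discs : tangent_discs D p R0 L0 Ga ga G t).

Let W zeta d z : R[i] := (z - (zeta + d))^-1 + d^-1.

(* D is squeezed near p between two discs, which become round discs centred at
   0 with radii of ratio tending to 1 in the coordinate W. *)
Lemma squeeze (eta theta : R) : 0 < eta -> eta <= R0 -> 0 < theta -> theta <= 1 / 4 -> theta <= eta / 4 ->
  exists2 de : R, 0 < de & forall zeta, D zeta -> N (zeta - p) < de ->
    exists d la, [/\ d != 0, N d <= theta, 0 < la <= theta, ~ D (zeta + d) &
      [/\ forall z, D z -> N (W zeta d z) < N d^-1 / Num.sqrt (1 - la),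
        forall z, N (W zeta d z) < N d^-1 / Num.sqrt (1 + la) -> D z /\ N (z - p) < eta &
        N (zeta + d - p) <= eta / 2]].
Proof.
move=> eta0 etaR th0 th4 the.
(* L0 serves near p. The second term extends the outer inequality to the points of D at distance at
   least R0 / 2 from [zeta], and the third confines the inner disc to |z - zeta| < eta / 2. *)
pose L := L0 + 2 * Ga / R0 + 4 * Ga / eta.
have [a1 a2] : 0 < 2 * Ga / R0 /\ 0 < 4 * Ga / eta by split; rewrite divr_gt0 ?mulr_gt0.
have [L_gt0 LL0 L1 L2'] : [/\ 0 < L, L0 <= L, 2 * Ga / R0 <= L & 4 * Ga / eta <= L].
  rewrite /L; move: (2 * Ga / R0) (4 * Ga / eta) a1 a2 L00 => x y x0 y0 L0_gt.
  by split; lra.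
(* |d| and [la] are at most the two summands times |zeta - p|, so both fall below [theta] once |zeta
   - p| < theta / K. *)
pose K := 2 * Ga / ga + 4 * L * Ga / ga ^+ 2.
have [b1 b2] : 0 < 2 * Ga / ga /\ 0 < 4 * L * Ga / ga ^+ 2.
  by split; rewrite divr_gt0 ?mulr_gt0 ?exprn_gt0.
have K0 : 0 < K by rewrite addr_gt0.
exists (Num.min (Num.min (R0 / 2) (eta / 4)) (theta / K)); first by rewrite !lt_min !divr_gt0.
move=> zeta Dz; rewrite !lt_min => /andP[/andP[h1 h2] h3].
set h := N (zeta - p) in h1 h2 h3.
have hp : 0 <= h by exact: modulus_ge0.
have zR : N (zeta - p) < R0 by rewrite -/h; lra.
have [t0 tG gG Gg loc] := discs Dz zR.
set g := G zeta in gG Gg loc; set s := t zeta in t0 tG loc.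
have g0 : 0 < N g by exact: lt_le_trans gG.
have g_neq0 : g != 0 by rewrite -modulus_gt0.
pose d : R[i] := (2 * s / N g ^+ 2)%:C * g; pose la := 4 * L * s / N g ^+ 2.
have MD := fun v => mobius_disc v g_neq0 t0 L_gt0.
have [d0 Nd la0 _] := MD 0; rewrite -/d -/la in d0 Nd la0.
have hK : h * K < theta by rewrite -ltr_pdivlMr.
have hE : h * K = 2 * Ga * h / ga + 4 * L * (Ga * h) / ga ^+ 2 by rewrite /K; ring.
have Nd1 : N d <= 2 * Ga * h / ga.
  rewrite Nd; apply: ler_pM; rewrite ?mulr_ge0 ?invr_ge0 ?(ltW t0) ?(ltW g0) //.
    by rewrite -mulrA ler_wpM2l.
  by rewrite lef_pV2 ?posrE.
have la1 : la <= 4 * L * (Ga * h) / ga ^+ 2.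
  rewrite /la; apply: ler_pM; rewrite ?mulr_ge0 ?invr_ge0 ?exprn_ge0 ?(ltW t0) ?(ltW g0) ?(ltW L_gt0) //.
    by rewrite ler_wpM2l // mulr_ge0 // ltW.
  rewrite lef_pV2 ?posrE ?exprn_gt0 // ler_sqr ?nnegrE //; exact: ltW.
have [c1 c2] : 0 <= 2 * Ga * h / ga /\ 0 <= 4 * L * (Ga * h) / ga ^+ 2.
  by split; rewrite divr_ge0 ?mulr_ge0 ?exprn_ge0 ?(ltW Ga0) ?(ltW L_gt0) ?(ltW ga0).
have Ndth : N d <= theta by lra.
have lath : la <= theta by lra.
have vE z : z - (zeta + d) = (z - zeta) - d by ring.
have Re_le v : `|complex.Re (conjc g * v)| <= Ga * N v.
  apply: le_trans (modulus_Re _) _; rewrite modulusM modulus_conj.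
  by apply: ler_wpM2r => //; exact: modulus_ge0.
have Dext z : D z -> complex.Re (conjc g * (z - zeta)) - L * N (z - zeta) ^+ 2 < s.
  move=> Dz'; have [zpR|zpR] := ltP (N (z - p)) R0.
    have [_ /(_ Dz')] := loc z zpR; apply: le_lt_trans.
    by rewrite lerD2l lerN2; apply: ler_wpM2r => //; exact: sqr_ge0.
  have vR : R0 / 2 <= N (z - zeta).
    have := modulus_dist (z - p) (zeta - p); have -> : z - p - (zeta - p) = z - zeta by ring.
    rewrite -/h; lra.
  have := Re_le (z - zeta); rewrite ler_norml => /andP[_ h4].
  set v := N (z - zeta) in vR h4 *.
  have h5 : Ga * v <= L * v ^+ 2.
    apply: (@le_trans _ _ (2 * Ga / R0 * v ^+ 2)); last by apply: ler_wpM2r => //; exact: sqr_ge0.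
    rewrite expr2 mulrA; apply: ler_wpM2r; first exact: modulus_ge0.
    rewrite [leLHS](_ : Ga = 2 * Ga / R0 * (R0 / 2)); last by field; rewrite gt_eqF.
    by apply: ler_wpM2l => //; rewrite ltW.
  by move: t0 h4 h5; lra.
exists d, la; split => //.
- by rewrite la0.
(* At the pole c the linear form equals 2 s while the quadratic term is only la s < s, so the outer
   inequality fails there. *)
- move=> /Dext; rewrite addrAC subrr add0r.
  have -> : complex.Re (conjc g * d) = 2 * s.
    have := g0; rewrite /d modulus_sqr => _; have := exprn_gt0 2 g0; rewrite modulus_sqr.
    by case: (g) => x y /= h4; field; rewrite gt_eqF.
  have -> : L * N d ^+ 2 = la * s by rewrite Nd /la; field; rewrite gt_eqF.
  by apply/negP; rewrite -leNgt; move: lath th4 t0; nra.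
have N0 : 0 < N d^-1 by rewrite modulus_gt0 invr_eq0.
have sq_lt (x k : R) : 0 <= x -> 0 < k -> (x < N d^-1 / Num.sqrt k) = (x ^+ 2 < N d^-1 ^+ 2 / k).
  move=> x0 k0; rewrite -[in RHS](sqr_sqrtr (ltW k0)) -expr_div_n ltr_sqr ?nnegrE //.
  by rewrite divr_ge0 ?sqrtr_ge0 // ltW.
have la_1 : la < 1 by lra.
split.
- move=> z Dz'; have vd : z - zeta != d.
    apply/eqP => h4; have := Dext _ Dz'; rewrite h4.
    have -> : complex.Re (conjc g * d) = 2 * s.
      have := exprn_gt0 2 g0; rewrite /d modulus_sqr.
      by case: (g) => x y /= h5; field; rewrite gt_eqF.
    have -> : L * N d ^+ 2 = la * s by rewrite Nd /la; field; rewrite gt_eqF.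
    by apply/negP; rewrite -leNgt; move: lath th4 t0; nra.
  rewrite /W vE sq_lt ?modulus_ge0 ?subr_gt0 //.
  have [_ _ _ /(_ vd)[_]] := MD (z - zeta); rewrite -/d -/la; apply => //.
  exact: Dext.
- move=> z; rewrite /W vE.
  (* At the pole, W takes the value d^-1 by the convention on inverses, too large for the inner
     disc. *)
  have [->|vd] := eqVneq (z - zeta) d.
    rewrite subrr invr0 add0r sq_lt ?(ltW N0) ?addr_gt0 // ltr_pdivlMr ?addr_gt0 // => h4.
    by have := exprn_gt0 2 N0; move: h4 la0; nra.
  rewrite sq_lt ?modulus_ge0 ?addr_gt0 // => h4.
  have [_ _ _ /(_ vd)[h5 _]] := MD (z - zeta); rewrite -/d -/la in h5.
  have {h4}h4 := h5.1 h4.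
  have v2 : N (z - zeta) < eta / 2.
    (* For |z - zeta| >= eta / 2 the linear form offsets at most half of the quadratic term, and the
       other half is at least Ga eta / 4 >= s. *)
    rewrite ltNge; apply/negP => ve.
    have := Re_le (z - zeta); rewrite ler_norml => /andP[h6 _].
    set v := N (z - zeta) in ve h4 h6.
    have h7 : 4 * Ga / eta * v ^+ 2 <= L * v ^+ 2 by apply: ler_wpM2r => //; exact: sqr_ge0.
    have h8 : Ga * v <= 2 * Ga / eta * v ^+ 2.
      rewrite expr2 mulrA; apply: ler_wpM2r; first exact: modulus_ge0.
      rewrite [leLHS](_ : Ga = 2 * Ga / eta * (eta / 2)); last by field; rewrite gt_eqF.
      by apply: ler_wpM2l ve; rewrite divr_ge0 ?mulr_ge0 ?(ltW Ga0) ?(ltW eta0).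
    have h9 : Ga * (eta / 4) <= 2 * Ga / eta * v ^+ 2.
      apply: le_trans h8; apply: ler_wpM2l; first exact: ltW.
      by move: ve eta0; lra.
    have h10 : s <= Ga * (eta / 4).
      by apply: le_trans tG _; apply: ler_wpM2l; rewrite ltW.
    have h11 : 4 * Ga / eta * v ^+ 2 = 2 * Ga / eta * v ^+ 2 + 2 * Ga / eta * v ^+ 2 by field; rewrite gt_eqF.
    by move: h4 h6 h7 h8 h9 h10; rewrite h11; lra.
  have zpe : N (z - p) < eta.
    have -> : z - p = (z - zeta) + (zeta - p) by ring.
    by apply: le_lt_trans (modulusD _ _) _; move: v2; rewrite -/h; lra.
  split => //; have [+ _] := loc z (lt_le_trans zpe etaR); apply; apply: le_lt_trans h4.
  by rewrite lerD2l; apply: ler_wpM2r => //; exact: sqr_ge0.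
- have -> : zeta + d - p = (zeta - p) + d by ring.
  by apply: le_trans (modulusD _ _) _; rewrite -/h; move: Ndth h2 the; lra.
Qed.

End Asymptotics.

(** The quotient of the radii contributes ((1 + la) / (1 - la))^n. The far term carries one factor
    r^2 less than the main one, which makes it relatively of size u^2 with u = |d|. The first line
    of the right-hand side is the number [x] of [kernel_asymptotics]. *)
Lemma test_ratio (R : realType) (u la A B k Rb : R) n : 0 < u -> 0 < la < 1 -> (0 < n)%N ->
  let r := u^-1 / Num.sqrt (1 - la) in let ri := u^-1 / Num.sqrt (1 + la) in
  (A * (pi * r ^+ (2 * n) / n%:R) + B * (r ^+ n.-1 * k) ^+ 2 * (pi * Rb ^+ 2)) /
    (n.-1`!%:R * u ^- (2 * n)) ^+ 2 =
  u ^+ (4 * n) * pi * ri ^+ (2 * n) / n%:R / n.-1`!%:R ^+ 2 *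
    (((1 + la) / (1 - la)) ^+ n * (A + B * k ^+ 2 * Rb ^+ 2 * n%:R * (u ^+ 2 * (1 - la)))).
Proof.
move=> u0 /andP[la0 la1] n0 r ri.
have q0 : 0 < 1 - la by rewrite subr_gt0.
have q0' : 0 < 1 + la by rewrite addr_gt0.
have r2 : r ^+ 2 = u^-1 ^+ 2 / (1 - la) by rewrite expr_div_n sqr_sqrtr // ltW.
have ri2 : ri ^+ 2 = u^-1 ^+ 2 / (1 + la) by rewrite expr_div_n sqr_sqrtr // ltW.
have f0 : n.-1`!%:R != 0 :> R by rewrite pnatr_eq0 -lt0n fact_gt0.
have nn0 : n%:R != 0 :> R by rewrite pnatr_eq0 -lt0n.
have u4 : u ^+ (4 * n) = (u ^+ (2 * n)) ^+ 2 by rewrite -exprM mulnAC.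
have U0 : u ^+ (2 * n) != 0 by rewrite expf_neq0 // gt_eqF.
have -> : r ^+ (2 * n) = (r ^+ n.-1) ^+ 2 * (u^-1 ^+ 2 / (1 - la)).
  by rewrite -{1}(prednK n0) mulnS exprD mulrC r2 (mulnC 2%N) exprM.
have h : ri ^+ (2 * n) * ((1 + la) / (1 - la)) ^+ n = (r ^+ n.-1) ^+ 2 * (u^-1 ^+ 2 / (1 - la)).
  rewrite -r2 exprM ri2 -exprMn -(exprM r) mulnC (exprM r) -exprSr prednK // r2; congr (_ ^+ n).
  by field; rewrite !gt_eqF.
rewrite [RHS](_ : _ = u ^+ (4 * n) * pi / n%:R / n.-1`!%:R ^+ 2 *
  (ri ^+ (2 * n) * ((1 + la) / (1 - la)) ^+ n) *
  (A + B * k ^+ 2 * Rb ^+ 2 * n%:R * (u ^+ 2 * (1 - la)))); last by ring.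
rewrite h u4; move: (u ^+ (2 * n)) (r ^+ n.-1) f0 U0 nn0 => U P; move: (n.-1`!%:R : R) (n%:R : R) => x y x0 U0 y0.
field.
by rewrite (gt_eqF q0) (gt_eqF u0) x0 y0 U0.
Qed.

(** Half of the additional [eps] pays for the far term and half for the power, which is at most 1 +
    4 3^n th because (1 + la) / (1 - la) <= 1 + 4 th for th <= 1 / 4. *)
Lemma ratio_bound (R : realType) (u la th a B C eps : R) n : 0 <= u -> u <= th -> 0 < la -> la <= th ->
  th <= 1 / 4 -> 0 < a -> a <= B -> 0 <= C -> 0 < eps ->
  th <= eps / (2 * (4 * 3 ^+ n) * (B + 2 * eps)) -> th <= eps / (2 * (C + 1)) ->
  ((1 + la) / (1 - la)) ^+ n * (a + eps + C * (u ^+ 2 * (1 - la))) <= a + 2 * eps.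
Proof.
move=> u0 uth la0 lath th4 a0 aB C0 eps0.
have k0 : 0 < 4 * 3 ^+ n :> R by rewrite mulr_gt0 ?exprn_gt0.
have Be : 0 < B + 2 * eps by lra.
have C1 : 0 < C + 1 by lra.
rewrite !ler_pdivlMr ?mulr_gt0 // => h1 h2.
have q0 : 0 < 1 - la by lra.
have h3 : ((1 + la) / (1 - la)) ^+ n <= 1 + 4 * 3 ^+ n * th.
  apply: (@le_trans _ _ ((1 + 4 * th) ^+ n)); last first.
    by have := @pow_one_plus R (4 * th) n; rewrite (mulrC 4 (3 ^+ n)) -mulrA; apply; lra.
  apply: lerXn2r; rewrite ?nnegrE ?divr_ge0 ?ler_pdivrMr //; try lra.
  by nra.
have h4 : C * (u ^+ 2 * (1 - la)) <= eps / 2.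
  have h5 : u ^+ 2 * (1 - la) <= th by nra.
  apply: (le_trans (ler_wpM2l C0 h5)); nra.
have h5 : 0 <= 1 + 4 * 3 ^+ n * th by rewrite addr_ge0 ?mulr_ge0 ?(ltW k0) //; lra.
apply: (@le_trans _ _ ((1 + 4 * 3 ^+ n * th) * (a + eps + eps / 2))).
  apply: ler_pM => //; first by rewrite exprn_ge0 // divr_ge0 //; lra.
    by rewrite addr_ge0 ?mulr_ge0 ?sqr_ge0 //; lra.
  by rewrite lerD2l.
move: (4 * 3 ^+ n : R) k0 h1 => k k0 h1.
have th0 : 0 < th by lra.
have kth : 0 < k * th by rewrite mulr_gt0.
have : k * th * (a + eps + eps / 2) <= k * th * (B + 2 * eps).
  by rewrite ler_wpM2l ?(ltW kth) //; lra.
have h6 : th * (2 * k * (B + 2 * eps)) = 2 * (k * th * (B + 2 * eps)) by ring.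
move: h1; rewrite h6 [(1 + k * th) * _]mulrDl mul1r.
move: (k * th * (a + eps + eps / 2)) (k * th * (B + 2 * eps)); clear -eps0 => *; lra.
Qed.

Section Asymptotics.
Context {R : realType}.
Local Notation N := (@modulus R).
Variables (D : set R[i]) (p : R[i]) (n : nat) (R0 L0 Ga ga Rb : R) (G : R[i] -> R[i]) (t : R[i] -> R).
Hypotheses (oD : open D) (cD : connected D) (n0 : (0 < n)%N) (R00 : 0 < R0) (L00 : 0 < L0)
  (Ga0 : 0 < Ga) (ga0 : 0 < ga) (Rb0 : 0 < Rb) (Db : forall z, D z -> N z < Rb)
  (discs : tangent_discs D p R0 L0 Ga ga G t).

(** The order of quantifiers matters: [x] is chosen before the weight, so that [nu] and the constant
    weight are compared with the same number, the extremal energy of the inner disc for weight 1. *)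
Lemma kernel_asymptotics (eta B eps : R) : 0 < eta -> eta <= R0 -> 0 <= B -> 0 < eps ->
  exists2 de : R, 0 < de & forall zeta, D zeta -> N (zeta - p) < de ->
    exists2 x : R, 0 < x & forall (mu : R[i] -> R) (a : R), weight D mu ->
      (forall z, D z -> eval_loc_bounded D mu z) -> A2_complete D mu ->
      {ae area R, forall w, region D w -> mu (cplx w) <= B} -> eps < a -> a <= B ->
      (forall z, D z -> N (z - p) < eta -> `|mu z - a| <= eps) ->
      exists m : R, [/\ 0 < m, reduced_kernel_deriv D mu n n.-1 zeta zeta = (m^-1)%:C,
        (a - eps) * x <= m & m <= (a + 2 * eps) * x].
Proof.
move=> eta0 etaR B0 eps0.
(* The pole c is within eta / 2 of p, so |z - c|^-2 <= k whenever |z - p| >= eta. [C] collects what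
   multiplies u^2 (1 - la) in the far term of [test_ratio]. *)
pose k : R := (2 / eta) ^+ 2; pose C := B * k ^+ 2 * Rb ^+ 2 * n%:R.
pose k4 : R := 4 * 3 ^+ n.
have C0 : 0 <= C by exact: (mulr_ge0 (mulr_ge0 (mulr_ge0 B0 (sqr_ge0 k)) (sqr_ge0 Rb)) (ler0n _ n)).
have k40 : 0 < k4 by rewrite mulr_gt0 ?exprn_gt0.
(* The two smallness conditions that [ratio_bound] imposes on [theta]. *)
pose th1 := eps / (2 * k4 * (B + 2 * eps)); pose th2 := eps / (2 * (C + 1)).
have Be0 : 0 < B + 2 * eps by move: B0 eps0; lra.
have th10 : 0 < th1 by rewrite divr_gt0 ?mulr_gt0.
have th20 : 0 < th2 by rewrite divr_gt0 // mulr_gt0 // ltr_wpDl.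
pose theta := Num.min (Num.min (1 / 4) (eta / 4)) (Num.min th1 th2).
have th0 : 0 < theta by rewrite !lt_min th10 th20 !divr_gt0.
have [[tha thb] [thc thd]] : (theta <= 1 / 4 /\ theta <= eta / 4) /\ (theta <= th1 /\ theta <= th2).
  by rewrite /theta !ge_min !lexx !orbT.
have [de de0 Hde] := squeeze R00 L00 Ga0 ga0 discs eta0 etaR th0 tha thb.
exists de => // zeta Dz zde.
have [d [la [d0 Nd /andP[la0 lath] nDc [DW Win cp]]]] := Hde zeta Dz zde.
have u0 : 0 < N d by rewrite modulus_gt0.
have la1 : la < 1 by move: lath tha; lra.
set u := N d in Nd u0.
have NV : N d^-1 = u^-1 by rewrite modulusV.
rewrite NV in DW Win.
pose r := u^-1 / Num.sqrt (1 - la); pose ri := u^-1 / Num.sqrt (1 + la).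
have r0 : 0 < r by rewrite divr_gt0 ?invr_gt0 // sqrtr_gt0 subr_gt0.
have ri0 : 0 < ri by rewrite divr_gt0 ?invr_gt0 // sqrtr_gt0 addr_gt0.
have riu : ri <= N d^-1.
  rewrite NV /ri ler_pdivrMr ?sqrtr_gt0 ?addr_gt0 // ler_peMr ?invr_ge0 ?(ltW u0) //.
  by have := @ler_wsqrtr _ 1 (1 + la); rewrite sqrtr1; apply; rewrite lerDl ltW.
pose x := u ^+ (4 * n) * pi * ri ^+ (2 * n) / n%:R / n.-1`!%:R ^+ 2.
have x0 : 0 < x.
  by rewrite !divr_gt0 ?mulr_gt0 ?exprn_gt0 ?pi_gt0 ?ltr0n ?fact_gt0.
exists x => // mu a mw bdd complete muB epsa aB mua.
have a0 : 0 < a by exact: lt_trans epsa.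
pose T z := ((z - (zeta + d))^-1 + d^-1) ^+ n * n%:R^-1.
have far z : D z -> mu z <= a + eps \/ N (dd 1 T z) ^+ 2 <= (r ^+ n.-1 * k) ^+ 2.
  move=> Dz'; have [h|h] := ltP (N (z - p)) eta.
    by left; have := mua z Dz' h; rewrite ler_norml => /andP[_]; rewrite lerBlDr addrC.
  right; rewrite (modulus_dd_test n0 nDc Dz') modulusM modulusX modulusV modulusX.
  have zc : eta / 2 <= N (z - (zeta + d)).
    have := modulusD (z - (zeta + d)) (zeta + d - p).
    have -> : z - (zeta + d) + (zeta + d - p) = z - p by ring.
    by move: h cp; move: (N (z - p)) (N (z - _)) (N (zeta + d - p)); move=> *; lra.
  have z2 : 0 < N (z - (zeta + d)) by apply: lt_le_trans zc; rewrite divr_gt0.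
  have X0 : 0 <= N ((z - (zeta + d))^-1 + d^-1) ^+ n.-1 by rewrite exprn_ge0 ?modulus_ge0.
  have Y0 : 0 <= N (z - (zeta + d)) ^- 2 by rewrite invr_ge0 sqr_ge0.
  have r1 : 0 <= r ^+ n.-1 by rewrite exprn_ge0 // ltW.
  have k0 : 0 <= k by exact: sqr_ge0.
  rewrite ler_sqr ?nnegrE; [|exact: mulr_ge0|exact: mulr_ge0].
  apply: ler_pM => //.
    by apply: lerXn2r; rewrite ?nnegrE ?modulus_ge0 ?(ltW r0) // ltW // DW.
  have e2 : 0 < eta / 2 by rewrite divr_gt0.
  rewrite -exprVn; apply: lerXn2r; rewrite ?nnegrE ?invr_ge0 ?modulus_ge0 ?divr_ge0 ?(ltW eta0) //.
  by rewrite -invf_div lef_pV2 ?posrE.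
have ae0 : 0 <= a + eps by rewrite addr_ge0 ?ltW.
have M0 : 0 <= (r ^+ n.-1 * k) ^+ 2 by exact: sqr_ge0.
have [ADT ET] := test_energy oD Dz n0 d0 nDc mw ae0 B0 M0 Rb0 r0 muB Db DW far.
have [T0 Tn] := dd_test oD Dz n0 d0 nDc.
have VT : V D mu n zeta T by apply/AD_dd; exact: ADT.
have Tn0 : dd n T zeta != 0.
  by rewrite -modulus_gt0 Tn mulr_gt0 ?invr_gt0 ?exprn_gt0 // ltr0n fact_gt0.
have [F [[VF F1] Fmin KF]] := kernel_energy oD cD Dz n0 mw bdd complete VT Tn0.
have ADF : AD D mu n zeta F by apply/AD_dd; exact: VF.
have lo0 : 0 <= a - eps by rewrite subr_ge0 ltW.
have low : (a - eps) * x <= energy D mu (dd 1 F).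
  apply: (energy_lower oD mw Dz n0 lo0 ri0 riu _ _ ADF F1) => z /Win[Dz' zp]; first exact: Dz'.
  by have := mua z Dz' zp; rewrite ler_norml lerBrDr addrC => /andP[+ _].
exists (energy D mu (dd 1 F)); split; [|exact: KF|exact: low|].
  by apply: lt_le_trans low; rewrite mulr_gt0 // subr_gt0.
have Nc : normalized D mu n zeta (fun z => (dd n T zeta)^-1 * T z).
  split; first exact: (AD_scale oD Dz mw _ VT).
  by rewrite (dd_scale oD Dz _ _ VT) mulVf.
apply: (le_trans (Fmin _ Nc)).
rewrite (energy_dd_scale _ oD mw VT) modulusV Tn exprVn mulrC.
apply: (@le_trans _ _ (((a + eps) * (pi * r ^+ (2 * n) / n%:R) +
    B * (r ^+ n.-1 * k) ^+ 2 * (pi * Rb ^+ 2)) / (n.-1`!%:R * u ^- (2 * n)) ^+ 2)).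
  by apply: ler_wpM2r; [rewrite invr_ge0 sqr_ge0|exact: ET].
have la01 : 0 < la < 1 by rewrite la0.
rewrite (test_ratio (a + eps) B k Rb u0 la01 n0) -/ri -/x mulrC; apply: ler_wpM2r; first exact: ltW.
exact: (@ratio_bound _ u la theta a B C eps n (ltW u0)).
Qed.

End Asymptotics.

(** m and a m1 differ by at most 2 (a + 1) eps x, and a x <= 2 m; dividing, [x] drops out. *)
Lemma ratio_close (R : realType) (a e eps x m1 m : R) : 0 < a -> 0 < e -> 0 < x -> 0 < m ->
  0 < eps -> eps <= a / 2 -> eps * (4 * (a + 1)) < e * a ^+ 2 ->
  (1 - eps) * x <= m1 -> m1 <= (1 + 2 * eps) * x ->
  (a - eps) * x <= m -> m <= (a + 2 * eps) * x -> `|a^-1 - m1 / m| < e.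
Proof.
move=> a0 e0 x0 m0 eps0 epsa he h1 h2 h3 h4.
have -> : a^-1 - m1 / m = (m - a * m1) / (a * m) by field; rewrite !gt_eqF.
have am : 0 < a * m by rewrite mulr_gt0.
rewrite normrM normfV (gtr0_norm am) ltr_pdivrMr //.
have h5 : a * x <= 2 * m.
  apply: (@le_trans _ _ (2 * ((a - eps) * x))); last by rewrite ler_wpM2l.
  by rewrite mulrA ler_wpM2r ?(ltW x0) //; lra.
apply: (@le_lt_trans _ _ (2 * (a + 1) * (eps * x))).
  have h6 : a * m1 <= a * ((1 + 2 * eps) * x) by rewrite ler_wpM2l ?(ltW a0).
  have h7 : a * ((1 - eps) * x) <= a * m1 by rewrite ler_wpM2l ?(ltW a0).
  have ex : 0 < eps * x by rewrite mulr_gt0.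
  have ax : 0 < a * (eps * x) by rewrite mulr_gt0.
  rewrite ler_norml; apply/andP; split; lra.
rewrite -(ltr_pM2l a0).
apply: (@le_lt_trans _ _ (2 * (a + 1) * eps * (2 * m))).
  have -> : a * (2 * (a + 1) * (eps * x)) = 2 * (a + 1) * eps * (a * x) by ring.
  by rewrite ler_wpM2l // !mulr_ge0 ?(ltW eps0) //; lra.
have -> : 2 * (a + 1) * eps * (2 * m) = eps * (4 * (a + 1)) * m by ring.
have -> : a * (e * (a * m)) = e * a ^+ 2 * m by ring.
by rewrite ltr_pM2r.
Qed.

(** The bound in [bounded_set] is a real element of R[i], whence the passage through its real
    part. *)
Lemma bounded_modulus (R : realType) (D : set R[i]) : bounded_set D ->
  exists2 Rb : R, 0 < Rb & forall z, D z -> modulus z < Rb.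
Proof.
move=> [M [Mr HM]].
have b0 : 0 < `|complex.Re M| + 1 by rewrite ltr_wpDl.
exists (`|complex.Re M| + 1 + 1) => [|z Dz]; first by rewrite addr_gt0.
have : M < (`|complex.Re M| + 1)%:C.
  by rewrite -(RRe_real Mr) ltcR ltr_pwDr // ler_norm.
move=> /HM /(_ z Dz) /=; rewrite normcE lecR => h.
by apply: le_lt_trans h _; rewrite ltrDl.
Qed.

Lemma within_modulus (R : realType) (D : set R[i]) p (P : set R[i]) :
  (exists2 d : R, 0 < d & forall z, D z -> modulus (z - p) < d -> P z) <->
  (\forall z \near within D (nbhs p), P z).
Proof.
split=> [[d d0 H]|].
  apply/nbhs_ballP; exists d%:C => /=; first by rewrite ltcR.
  by move=> z; rewrite -ball_normE /= distrC normc_lt => h Dz; exact: H.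
move=> /nbhs_ballP[e /= /gt0_complexP[d d0 ->] H]; exists d => // z Dz zp.
by apply: (H z) => //; rewrite -ball_normE /= distrC normc_lt.
Qed.

Theorem theorem1p13 (R : realType) (D : set R[i]) (p : R[i])
    (nu : R[i] -> R) (n : nat)
    (hD : domain D) (hDb : bounded_set D) (hp : boundary D p)
    (hnu : class_A D p nu) (hn : (0 < n)%N) (hC2 : C2_boundary_near D p) :
  sim D p ((nu p)^-1)%:C
    (fun z => reduced_kernel_deriv D nu n n.-1 z z)
    (fun z => reduced_kernel_deriv D (fun=> 1) n n.-1 z z).
Proof.
have [oD cD _] := hD; have [adm [B0 nuB] nuc a0] := hnu.
have [nw _ _] := adm; have [bdd complete] := admissible_complete oD adm.
have [bdd1 complete1] := one_complete oD.
have [Rb Rb0 Db] := bounded_modulus hDb.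
have [R0 [L0 [Ga [ga [G [t [R00 L00 Ga0 ga0 discs]]]]]]] := C2_tangent_discs oD hp hC2.
set a := nu p in nuc a0 *.
(* One bound for both weights and both limit values, as [kernel_asymptotics] fixes B before the
   weight. *)
pose B := Num.max (Num.max B0 1) a.
have [B0B B1 Ba] : [/\ B0 <= B, 1 <= B & a <= B] by rewrite /B !le_max !lexx !orbT.
apply/cvgrPdist_lt => _ /gt0_complexP[e e0 ->].
(* The first two terms keep eps below the limit values 1 and a of the weights; the last is the
   smallness condition of [ratio_close], with a factor 2 to make it strict. *)
pose eps := Num.min (Num.min (1 / 2) (a / 2)) (e * a ^+ 2 / (8 * (a + 1))).
have a1 : 0 < a + 1 by rewrite addr_gt0.
have eps0 : 0 < eps by rewrite !lt_min !divr_gt0 ?mulr_gt0 ?exprn_gt0.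
have [eps1 epsa epse] : [/\ eps <= 1 / 2, eps <= a / 2 & eps <= e * a ^+ 2 / (8 * (a + 1))].
  by rewrite /eps !ge_min !lexx !orbT.
have he : eps * (4 * (a + 1)) < e * a ^+ 2.
  have ea : 0 < e * a ^+ 2 by rewrite mulr_gt0 ?exprn_gt0.
  move: epse; rewrite ler_pdivlMr ?mulr_gt0 // => h; apply: lt_le_trans h.
  by rewrite ltr_pM2l // ltr_pM2r // ltr_nat.
have [eta1 eta10 Heta] : exists2 d : R, 0 < d & forall z, D z -> modulus (z - p) < d -> `|a - nu z| < eps.
  by apply/within_modulus; have /cvgrPdist_lt /(_ _ eps0) := nuc.
pose eta := Num.min eta1 R0.
have eta0 : 0 < eta by rewrite lt_min eta10.
have [etaR eta_1] : eta <= R0 /\ eta <= eta1 by rewrite /eta !ge_min !lexx orbT.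
have B_ge0 : 0 <= B by exact: le_trans B1.
have [de de0 H] := kernel_asymptotics oD cD hn R00 L00 Ga0 ga0 Rb0 Db discs eta0 etaR B_ge0 eps0.
apply/within_modulus; exists de => // z Dz zp.
have [x x0 Hx] := H z Dz zp.
have nuB' : {ae area R, forall w, region D w -> nu (cplx w) <= B}.
  by apply: filterS nuB => w h Dw; apply: le_trans B0B; apply: le_trans (h Dw); exact: ler_norm.
have oneB : {ae area R, forall w, region D w -> (fun=> 1 : R) (cplx w) <= B}.
  by apply: aeW => w _.
have epsa' : eps < a by apply: le_lt_trans epsa _; rewrite ltr_pdivrMr // ltr_pMr // ltr1n.
have eps1' : eps < 1 by apply: le_lt_trans eps1 _; rewrite ltr_pdivrMr // mul1r ltr1n.
have near_nu w : D w -> modulus (w - p) < eta -> `|nu w - a| <= eps.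
  by move=> Dw wp; rewrite distrC ltW // Heta // (lt_le_trans wp).
have near_1 w : D w -> modulus (w - p) < eta -> `|(fun=> 1 : R) w - 1| <= eps.
  by move=> _ _; rewrite subrr normr0 ltW.
have [m [m0 -> lm um]] := Hx nu a nw bdd complete nuB' epsa' Ba near_nu.
have [m1 [m10 -> lm1 um1]] := Hx _ 1 (weight_one D) bdd1 complete1 oneB eps1' B1 near_1.
(* The kernels are the inverses of the energies, so their quotient is m1 / m, with limit 1 / a. *)
have -> : ((m^-1)%:C : R[i]) / (m1^-1)%:C = (m1 / m)%:C.
  by rewrite -fmorphV -rmorphM /= invrK mulrC.
rewrite -rmorphB normc_lt modulus_real.
exact: (@ratio_close _ a e eps x m1 m).
Qed.
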